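(* There exists an absolute constant $R>0$ such that the following holds. Let $p\ge 3$ and $m\ge 10^{11}R^3$ be fixed integers, let $\lambda>0$ be fixed with $$\frac{\lambda^{4m}(2pm)!}{2^{pm}(p!)^{2m}(mp)!(2m)!}>10^{pm}R,$$ and let $\ell=\ell_n$ be integers with $\ell\to\infty$ and $\ell=o\big(\tfrac{\log n}{\log\log n}\big)$ as $n\to\infty$. Let $\mathcal H=\mathcal H(m,p,\ell)$, let $0<C<1$ be any fixed constant and put $\tau=C\,\mathbb E_{\mathbb P}[f_{\mathcal H}(\boldsymbol Y)]$. Then, as $n\to\infty$, $$\mathbb P\big(f_{\mathcal H}(\boldsymbol Y)\le\tau\big)+\mathbb Q\big(f_{\mathcal H}(\boldsymbol Y)\ge\tau\big)=o(1).$$ In particular, the test $\mathcal A$ with $\mathcal A(\boldsymbol Y)=1$ if $f_{\mathcal H}(\boldsymbol Y)\ge\tau$ and $\mathcal A(\boldsymbol Y)=0$ if $f_{\mathcal H}(\boldsymbol Y)<\tau$ achieves strong detection between $\mathbb P$ and $\mathbb Q$, that is, $\mathbb P(\mathcal A(\boldsymbol Y)=0)+\mathbb Q(\mathcal A(\boldsymbol Y)=1)\to 0$.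
   Context: Model. Let $\widetilde{\boldsymbol G}\in(\mathbb R^n)^{\otimes p}$ have i.i.d. standard normal entries and let $\boldsymbol G_{i_1,\dots,i_p}=\frac1{\sqrt{p!}}\sum_{\pi\in\mathfrak S_p}\widetilde{\boldsymbol G}_{i_{\pi(1)},\dots,i_{\pi(p)}}$. $\mathbb Q$ is the law under which $\boldsymbol Y=\boldsymbol G$. $\mathbb P$ is the law under which $\boldsymbol Y=\lambda n^{-p/4}x_*^{\otimes p}+\boldsymbol G$, with $x_*$ uniform on $\{-1,+1\}^n$ and independent of $\boldsymbol G$. For $e=\{i_1,\dots,i_p\}\subset[n]$ with $|e|=p$, write $\boldsymbol Y_e=\boldsymbol Y_{i_1,\dots,i_p}$. Hypergraphs. A hypergraph $H$ is a finite vertex set $V(H)$ with a set $E(H)$ of nonempty subsets of $V(H)$ (hyperedges); it is $p$-uniform if all hyperedges have size $p$. $\mathsf{deg}_H(v)$ is the number of hyperedges containing $v$; $\mathsf L(H)$ (leaves) is the set of vertices of degree 1. $H$ is connected if the graph on $V(H)$ joining distinct vertices lying in a common hyperedge is connected. $H|_{\setminus X}$ has vertex set $V(H)\setminus X$ and hyperedges $\{e\setminus X: e\in E(H), e\setminus X\ne\emptyset\}$. $[H]$ is the isomorphism class (unlabeled hypergraph) and $\mathsf{Aut}(H)$ the automorphism group of $H$. $S\subset\mathsf K_n$ means $V(S)\subset[n]$. $\mathcal U(m,p)$ is the set of unlabeled $p$-uniform hypergraphs $[U]$ such that: (1) $|V(U)|=mp+1$, $|E(U)|=2m$ and $\mathsf{deg}_U(v)\in\{1,2\}$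 for all $v$ (so $U$ has exactly two leaves); (2) $U$ is connected; (3) $U|_{\setminus\{v\}}$ is connected for all $v\in V(U)$. $\mathcal H(m,p,\ell)$ is the set of unlabeled $p$-uniform hypergraphs $[H]$ for which there are $U_1,\dots,U_\ell$ with $[U_i]\in\mathcal U(m,p)$, $\mathsf L(U_i)=\{v_i,v_{i+1}\}$, $V(U_i)\cap V(U_{i+1})=\{v_{i+1}\}$ for all $1\le i\le\ell$ (indices cyclic: $v_{\ell+1}=v_1$, $U_{\ell+1}=U_1$), non-consecutive $U_i$'s vertex-disjoint, and $V(H)=\bigcup_i V(U_i)$, $E(H)=\bigcup_i E(U_i)$. Such $H$ has $mp\ell$ vertices, $2m\ell$ hyperedges, and all degrees equal to 2. Statistic. $f_S(\boldsymbol Y)=\prod_{e\in E(S)}\boldsymbol Y_e$, $\beta_{\mathcal H}=\sum_{[H]\in\mathcal H}\frac1{|\mathsf{Aut}(H)|}$, and $$f_{\mathcal H}(\boldsymbol Y)=\frac1{\sqrt{n^{mp\ell}\beta_{\mathcal H}}}\sum_{[H]\in\mathcal H}\ \sum_{S\subset\mathsf K_n,\,S\cong H}f_S(\boldsymbol Y).$$ *)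

(* Defs.v *)
From HB Require Import structures.
From mathcomp Require Import all_boot all_order all_algebra all_fingroup.
From mathcomp Require Import all_classical all_reals all_analysis.
Set Implicit Arguments.
Unset Strict Implicit.
Unset Printing Implicit Defensive.
Import Order.TTheory GRing.Theory Num.Theory.
Import numFieldNormedType.Exports.
Local Open Scope ring_scope.

Definition hgraph_wf (T : finType) (VE : {set T} * {set {set T}}) : bool :=
  [forall (e | e \in VE.2), (e != finset.set0) && (e \subset VE.1)].

(* Finite hypergraphs whose vertices are taken from the ambient finite type T;
   hgraph 'I_n is the set of S with S \subset K_n, i.e. V(S) \subset [n]. *)
Record hgraph (T : finType) := HGraph {
  hg_data :> {set T} * {set {set T}};
  hg_wf : hgraph_wf hg_data }.

HB.instance Definition _ (T : finType) := [isSub for @hg_data T].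
HB.instance Definition _ (T : finType) := [Finite of hgraph T by <:].

Definition verts (T : finType) (H : hgraph T) : {set T} := H.1.
Definition edges (T : finType) (H : hgraph T) : {set {set T}} := H.2.

Definition vertex (T : finType) (H : hgraph T) : finType :=
  {x : T | x \in verts H}.

Definition edge_iso (T T' : finType) (H : hgraph T) (H' : hgraph T')
    (f : vertex H -> vertex H') : bool :=
  [forall A : {set vertex H},
     (val @: A \in edges H) == (val @: (f @: A) \in edges H')].

Definition hiso (T T' : finType) (H : hgraph T) (H' : hgraph T') : bool :=
  `[< exists f : vertex H -> vertex H', bijective f /\ edge_iso f >].

Definition Aut (T : finType) (H : hgraph T) : {set {perm vertex H}} :=
  [set s : {perm vertex H} | edge_iso s]%SET.

Definition hdeg (T : finType) (H : hgraph T) (v : T) : nat :=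
  #|[set e in edges H | v \in e]%SET|.

Definition leaves (T : finType) (H : hgraph T) : {set T} :=
  [set v in verts H | hdeg H v == 1%N]%SET.

Definition uniform (T : finType) (p : nat) (H : hgraph T) : bool :=
  [forall (e | e \in edges H), #|e| == p].

Definition hadj (T : finType) (H : hgraph T) : rel T :=
  fun x y => (x != y) && [exists (e | e \in edges H), (x \in e) && (y \in e)].

Definition hconnected (T : finType) (H : hgraph T) : bool :=
  [forall (x | x \in verts H), forall (y | y \in verts H), connect (hadj H) x y].

Lemma hdel_wf (T : finType) (H : hgraph T) (X : {set T}) :
  hgraph_wf (verts H :\: X,
             [set e :\: X | e in edges H & e :\: X != finset.set0]%SET).
Proof.
apply/forall_inP => e /= /imsetP[e0]; rewrite inE => /andP[He0 ne0] ->.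
rewrite ne0 /=; apply: finset.setSD.
by have /forall_inP/(_ e0 He0)/andP[] := hg_wf H.
Qed.

Definition hdel (T : finType) (H : hgraph T) (X : {set T}) : hgraph T :=
  HGraph (hdel_wf H X).

Definition in_calU (T : finType) (m p : nat) (U : hgraph T) : bool :=
  [&& uniform p U,
      #|verts U| == (m * p + 1)%N,
      #|edges U| == (2 * m)%N,
      [forall (v | v \in verts U), (hdeg U v == 1%N) || (hdeg U v == 2%N)],
      hconnected U
    & [forall (v | v \in verts U), hconnected (hdel U [set v]%SET)]].

(* ordS is the cyclic successor on 'I_l. *)
Definition in_calH (T : finType) (m p l : nat) (H : hgraph T) : Prop :=
  uniform p H /\
  exists (U : 'I_l -> hgraph T) (v : 'I_l -> T),
    [/\ forall i, [/\ in_calU m p (U i),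
                      leaves (U i) = [set v i; v (ordS i)]%SET
                    & verts (U i) :&: verts (U (ordS i))
                      = [set v (ordS i)]%SET],
        forall i j, i != j -> j != ordS i -> i != ordS j ->
          [disjoint verts (U i) & verts (U j)],
        verts H = (\bigcup_i verts (U i))%SET
      & edges H = (\bigcup_i edges (U i))%SET].

(* One labelled representative for each unlabelled hypergraph in H(m, p, l).
   Members of H(m, p, l) have m p l vertices (there are none for l = 1, 2), so
   that each class has representatives with vertex set 'I_(m p l). *)
Definition calH (m p l : nat) : {set hgraph 'I_(m * p * l)} :=
  let D := [set H : hgraph 'I_(m * p * l) | `[< in_calH m p l H >]]%SET in
  transversal (equivalence_partition (@hiso _ _) D) D.

Definition tensor (K : Type) (n p : nat) := {ffun 'I_p -> 'I_n} -> K.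

Definition symmetrize (K : realType) (n p : nat) (W : tensor K n p) :
    tensor K n p :=
  fun i => (Num.sqrt (p`!%:R))^-1 * \sum_(s : 'S_p) W [ffun k => i (s k)].

Definition spiked (K : realType) (n p : nat) (lambda : K) (x : 'I_n -> K)
    (G : tensor K n p) : tensor K n p :=
  fun i => lambda * (n%:R `^ (- (p%:R / 4))) * (\prod_(k < p) x (i k)) + G i.

(* Y_e for #|e| = p, read off at some listing of e; the choice of the listing
   does not matter as Y is symmetric. *)
Definition tensor_at (K : realType) (n p : nat) (Y : tensor K n p)
    (e : {set 'I_n}) : K :=
  if [pick i : {ffun 'I_p -> 'I_n} | injectiveb i && (i @: setT == e)]
    is Some i then Y i else 0.

Definition f_sub (K : realType) (n p : nat) (Y : tensor K n p)
    (S : hgraph 'I_n) : K :=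
  \prod_(e in edges S) tensor_at Y e.

Definition beta (K : realType) (m p l : nat) : K :=
  \sum_(H in calH m p l) (#|Aut H|%:R)^-1.

Definition f_calH (K : realType) (n m p l : nat) (Y : tensor K n p) : K :=
  (Num.sqrt (n%:R ^+ (m * p * l) * beta K m p l))^-1 *
  \sum_(H in calH m p l) \sum_(S : hgraph 'I_n | hiso S H) f_sub Y S.

Local Open Scope classical_set_scope.

Definition standard_normal (d : measure_display) (T : measurableType d)
    (K : realType) (P : probability T K) (X : {RV P >-> K}) : Prop :=
  forall A : set K, measurable A -> distribution P X A = normal_prob 0 1 A.

Definition mutually_independent (d : measure_display) (T : measurableType d)
    (K : realType) (P : probability T K) (I : finType) (X : I -> T -> K) :
    Prop :=
  forall (J : {set I}) (B : I -> set K), (forall i, measurable (B i)) ->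
    P [set w | forall i, i \in J -> B i (X i w)] =
    (\prod_(i in J) P [set w | B i (X i w)])%E.

(* Independence of the random vectors (X i)_i and (Z j)_j; measurable boxes
   generate the product sigma-algebras and are stable under intersection. *)
Definition independent_vectors (d : measure_display) (T : measurableType d)
    (K : realType) (P : probability T K) (I J : finType)
    (X : I -> T -> K) (Z : J -> T -> K) : Prop :=
  forall (A : I -> set K) (B : J -> set K),
    (forall i, measurable (A i)) -> (forall j, measurable (B j)) ->
    P [set w | (forall i, A i (X i w)) /\ (forall j, B j (Z j w))] =
    (P [set w | forall i, A i (X i w)] * P [set w | forall j, B j (Z j w)])%E.

Definition uniform_signs (d : measure_display) (T : measurableType d)
    (K : realType) (P : probability T K) (n : nat) (x : 'I_n -> T -> K) : Prop :=
  forall s : {ffun 'I_n -> bool},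
    P [set w | forall j, x j w = (-1) ^+ s j] = ((2 ^+ n)^-1)%:E.

Definition noise (d : measure_display) (T : measurableType d) (K : realType)
    (P : probability T K) (n p : nat)
    (W : {ffun 'I_p -> 'I_n} -> {RV P >-> K}) (w : T) : tensor K n p :=
  symmetrize (fun i => W i w).

(* A probability space carrying both laws: W is the i.i.d. Gaussian tensor and
   x the signal x_*. *)
Definition tensor_pca_model (d : measure_display) (T : measurableType d)
    (K : realType) (P : probability T K) (n p : nat)
    (W : {ffun 'I_p -> 'I_n} -> {RV P >-> K}) (x : 'I_n -> {RV P >-> K}) :
    Prop :=
  [/\ forall i, standard_normal (W i),
      mutually_independent P (fun i => W i : T -> K),
      uniform_signs P (fun j => x j : T -> K)
    & independent_vectors P (fun j => x j : T -> K)
        (fun i w => noise W w i)].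

Definition Y_Q (d : measure_display) (T : measurableType d) (K : realType)
    (P : probability T K) (n p : nat)
    (W : {ffun 'I_p -> 'I_n} -> {RV P >-> K}) (w : T) : tensor K n p :=
  noise W w.

Definition Y_P (d : measure_display) (T : measurableType d) (K : realType)
    (P : probability T K) (n p : nat) (lambda : K)
    (W : {ffun 'I_p -> 'I_n} -> {RV P >-> K}) (x : 'I_n -> {RV P >-> K})
    (w : T) : tensor K n p :=
  spiked lambda (fun j => x j w) (noise W w).

Definition threshold (d : measure_display) (T : measurableType d)
    (K : realType) (P : probability T K) (n m p l : nat) (C lambda : K)
    (W : {ffun 'I_p -> 'I_n} -> {RV P >-> K}) (x : 'I_n -> {RV P >-> K}) :
    \bar K :=
  (C%:E * 'E_P[fun w => f_calH m l (Y_P lambda W x w)])%E.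

Definition test (K : realType) (n m p l : nat) (tau : \bar K)
    (Y : tensor K n p) : bool :=
  (tau <= (f_calH m l Y)%:E)%E.

(* Main.v *)
(* The proof is by the second moment method. Up to a common factor the
   statistic is the sum of the monomials f_S over the M copies S of the
   hypergraphs in [n]. With a = lambda n^(-p/4), N = m p l and E = 2 m l, even
   degrees make the signs cancel, so that E_P f_S = a^E, E_Q f_S f_S' = [S = S']
   and E_P f_S f_S' / a^(2E) = (1 + a^(-2))^|S cap S'|. By Chebyshev's
   inequality it suffices that
     E_Q f^2 / (E_P f)^2 = n^N / (lambda^(2E) M)  and
     M^(-2) sum_(S, S') (1 + a^(-2))^|S cap S'| - 1
   tend to 0. As all degrees are 2 and S is connected, a proper nonempty set J
   of hyperedges of S covers more than p |J| / 2 vertices, so that few copies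
   contain J and the overlaps of this type contribute a factor n^(-1/2 + o(1)),
   because (E N)^O(l) = n^o(1). What remains is a lower bound on M: gluing, in
   each of the l blocks, two systems of m disjoint hyperedges into a cycle, with
   the (m (p - 2) - 1)! matchings of the remaining positions, produces every
   copy at most E (p!)^E times, since a copy, one of its hyperedges and
   listings of all hyperedges determine the gluing. *)
Require Import Defs.
From HB Require Import structures.
From mathcomp Require Import all_boot all_order all_algebra all_fingroup.
From mathcomp Require Import boolp zify.
Set Implicit Arguments.
Unset Strict Implicit.
Unset Printing Implicit Defensive.

(** * Factorial bounds *)

(** The threshold is a multiple of the mean, so the normalisation of the statistic and the
    automorphism numbers cancel, and only the number M of labelled copies matters. The obstacle in
    bounding M from below is that an arbitrary gluing of hyperedges need not give connected blocks
    that survive the deletion of a vertex. Hence 2m+1 of the q = mp slots of a block are frozen into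
    a skeleton (a cycle of 2m hyperedges and a junction), and only the other q-2m-1 are permuted.
    The numerical hypothesis pays for this loss: (2q)! <= 4^q (q!)^2 turns 10^q 2^q into 5^q, and
    5^q covers the quotient of 2 q! by (2m)! (q-2m-1)!. A factor 2 per block is left, so that 2^l
    beats the factor E = 2ml lost to the choice of a root hyperedge; in this way R = 1 suffices. Up
    to a constant, the quotient n^N / (lambda^(2E) M) also bounds the relative variance under P.
    Powers of n are written through y = sqrt n: a strict inequality between the integers p|J| and
    2|cover J| then saves a full factor y. *)

Lemma bin_central_le k : 'C(k.*2, k) <= 4 ^ k.
Proof.
have -> : 4 ^ k = \sum_(i < k.*2.+1) 'C(k.*2, i).
  have := expnDn 1 1 k.*2; rewrite addn1 -{1}mul2n expnM => ->.
  by apply: eq_bigr => i _; rewrite !exp1n !muln1.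
have kk : k < k.*2.+1 by lia.
by rewrite (bigD1 (Ordinal kk))//= leq_addr.
Qed.

Lemma fact_double_le k : (k.*2)`! <= 4 ^ k * k`! ^ 2.
Proof.
have kk : k <= k.*2 by lia.
rewrite -(bin_fact kk) (_ : k.*2 - k = k); last by lia.
by rewrite mulnn leq_mul2r bin_central_le orbT.
Qed.

(** Weak Stirling bound: each of the k factors of (2k)!/k! is at least k, so k^k k! <= (2k)! <= 4^k
    (k!)^2. *)
Lemma expn_fact_le k : k ^ k <= 4 ^ k * k`!.
Proof.
have kk : k <= k.*2 by lia.
have H : k ^ k * k`! <= (k.*2)`!.
  rewrite -(ffact_fact kk) (_ : k.*2 - k = k); last by lia.
  rewrite leq_mul2r; apply/orP; right.
  have : forall j r, k <= r -> k ^ j <= (r + j) ^_ j.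
    elim=> [|j IH] r kr; first by rewrite expn0 ffactn0.
    rewrite expnS addnS ffactSS leq_mul//; first by lia.
    exact: IH.
  by move=> /(_ k k (leqnn k)); rewrite addnn.
rewrite -(leq_pmul2r (fact_gt0 k)) -mulnA mulnn.
exact: leq_trans H (fact_double_le k).
Qed.

Lemma cube_le_exp5 p : 3 <= p -> 4 * p ^ 3 <= 5 ^ p.
Proof.
elim: p => // p IH; rewrite leq_eqVlt => /orP[/eqP <- //|p3].
have {}IH := IH p3; rewrite [5 ^ p.+1]expnS.
apply: leq_trans (leq_mul (leqnn 5) IH).
by rewrite !expnS !expn0; nia.
Qed.

Lemma double_le_exp3 m : 3 <= m -> 2 * m <= 3 ^ m.-1.
Proof.
case: m => // m; elim: m => // m IH; rewrite ltnS leq_eqVlt => /orP[/eqP <- //|m2].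
by have := IH m2; rewrite /= expnS; lia.
Qed.

(** The largest 2m+1 factors of q! are at most q each, which leaves q^(2m+1) to be compared with 5^q
    (2m)!. As (2m)! >= (m/2)^(2m), it suffices that 2q (2p)^(2m) <= (4 p^3)^m, and [cube_le_exp5]
    bounds the right side by 5^q. *)
Lemma fact_ratio_le p m : 3 <= p -> 3 <= m ->
  2 * (m * p)`! <= 5 ^ (m * p) * (2 * m)`! * ((m * (p - 2)).-1)`!.
Proof.
move=> p3 m3; set q := m * p; set F := ((m * (p - 2)).-1)`!.
have pp : m * (p - 2) = q - 2 * m by rewrite mulnBr mulnC [m * 2]mulnC mulnC.
have q2m : 2 * m < q by rewrite /q; nia.
have H1 : q`! <= q ^ (2 * m).+1 * F.
  rewrite -(ffact_fact (_ : (2 * m).+1 <= q))//.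
  rewrite /F pp (_ : (q - 2 * m).-1 = q - (2 * m).+1); last by lia.
  rewrite leq_mul2r; apply/orP; right.
  elim: (2 * m).+1 => [|j IH]; first by rewrite ffactn0 expn0.
  by rewrite ffactnSr expnSr leq_mul// leq_subr.
have H2 := expn_fact_le (2 * m).
suff H3 : 2 * q ^ (2 * m).+1 * 4 ^ (2 * m) <= 5 ^ q * (2 * m) ^ (2 * m).
  have : 2 * q`! * 4 ^ (2 * m) <= (5 ^ q * (2 * m)`! * F) * 4 ^ (2 * m).
    apply: leq_trans (_ : 2 * (q ^ (2 * m).+1 * F) * 4 ^ (2 * m) <= _).
      by apply: leq_mul => //; apply: leq_mul.
    apply: leq_trans (_ : (5 ^ q * (2 * m) ^ (2 * m)) * F <= _).
      by apply: leq_trans (leq_mul H3 (leqnn F)); lia.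
    by apply: leq_trans (leq_mul (leq_mul (leqnn (5 ^ q)) H2) (leqnn F)) _; lia.
  by rewrite leq_pmul2r// expn_gt0.
have -> : 4 ^ (2 * m) = 2 ^ (2 * m) * 2 ^ (2 * m) by rewrite -expnMn.
have -> : (2 * m) ^ (2 * m) = 2 ^ (2 * m) * m ^ (2 * m) by rewrite expnMn.
have -> : 2 * q ^ (2 * m).+1 * (2 ^ (2 * m) * 2 ^ (2 * m)) =
  (2 * q * (2 * p) ^ (2 * m)) * (2 ^ (2 * m) * m ^ (2 * m)).
  by rewrite expnS {2}/q !expnMn; lia.
rewrite leq_mul2r; apply/orP; right.
have H4 : (4 * p ^ 3) ^ m <= 5 ^ q.
  by rewrite /q [m * p]mulnC expnM leq_exp2r ?cube_le_exp5//; lia.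
apply: leq_trans H4.
(* The spare [p ^ m] pays for 2q = 2mp: one factor p for itself, the others for 2m <= 3^(m-1). *)
have -> : (4 * p ^ 3) ^ m = (2 * p) ^ (2 * m) * p ^ m.
  by rewrite expnM -expnMn; congr (_ ^ _); rewrite !expnS !expn0; lia.
rewrite mulnC leq_mul2l; apply/orP; right.
have -> : p ^ m = p ^ m.-1 * p by rewrite -expnSr prednK//; lia.
rewrite /q mulnA leq_mul2r; apply/orP; right.
apply: leq_trans (double_le_exp3 m3) _.
by rewrite leq_exp2r//; lia.
Qed.

(** * Copies of the hypergraphs *)

Section EdgeSets.
Variable T : finType.
Implicit Types (J : {set {set T}}) (v : T).

Definition edeg J v : nat := #|[set e in J | v \in e]|.

Lemma edeg_sub J J' v : J' \subset J -> edeg J' v <= edeg J v.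
Proof.
move=> sub; apply: subset_leq_card; apply/subsetP => e; rewrite !inE => /andP[eJ ->].
by rewrite (subsetP sub).
Qed.

Lemma edeg_gt0 J v : (0 < edeg J v) = (v \in cover J).
Proof.
apply/card_gt0P/bigcupP => [[e]|[e eJ ve]]; last by exists e; rewrite inE eJ.
by rewrite inE => /andP[eJ ve]; exists e.
Qed.

Lemma sum_edeg J : \sum_v edeg J v = \sum_(e in J) #|e|.
Proof.
under eq_bigr do rewrite /edeg -sum1dep_card big_mkcondr.
rewrite exchange_big/=; apply: eq_bigr => e eJ.
by rewrite -sum1_card [RHS]big_mkcond.
Qed.

Lemma edeg_bigcup (I : finType) (F : I -> {set {set T}}) v :
  (forall i j, i != j -> [disjoint F i & F j]) ->
  edeg (\bigcup_i F i) v = \sum_i edeg (F i) v.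
Proof.
move=> dis; rewrite /edeg -sum1dep_card big_mkcondr.
rewrite (partition_disjoint_bigcup addn (fun e : {set T} => if v \in e then 1 else 0) dis).
by apply: eq_bigr => i _; rewrite -sum1dep_card big_mkcondr.
Qed.

End EdgeSets.

(** The interface between the block structure and the overlap estimates; it is invariant under
    isomorphism. As all degrees are 2, having no vertex of degree one in [J] is what makes [J]
    closed under adjacency. *)
Record good (T : finType) (p N k : nat) (S : hgraph T) : Prop := Good {
  good_card : {in edges S, forall e : {set T}, #|e| = p};
  good_edges : #|edges S| = k;
  good_verts : #|verts S| <= N;
  good_deg : {in verts S, forall v, edeg (edges S) v = 2};
  (* A set of hyperedges closed under adjacency is empty or everything. *)
  good_conn : forall J : {set {set T}}, J \subset edges S -> J != set0 ->
    {in cover J, forall v, edeg J v != 1} -> J = edges S }.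

Section HgraphBasics.
Variables (T : finType) (H : hgraph T).

Lemma edge_sub e : e \in edges H -> e \subset verts H.
Proof. by move=> eH; have /forall_inP/(_ e eH)/andP[] := hg_wf H. Qed.

Lemma edge_neq0 e : e \in edges H -> e != set0.
Proof. by move=> eH; have /forall_inP/(_ e eH)/andP[] := hg_wf H. Qed.

Lemma cover_edges : cover (edges H) \subset verts H.
Proof. by apply/bigcupsP => e; exact: edge_sub. Qed.

Lemma hgraph_eqP (H' : hgraph T) : verts H = verts H' -> edges H = edges H' -> H = H'.
Proof.
rewrite /verts /edges => h1 h2; apply: val_inj => /=.
by case: (H : _ * _) (H' : _ * _) h1 h2 => a b [c d] /= -> ->.
Qed.

End HgraphBasics.

Section OrdS.
Variable l : nat.
Implicit Types i j : 'I_l.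

Lemma val_iter_ordS k i : iter k (@ordS l) i = (i + k) %% l :> nat.
Proof.
elim: k => [|k IH] /=; first by rewrite addn0 modn_small.
by rewrite IH -addn1 modnDml addn1 addnS.
Qed.

Lemma ordS_reach i j : exists2 k, k < l & iter k (@ordS l) i = j.
Proof.
have il := ltn_ord i; exists ((l - i + j) %% l); first by rewrite ltn_mod; lia.
apply: val_inj => /=; rewrite val_iter_ordS modnDmr.
have -> : i + (l - i + j) = l + j by lia.
by rewrite modnDl modn_small.
Qed.

Lemma iter_ordS_neq k i : 0 < k < l -> iter k (@ordS l) i != i.
Proof.
move=> /andP[k0 kl]; apply/eqP => /(congr1 val) /=; rewrite val_iter_ordS.
have il := ltn_ord i; case: (ltnP (i + k) l) => h; first by rewrite modn_small//; lia.
have -> : i + k = (i + k - l) + l by lia.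
by rewrite modnDr modn_small; lia.
Qed.

End OrdS.

Lemma in_calUP (T : finType) m p (U : hgraph T) : in_calU m p U ->
  [/\ {in edges U, forall e : {set T}, #|e| = p}, #|edges U| = 2 * m,
      {in verts U, forall v, (edeg (edges U) v == 1) || (edeg (edges U) v == 2)} &
      hconnected U].
Proof.
move=> /andP[/forall_inP h1 /andP[_ /andP[/eqP h2 /andP[/forall_inP h3 /andP[h4 _]]]]].
by split => // e /h1/eqP.
Qed.

Section CalH.
Variables (T : finType) (m p l : nat) (H : hgraph T).
Hypotheses (p3 : 3 <= p) (l4 : 4 <= l) (HH : in_calH m p l H).

(** An interior vertex of a block has degree two there and lies in no other block; a junction is a
    leaf of exactly two blocks. For [good_conn], closure under adjacency fills each connected block
    that it meets and passes through the junctions around the whole cycle. *)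
Lemma in_calH_good N : #|verts H| <= N -> good p N (2 * m * l) H.
Proof.
move=> vN; case: HH => Hunif [U [v [HU Hdis Hv He]]].
have edgeU i e : e \in edges (U i) -> #|e| = p.
  by have [/in_calUP[h _ _ _] _ _] := HU i => /h.
have ordS_neq (i : 'I_l) : ordS i != i by apply: (@iter_ordS_neq l 1 i); lia.
(* A third block through a junction would have to be consecutive to both blocks meeting there,
   closing a cycle of three blocks; [l4] excludes this. *)
have ordSSS_neq (i : 'I_l) : ordS (ordS (ordS i)) != i by apply: (@iter_ordS_neq l 3 i); lia.
have capU i j : i != j -> verts (U i) :&: verts (U j) \subset leaves (U i).
  move=> ij; have [ji|ji] := eqVneq j (ordS i).
    by rewrite ji; have [_ -> ->] := HU i; rewrite sub1set !inE eqxx orbT.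
  have [ij'|ij'] := eqVneq i (ordS j).
    rewrite setIC {1}ij'; have [_ _ ->] := HU j; have [_ -> _] := HU i.
    by rewrite sub1set !inE -ij' eqxx.
  by have := Hdis i j ij ji ij'; rewrite -setI_eq0 => /eqP ->; rewrite sub0set.
have cap1 i j : i != j -> #|verts (U i) :&: verts (U j)| <= 1.
  move=> ij; have [ji|ji] := eqVneq j (ordS i).
    by rewrite ji; have [_ _ ->] := HU i; rewrite cards1.
  have [ij'|ij'] := eqVneq i (ordS j).
    by rewrite setIC {1}ij'; have [_ _ ->] := HU j; rewrite cards1.
  by have := Hdis i j ij ji ij'; rewrite -setI_eq0 => /eqP ->; rewrite cards0.
(* Two blocks share at most one vertex, whereas a hyperedge has p >= 3 vertices. *)
have disE i j : i != j -> [disjoint edges (U i) & edges (U j)].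
  move=> ij; rewrite -setI_eq0; apply/eqP/setP => e; rewrite !inE; apply/negbTE/negP.
  move=> /andP[ei ej]; have : e \subset verts (U i) :&: verts (U j).
    by rewrite subsetI !edge_sub.
  by move=> /subset_leq_card; have := cap1 i j ij; rewrite (edgeU i e ei); lia.
have degU i x : x \in verts (U i) -> x \notin leaves (U i) -> edeg (edges (U i)) x = 2.
  move=> xi; have [/in_calUP[_ _ /(_ x xi) h _] _ _] := HU i.
  move=> xL; case/orP: h => /eqP // h; move: xL; rewrite inE xi /=.
  by rewrite (h : hdeg (U i) x = 1).
have degL i x : x \in leaves (U i) -> edeg (edges (U i)) x = 1.
  by rewrite inE => /andP[_ /eqP].
have deg0 i x : x \notin verts (U i) -> edeg (edges (U i)) x = 0.
  move=> xi; apply/eqP; rewrite -leqn0 leqNgt edeg_gt0; apply: contra xi.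
  by move/(subsetP (cover_edges (U i))).
have degH x : edeg (edges H) x = \sum_i edeg (edges (U i)) x.
  by rewrite He edeg_bigcup.
have deg_junction i : edeg (edges H) (v (ordS i)) = 2.
  have [_ Li Ci] := HU i; have [_ LSi _] := HU (ordS i).
  have vin : v (ordS i) \in verts (U i) :&: verts (U (ordS i)) by rewrite Ci inE.
  move: (vin); rewrite inE => /andP[v1 v2].
  rewrite degH (bigD1 i)//= (bigD1 (ordS i))//= big1 ?addn0.
    by rewrite !degL// ?Li ?LSi !inE eqxx ?orbT.
  move=> j /andP[ji jSi]; apply: deg0; apply/negP => vj.
  have nd k : v (ordS i) \in verts (U k) -> k != j -> j = ordS k \/ k = ordS j.
    move=> vk kj; have [->|h1] := eqVneq j (ordS k); first by left.
    have [->|h2] := eqVneq k (ordS j); first by right.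
    have := Hdis k j kj h1 h2; rewrite -setI_eq0 => /eqP/setP/(_ (v (ordS i))).
    by rewrite !inE vk vj.
  have ij : i != j by rewrite eq_sym.
  have Sij : ordS i != j by rewrite eq_sym.
  case: (nd i v1 ij) => [E|E]; first by rewrite E eqxx in jSi.
  case: (nd (ordS i) v2 Sij) => [E'|E'].
    by have := ordSSS_neq i; rewrite -E' -E eqxx.
  by move: ij; rewrite (ordS_inj E') eqxx.
have vertsUsub i : verts (U i) \subset verts H by rewrite Hv; exact: (bigcup_sup i).
have edgesUsub i : edges (U i) \subset edges H by rewrite He; exact: (bigcup_sup i).
have degE x : x \in verts H -> edeg (edges H) x = 2.
  rewrite Hv => /bigcupP[i _ xi].
  case: (boolP (x \in leaves (U i))) => xL; last first.
    rewrite degH (bigD1 i)//= degU// big1 ?addn0// => j ji; apply: deg0.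
    apply: contra xL => xj; rewrite eq_sym in ji.
    by apply: (subsetP (capU i j ji)); rewrite inE xi.
  have [_ Li _] := HU i; move: xL; rewrite Li !inE => /orP[/eqP ->|/eqP ->].
    by rewrite -(ord_predK i); exact: deg_junction.
  exact: deg_junction.
split.
- by move=> e eH; have /forall_inP/(_ e eH)/eqP := Hunif.
- rewrite He -sum1_card (partition_disjoint_bigcup addn (fun=> 1) disE).
  under eq_bigr => i _.
    rewrite sum1_card; have [/in_calUP[_ -> _ _] _ _] := HU i; over.
  by rewrite sum_nat_const card_ord mulnC.
- exact: vN.
- exact: degE.
move=> J JH J0 Jdeg.
(* The degree of [x] in [J] is positive, differs from 1 and is at most 2, so [J] contains both
   hyperedges of [H] at [x]. *)
have Jcl e e' x : e \in J -> x \in e -> e' \in edges H -> x \in e' -> e' \in J.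
  move=> eJ xe e'H xe'.
  have xJ : x \in cover J by apply/bigcupP; exists e.
  have xH : x \in verts H by apply: (subsetP (edge_sub e'H)).
  have : [set f in J | x \in f] == [set f in edges H | x \in f].
    rewrite eqEcard; apply/andP; split.
      by apply/subsetP => f; rewrite !inE => /andP[fJ ->]; rewrite (subsetP JH).
    have := degE x xH; have := Jdeg x xJ; have := edeg_gt0 J x; rewrite xJ /edeg => h1 h2 h3.
    by rewrite h3; move: h1 h2; case: #|_| => [|[|]].
  by move=> /eqP/setP/(_ e'); rewrite !inE e'H xe' !andbT.
pose X := cover J.
have XU i x : x \in X -> x \in verts (U i) -> verts (U i) \subset X.
  move=> xX xi; apply/subsetP => y yi.
  have [/in_calUP[_ _ _ conn] _ _] := HU i.
  have /forall_inP/(_ x xi)/forall_inP/(_ y yi) := conn.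
  move=> /connectP[s]; elim: s x xX {xi} => [|z s IH] x xX /=; first by move=> _ ->.
  move=> /andP[/andP[_ /existsP[e /andP[eU /andP[xe ze]]]] ps] yE.
  apply: (IH z) => //; case/bigcupP: xX => f fJ xf; apply/bigcupP; exists e => //.
  by apply: (Jcl f e x) => //; rewrite (subsetP (edgesUsub i)).
have [e eJ] : exists e, e \in J by apply/set0Pn.
have eH := subsetP JH e eJ.
have [i eU] : exists i, e \in edges (U i).
  by move: eH; rewrite He => /bigcupP[i _ ?]; exists i.
have [x xe] : exists x, x \in e by apply/set0Pn; exact: edge_neq0 eU.
have Xi : verts (U i) \subset X.
  by apply: (XU i x); [apply/bigcupP; exists e|exact: (subsetP (edge_sub eU))].
have Xall j : verts (U j) \subset X.
  have [k _ <-] := ordS_reach i j; elim: k => [//|k IH] /=.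
  set i' := iter k _ i in IH *; have [_ _ C] := HU i'.
  have : v (ordS i') \in verts (U i') :&: verts (U (ordS i')) by rewrite C inE.
  by rewrite inE => /andP[v1 v2]; apply: (XU _ (v (ordS i'))) => //; exact: (subsetP IH).
apply/eqP; rewrite eqEsubset JH; apply/subsetP => f fH.
move: (fH); rewrite He => /bigcupP[j _ fU].
have [y yf] : exists y, y \in f by apply/set0Pn; exact: edge_neq0 fU.
have /bigcupP[g gJ yg] : y \in X by apply: (subsetP (Xall j)); exact: (subsetP (edge_sub fU)).
exact: (Jcl g f y).
Qed.

End CalH.

Section Transport.
Variables (T T' : finType) (S : hgraph T) (H : hgraph T').

Lemma hiso_good p N k : hiso S H -> good p N k H -> good p N k S.
Proof.
move=> /asboolP[f [fbij /forallP iso]] [cardH edgesH vertsH degH connH].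
have finj := bij_inj fbij.
(* The isomorphism acts on the subtype of vertices, while hyperedges are sets in the ambient type:
   [F] carries a set over, and is faithful only on subsets of [verts S]. *)
pose F (A : {set T}) : {set T'} := val @: (f @: (val @^-1: A)).
have valK (A : {set T}) : A \subset verts S -> val @: (val @^-1: A : {set vertex S}) = A.
  move=> AS; apply/setP => x; apply/imsetP/idP => [[u]|xA]; first by rewrite inE => uA ->.
  by exists (Sub x (subsetP AS x xA)); rewrite ?inE ?SubK.
have FE (A : {set T}) : A \subset verts S -> (A \in edges S) = (F A \in edges H).
  by move=> AS; have /eqP := iso (val @^-1: A); rewrite valK.
have memF (u : vertex S) (A : {set T}) : (val (f u) \in F A) = (val u \in A).
  rewrite mem_imset; last exact: val_inj.
  by rewrite mem_imset// inE.
have Fcard (A : {set T}) : A \subset verts S -> #|F A| = #|A|.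
  move=> AS; rewrite card_imset; last exact: val_inj.
  by rewrite card_imset// -[in RHS](valK A AS) card_imset//; exact: val_inj.
have Finj (A B : {set T}) : A \subset verts S -> B \subset verts S -> F A = F B -> A = B.
  move=> AS BS /(imset_inj val_inj) /(imset_inj finj) E.
  by rewrite -(valK A AS) E valK.
have Fsurj B : B \in edges H -> exists2 A, A \in edges S & F A = B.
  move=> BH; pose A : {set T} := val @: (f @^-1: (val @^-1: B)).
  have AS : A \subset verts S.
    by apply/subsetP => x /imsetP[u _ ->]; exact: (valP u).
  have FA : F A = B.
    apply/setP => y; apply/imsetP/idP.
      move=> [u' /imsetP[u]]; rewrite inE => /imsetP[u0]; rewrite !inE => h.
      by move=> /val_inj -> -> ->.
    move=> yB; have yH : y \in verts H by apply: (subsetP (edge_sub BH)).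
    have [g fg gf] := fbij.
    exists (Sub y yH); last by rewrite SubK.
    apply/imsetP; exists (g (Sub y yH)); last by rewrite gf.
    by rewrite inE imset_f// !inE gf SubK.
  by exists A => //; rewrite FE// FA.
have edegF (J : {set {set T}}) (u : vertex S) : J \subset edges S ->
    edeg (F @: J) (val (f u)) = edeg J (val u).
  move=> JS; rewrite /edeg -[RHS](@card_in_imset _ _ F).
    apply: eq_card => B; apply/idP/imsetP.
      rewrite inE => /andP[/imsetP[A AJ ->]]; rewrite memF => uA.
      by exists A => //; rewrite inE AJ.
    move=> [A /[!inE] /andP[AJ uA] ->].
    by rewrite imset_f//= memF.
  move=> A B; rewrite !inE => /andP[AJ _] /andP[BJ _]; apply: Finj;
  by rewrite edge_sub// (subsetP JS).
have FS : F @: edges S = edges H.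
  apply/setP => B; apply/imsetP/idP => [[A AS ->]|/Fsurj[A AS <-]]; last by exists A.
  by rewrite -FE// edge_sub.
split.
- move=> e eS; rewrite -(Fcard e (edge_sub eS)); apply: cardH.
  by rewrite -FE// edge_sub.
- rewrite -edgesH -FS card_in_imset// => A B AS BS; apply: Finj;
  by rewrite edge_sub.
- apply: leq_trans vertsH.
  by have := leq_card f finj; rewrite !card_sig => h; apply: leq_trans h _.
- move=> x xS; have /= := edegF (edges S) (Sub x xS : vertex S) (subxx _).
  rewrite FS => <-; apply: degH; exact: (valP (f _)).
move=> J JS J0 Jdeg.
have JE : F @: J = edges H.
  apply: connH.
  - by rewrite -FS; apply: imsetS.
  - by apply: contra J0; rewrite imset_eq0.
  move=> y /bigcupP[B BJ yB].
  have yH : y \in verts H.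
    apply: (subsetP (edge_sub _) y yB); rewrite -FS.
    by move: BJ; apply: (subsetP (imsetS _ JS)).
  have [g fg gf] := fbij.
  pose u := g (Sub y yH : vertex H).
  have yE : y = val (f u) by rewrite /u gf SubK.
  rewrite yE edegF//; apply: Jdeg; apply/bigcupP.
  move: BJ yB => /imsetP[A AJ ->]; rewrite yE memF => uA; by exists A.
(* The image of [J] is everything, so [J] has at least as many elements as [edges S]. *)
apply/eqP; rewrite eqEcard JS -(@card_in_imset _ _ F (edges S)); last first.
  by move=> A B AS BS; apply: Finj; rewrite edge_sub.
by rewrite FS -JE leq_imset_card.
Qed.

End Transport.

Lemma hiso_refl (T : finType) (S : hgraph T) : hiso S S.
Proof.
apply/asboolP; exists id; split; first by exists id.
by apply/forallP => A; rewrite imset_id.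
Qed.

Lemma hiso_sym (T T' : finType) (S : hgraph T) (S' : hgraph T') : hiso S S' -> hiso S' S.
Proof.
move=> /asboolP[f [[g fK gK] /forallP iso]]; apply/asboolP; exists g; split; first by exists f.
apply/forallP => A; have /eqP := iso (g @: A).
rewrite -[f @: _]imset_comp (eq_imset (g := id)); last by move=> x /=; rewrite gK.
by rewrite imset_id => ->.
Qed.

Lemma hiso_trans (T1 T2 T3 : finType) (S1 : hgraph T1) (S2 : hgraph T2) (S3 : hgraph T3) :
  hiso S1 S2 -> hiso S2 S3 -> hiso S1 S3.
Proof.
move=> /asboolP[f [fb /forallP iso]] /asboolP[g [gb /forallP iso']].
apply/asboolP; exists (g \o f); split; first exact: bij_comp.
apply/forallP => A; have /eqP -> := iso A; have /eqP -> := iso' (f @: A).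
by rewrite -[g @: _]imset_comp.
Qed.

(** * Labelled copies and the transversal of isomorphism classes *)

Section Copies.
Variables (n m p l : nat).
Local Notation N := (m * p * l).

Definition copies : {set hgraph 'I_n} :=
  [set S | [exists H, (H \in calH m p l) && hiso S H]].

Let D : {set hgraph 'I_N} := [set H : hgraph 'I_N | `[< in_calH m p l H >]].
Let classes := equivalence_partition (@hiso 'I_N 'I_N) D.

Let hiso_equiv : {in D & &, equivalence_rel (@hiso 'I_N 'I_N)}.
Proof.
move=> x y z _ _ _; split; first exact: hiso_refl.
move=> xy; apply/idP/idP; last exact: hiso_trans xy.
exact: hiso_trans (hiso_sym xy).
Qed.

Let classes_partition : partition classes D.
Proof. exact: equivalence_partitionP hiso_equiv. Qed.

Lemma calH_in_calH (H : hgraph 'I_N) : H \in calH m p l -> in_calH m p l H.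
Proof.
have := transversal_sub (transversalP classes_partition) => /subsetP sub.
by move=> /sub; rewrite inE => /asboolP.
Qed.

Lemma calH_hiso_uniq (H H' : hgraph 'I_N) :
  H \in calH m p l -> H' \in calH m p l -> hiso H H' -> H = H'.
Proof.
move=> HC HC' iso.
have DH : H \in D by rewrite inE; apply/asboolP; exact: calH_in_calH.
have DH' : H' \in D by rewrite inE; apply/asboolP; exact: calH_in_calH.
have inj := pblock_inj (transversalP classes_partition).
apply: inj => //; apply/eqP.
rewrite eq_pblock; last 2 first.
- by have /and3P[] := classes_partition.
- by have /and3P[/eqP -> _ _] := classes_partition.
by rewrite pblock_equivalence_partition.
Qed.

Lemma exists_calH (H : hgraph 'I_N) : in_calH m p l H ->
  exists2 H' : hgraph 'I_N, H' \in calH m p l & hiso H H'.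
Proof.
move=> HH; have DH : H \in D by rewrite inE; apply/asboolP.
have B : pblock classes H \in classes.
  by rewrite pblock_mem//; have /and3P[/eqP -> _ _] := classes_partition.
have tr := transversalP classes_partition.
have [H' H'C] : exists H', H' \in calH m p l :&: pblock classes H.
  have /and3P[_ _ /forall_inP/(_ _ B)/cards1P[H' E]] := tr.
  by exists H'; rewrite E inE.
exists H'; first by move: H'C; rewrite inE => /andP[].
move: H'C; rewrite inE => /andP[H'C].
rewrite pblock_equivalence_partition//.
by rewrite inE; apply/asboolP; exact: calH_in_calH.
Qed.

Lemma copiesP S : reflect (exists2 H, H \in calH m p l & hiso S H) (S \in copies).
Proof.
rewrite inE; apply: (iffP existsP) => [[H /andP[h1 h2]]|[H h1 h2]]; first by exists H.
by exists H; rewrite h1.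
Qed.

(** The chosen representatives are pairwise non-isomorphic, so every labelled copy occurs under
    exactly one of them and the double sum has no multiplicities. *)
Lemma sum_copies (R : nmodType) (F : hgraph 'I_n -> R) :
  (\sum_(H in calH m p l) \sum_(S : hgraph 'I_n | hiso S H) F S = \sum_(S in copies) F S)%R.
Proof.
pose G (S : hgraph 'I_n) (H : hgraph 'I_N) := hiso S H.
rewrite (exchange_big_dep (mem copies))/=; last first.
  by move=> H S HC iso; apply/copiesP; exists H.
apply: eq_bigr => S /copiesP[H HC iso].
rewrite (big_pred1 H)// => H'; apply/andP/eqP => [[H'C iso']|->//].
by apply: calH_hiso_uniq => //; exact: hiso_trans (hiso_sym iso') iso.
Qed.

Lemma copies_good S : 3 <= p -> 4 <= l -> S \in copies -> good p N (2 * m * l) S.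
Proof.
move=> p3 l4 /copiesP[H HC iso]; apply: hiso_good iso _.
apply: in_calH_good => //; first exact: calH_in_calH.
by rewrite -[leqRHS]card_ord max_card.
Qed.

End Copies.

Section Good.
Variables (T : finType) (p N k : nat) (S : hgraph T).
Hypothesis gS : good p N k S.

Lemma good_verts_cover : verts S = cover (edges S).
Proof.
apply/eqP; rewrite eqEsubset cover_edges andbT; apply/subsetP => x xS.
by rewrite -edeg_gt0 (good_deg gS).
Qed.

Lemma good_even v : ~~ odd (edeg (edges S) v).
Proof.
have [vS|vS] := boolP (v \in verts S); first by rewrite (good_deg gS).
by move: vS; rewrite good_verts_cover -edeg_gt0 -leqNgt leqn0 => /eqP ->.
Qed.

(* Connectedness forces a vertex of degree one in any proper nonempty set of edges. *)
Lemma good_sub_cover (J : {set {set T}}) :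
  J \subset edges S -> J != set0 -> J != edges S -> p * #|J| < 2 * #|cover J|.
Proof.
move=> JS J0 JE.
have Jle v : edeg J v <= 2.
  case: (boolP (v \in verts S)) => vS.
    by rewrite -(good_deg gS vS); exact: edeg_sub.
  apply: leq_trans (edeg_sub v JS) _.
  by move: vS; rewrite good_verts_cover -edeg_gt0 -eqn0Ngt => /eqP ->.
have [v vJ v1] : exists2 v, v \in cover J & edeg J v = 1.
  apply: contrapT => H; move/eqP: JE; apply; apply: (good_conn gS) => // v vJ.
  by apply/eqP => v1; apply: H; exists v.
have <- : \sum_x edeg J x = p * #|J|.
  rewrite sum_edeg (eq_bigr (fun=> p)); first by rewrite sum_nat_const mulnC.
  by move=> e eJ; apply: (good_card gS); exact: (subsetP JS).
have -> : \sum_x edeg J x = \sum_(x in cover J) edeg J x.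
  rewrite [RHS]big_mkcond; apply: eq_bigr => x _.
  by case: ifP => // /negbT; rewrite -edeg_gt0 -eqn0Ngt => /eqP.
rewrite (bigD1 v)//= v1.
have : \sum_(i in cover J | i != v) edeg J i <= \sum_(i in cover J | i != v) 2.
  by apply: leq_sum => i _.
rewrite sum_nat_const (cardsD1 v (cover J)) vJ.
have -> : #|[pred i in cover J | i != v]| = #|cover J :\ v|.
  by apply: eq_card => i; rewrite !inE andbC.
by lia.
Qed.

End Good.

(** * Counting the copies that contain a given set of hyperedges *)

Section Extensions.
Variables (n p N k : nat) (J : {set {set 'I_n}}).
Hypotheses (n_gt0 : 0 < n) (N_gt0 : 0 < N).
Let c := #|cover J|.
Let x0 : 'I_n := Ordinal n_gt0.
Let i0 : 'I_N := Ordinal N_gt0.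

(** A decoder: the tuple lists the vertices outside [cover J], and the finite function gives the p
    positions of each of the k hyperedges in the resulting list. Surjectivity onto the extensions
    suffices for an upper bound, so redundant codes do no harm. *)
Definition assemble (he : (N - c).-tuple 'I_n * {ffun 'I_k -> {ffun 'I_p -> 'I_N}}) :
    {set {set 'I_n}} :=
  [set [set nth x0 (enum (cover J) ++ he.1) (he.2 j q) | q : 'I_p] | j : 'I_k].

Lemma assemble_surj (S : hgraph 'I_n) : good p N k S -> J \subset edges S ->
  exists he, assemble he = edges S.
Proof.
move=> gS JS.
have cS : cover J \subset verts S.
  by rewrite (good_verts_cover gS); apply/bigcupsP => e eJ; apply: bigcup_sup; exact: (subsetP JS).
pose r := enum (verts S :\: cover J).
have szr : size r + c = #|verts S|.
  by rewrite -cardE cardsD (setIidPr cS) subnK// subset_leq_card.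
have rN : size r <= N - c by have := good_verts gS; lia.
(* [good_verts] is an upper bound, so the list is padded with a dummy vertex to the exact length. *)
pose h := r ++ nseq (N - c - size r) x0.
have szh : size h == N - c by rewrite size_cat size_nseq subnKC.
pose s := enum (cover J) ++ h.
have szs : size s = N.
  rewrite size_cat (eqP szh) -cardE subnKC//.
  by apply: leq_trans (subset_leq_card cS) (good_verts gS).
have vs x : x \in verts S -> x \in s.
  move=> xS; rewrite !mem_cat !mem_enum !inE xS andbT.
  by case: (x \in cover J).
pose gi x : 'I_N := insubd i0 (index x s).
have giK x : x \in verts S -> nth x0 s (gi x) = x.
  move=> xS; rewrite /gi val_insubd -[X in _ < X]szs index_mem vs//; exact: nth_index (vs x xS).
pose A (j : 'I_k) := nth set0 (enum (edges S)) j.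
have szE : size (enum (edges S)) = k by rewrite -cardE (good_edges gS).
have AE j : A j \in edges S by rewrite -mem_enum mem_nth// szE.
pose e : {ffun 'I_k -> {ffun 'I_p -> 'I_N}} :=
  [ffun j => [ffun q : 'I_p => gi (nth x0 (enum (A j)) q)]].
exists (Tuple szh, e); rewrite /assemble /=.
have E j : [set nth x0 (enum (cover J) ++ h) (e j q) | q : 'I_p] = A j.
  have szA : size (enum (A j)) = p by rewrite -cardE (good_card gS).
  have nA (q : 'I_p) : nth x0 (enum (A j)) q \in A j.
    by rewrite -mem_enum mem_nth// szA.
  have nV (q : 'I_p) : nth x0 (enum (A j)) q \in verts S.
    by apply: (subsetP (edge_sub (AE j))).
  apply/setP => x; apply/imsetP/idP.
    by move=> [q _ ->]; rewrite !ffunE giK.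
  move=> xA; have q0 : index x (enum (A j)) < p by rewrite -szA index_mem mem_enum.
  exists (Ordinal q0) => //; rewrite !ffunE giK; last exact: nV.
  by rewrite /= nth_index ?mem_enum.
apply/setP => B; apply/imsetP/idP => [[j _ ->]|BS]; first by rewrite E AE.
have j0 : index B (enum (edges S)) < k by rewrite -szE index_mem mem_enum.
by exists (Ordinal j0) => //; rewrite E /A /= nth_index ?mem_enum.
Qed.

(** The vertices of [J] are given, which leaves n choices for each entry of the tuple of the others;
    the hyperedges determine the copy, since they cover all its vertices. *)
Lemma card_extensions (Q : {set hgraph 'I_n}) :
  (forall S, S \in Q -> good p N k S /\ J \subset edges S) ->
  #|Q| <= n ^ (N - c) * N ^ (p * k).
Proof.
move=> HQ.
have inj : {in Q &, injective (@edges 'I_n)}.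
  move=> S S' SQ S'Q E; apply: hgraph_eqP => //.
  by rewrite (good_verts_cover (HQ S SQ).1) (good_verts_cover (HQ S' S'Q).1) E.
rewrite -(card_in_imset inj).
apply: (@leq_trans #|[set assemble he | he in
  setT : {set (N - c).-tuple 'I_n * {ffun 'I_k -> {ffun 'I_p -> 'I_N}}}]|).
  apply: subset_leq_card; apply/subsetP => E /imsetP[S SQ ->].
  have [gS JS] := HQ S SQ; have [he <-] := assemble_surj gS JS.
  by apply: imset_f; rewrite inE.
apply: leq_trans (leq_imset_card _ _) _.
by rewrite cardsT card_prod card_tuple !card_ffun !card_ord -expnM.
Qed.

End Extensions.

(** * Lower bound on the number of copies *)

Section Slots.
Variables (m p l : nat).
Hypotheses (m2 : 2 <= m) (p3 : 3 <= p) (l4 : 4 <= l).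

Local Notation slot := ('I_m * 'I_p)%type.
Local Notation slots := ('I_l * slot)%type.

Let p_gt0 : 0 < p. Proof. by lia. Qed.
Let p_gt1 : 1 < p. Proof. by lia. Qed.
Let m_gt0 : 0 < m. Proof. by lia. Qed.
Let l_gt0 : 0 < l. Proof. by lia. Qed.
(* The slot (i, (j, k)) is the k-th vertex of the j-th odd hyperedge of block i;
   the gluing defined below sends it to the k-th vertex of the j-th even
   hyperedge. Positions k0 and k1 link each even hyperedge to the j-th and
   (j+1)-st odd hyperedges, the slot joint links block i to block i+1, and the
   remaining (free) slots are permuted arbitrarily within each block. *)
Definition k0 : 'I_p := Ordinal p_gt0.
Definition k1 : 'I_p := Ordinal p_gt1.
Definition k2 : 'I_p := Ordinal p3.
Definition j0 : 'I_m := Ordinal m_gt0.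
Definition i0 : 'I_l := Ordinal l_gt0.
Definition joint : slot := (j0, k2).

Lemma ordS_m_neq (j : 'I_m) : ordS j != j.
Proof. by apply: (@iter_ordS_neq m 1 j); lia. Qed.

Lemma ordS_l_neq (i : 'I_l) : ordS i != i.
Proof. by apply: (@iter_ordS_neq l 1 i); lia. Qed.

Lemma ordSS_l_neq (i : 'I_l) : ordS (ordS i) != i.
Proof. by apply: (@iter_ordS_neq l 2 i); lia. Qed.

Definition free_slots : {set slot} := [set y : slot | (2 <= y.2) && (y != joint)].

Lemma card_free_slots : #|free_slots| = (m * (p - 2)).-1.
Proof.
have -> : free_slots = [set y : slot | 2 <= y.2] :\ joint.
  by apply/setP => y; rewrite !inE andbC.
have -> : [set y : slot | 2 <= y.2] = setX [set: 'I_m] [set k : 'I_p | 2 <= k].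
  by apply/setP => -[j k]; rewrite !inE.
have := cardsD1 joint (setX [set: 'I_m] [set k : 'I_p | 2 <= k]).
rewrite !inE /= cardsX cardsT card_ord.
have -> : #|[set k : 'I_p | 2 <= k]| = p - 2.
  have -> : [set k : 'I_p | 2 <= k] = ~: [set k0; k1].
    apply/setP => k; rewrite !inE -!val_eqE /=.
    by case: (val k) => [|[|]].
  by rewrite cardsCs setCK cards2 card_ord.
by move=> ->.
Qed.

Definition advance (y : slot) : slot := if y.2 == k1 then (ordS y.1, k1) else y.

Lemma advance_inj : injective advance.
Proof.
move=> [j k] [j' k']; rewrite /advance /=; case: eqP => [->|h]; case: eqP => [->|h'] //.
- by move=> E; rewrite (ordS_inj (congr1 fst E)).
- by move=> /(congr1 snd) /= E; move: h'; rewrite E.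
- by move=> /(congr1 snd) /= E; move: h; rewrite E.
Qed.

Definition gluing (s : 'I_l -> {perm slot}) (w : slots) : slots :=
  (if w.2 == joint then ordS w.1 else w.1, advance (s w.1 w.2)).

Section Gluing.
Variable s : 'I_l -> {perm slot}.
Hypothesis son : forall i, perm_on free_slots (s i).

Lemma gluing_fixed i y : y \notin free_slots -> s i y = y.
Proof. exact: out_perm. Qed.

Lemma gluing_joint i : gluing s (i, joint) = (ordS i, joint).
Proof.
rewrite /gluing [(i, joint).2]/= [(i, joint).1]/= eqxx gluing_fixed //.
by rewrite inE eqxx andbF.
Qed.

Lemma gluing_k0 i j : gluing s (i, (j, k0)) = (i, (j, k0)).
Proof.
by rewrite /gluing /= gluing_fixed ?inE// /advance/= xpair_eqE -!val_eqE /= andbF.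
Qed.

Lemma gluing_k1 i j : gluing s (i, (j, k1)) = (i, (ordS j, k1)).
Proof.
by rewrite /gluing /= gluing_fixed ?inE// /advance/= xpair_eqE -!val_eqE /= andbF.
Qed.

Lemma gluing2_joint w : ((gluing s w).2 == joint) = (w.2 == joint).
Proof.
case: w => i y; apply/eqP/eqP => /= [E|->]; last by have := gluing_joint i => /(congr1 snd).
have sj : s i joint = joint by rewrite gluing_fixed// !inE eqxx andbF.
apply: (@perm_inj _ (s i)); rewrite sj.
by apply: advance_inj; rewrite E.
Qed.

Lemma gluing_inj : injective (gluing s).
Proof.
move=> [i y] [i' y'] E.
have Ej : (y == joint) = (y' == joint).
  by rewrite -(gluing2_joint (i, y)) -(gluing2_joint (i', y')) E.
have Ei : i = i'.
  have := congr1 fst E; rewrite /= Ej; case: ifP => // _; exact: ordS_inj.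
by have := congr1 snd E; rewrite /= Ei => /advance_inj/perm_inj ->.
Qed.

(** In the realizations below, [a w] lies in exactly one odd hyperedge, indexed by [w], and in
    exactly one even hyperedge, indexed by [glueV w]. *)
Definition glueV (w : slots) : slots := invF gluing_inj w.

Lemma glueVK w : gluing s (glueV w) = w.
Proof. exact: f_invF. Qed.

Lemma gluingK w : glueV (gluing s w) = w.
Proof. exact: invF_f. Qed.

Lemma glueV_joint i : glueV (ordS i, joint) = (i, joint).
Proof. by apply: gluing_inj; rewrite glueVK gluing_joint. Qed.

Lemma glueV_fst i y : y != joint -> (glueV (i, y)).1 = i.
Proof.
move=> yj; set w := glueV (i, y).
have E : gluing s w = (i, y) by rewrite /w glueVK.
have : w.2 == joint = false by rewrite -gluing2_joint E /=; apply/negbTE.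
by move=> wj; have := congr1 fst E; rewrite /= wj.
Qed.

Lemma glueV_k0 i j : glueV (i, (j, k0)) = (i, (j, k0)).
Proof. by apply: gluing_inj; rewrite glueVK gluing_k0. Qed.

Lemma glueV_k1 i j : glueV (i, (ordS j, k1)) = (i, (j, k1)).
Proof. by apply: gluing_inj; rewrite glueVK gluing_k1. Qed.

Lemma glueV_joint_fst i : (glueV (i, joint)).1 = ord_pred i.
Proof. by rewrite -{1}(ord_predK i) glueV_joint. Qed.

Section Realization.
Variables (T : finType) (a : slots -> T).
Hypothesis a_inj : injective a.

Definition odd_edge (i : 'I_l) (j : 'I_m) : {set T} := [set a (i, (j, k)) | k : 'I_p].
Definition even_edge (i : 'I_l) (j : 'I_m) : {set T} :=
  [set a (gluing s (i, (j, k))) | k : 'I_p].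

Lemma mem_odd_edge w i j : (a w \in odd_edge i j) = (w.1 == i) && (w.2.1 == j).
Proof.
apply/imsetP/andP => [[k _ /a_inj ->] //|[/eqP <- /eqP <-]].
by exists w.2.2 => //; case: w => ? [].
Qed.

Lemma mem_even_edge w i j : (a w \in even_edge i j) =
  ((glueV w).1 == i) && ((glueV w).2.1 == j).
Proof.
apply/imsetP/andP => [[k _ /a_inj ->]|[/eqP <- /eqP <-]].
  by rewrite gluingK.
exists (glueV w).2.2 => //.
have -> : ((glueV w).1, ((glueV w).2.1, (glueV w).2.2)) = glueV w.
  by case: (glueV w) => ? [].
by rewrite glueVK.
Qed.

Lemma card_odd_edge i j : #|odd_edge i j| = p.
Proof. by rewrite card_imset ?card_ord// => k k' /a_inj[]. Qed.

Lemma card_even_edge i j : #|even_edge i j| = p.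
Proof. by rewrite card_imset ?card_ord// => k k' /a_inj/gluing_inj[]. Qed.

Lemma odd_edge_inj i j i' j' : odd_edge i j = odd_edge i' j' -> (i, j) = (i', j').
Proof.
move=> E; have : a (i, (j, k0)) \in odd_edge i j by rewrite mem_odd_edge !eqxx.
by rewrite E mem_odd_edge /= => /andP[/eqP -> /eqP ->].
Qed.

Lemma even_edge_inj i j i' j' : even_edge i j = even_edge i' j' -> (i, j) = (i', j').
Proof.
move=> E; have : a (i, (j, k0)) \in even_edge i j by rewrite mem_even_edge glueV_k0 /= !eqxx.
by rewrite E mem_even_edge glueV_k0 /= => /andP[/eqP -> /eqP ->].
Qed.

(** Slot [k0] of the j-th odd hyperedge lies in the j-th even one and slot [k1] in the even one
    before; these two differ because m >= 2, so no even hyperedge contains both vertices. *)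
Lemma odd_even_edge i j i' j' : odd_edge i j != even_edge i' j'.
Proof.
apply/eqP => E.
have : a (i, (ordS (ord_pred j), k1)) \in odd_edge i j.
  by rewrite mem_odd_edge /= ord_predK !eqxx.
rewrite E mem_even_edge glueV_k1 /= => /andP[_ /eqP E1].
have : a (i, (j, k0)) \in odd_edge i j by rewrite mem_odd_edge /= !eqxx.
rewrite E mem_even_edge glueV_k0 /= => /andP[_ /eqP E2].
by have := ordS_m_neq (ord_pred j); rewrite ord_predK E1 E2 eqxx.
Qed.

Definition block_edges i : {set {set T}} :=
  [set odd_edge i j | j : 'I_m] :|: [set even_edge i j | j : 'I_m].

Definition block_verts i : {set T} := [set a (i, y) | y : slot] :|: [set a (ordS i, joint)].

Lemma mem_block_verts w i : (a w \in block_verts i) =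
  (w.1 == i) || (w == (ordS i, joint)).
Proof.
rewrite !inE (inj_eq a_inj); congr (_ || _).
by apply/imsetP/eqP => [[y _ /a_inj ->] //|<-]; exists w.2 => //; case: w.
Qed.

(** The odd hyperedges of a block cover its own slots; the even ones cover the same slots with the
    joint replaced by that of the next block. Adding the missing joint to either gives the same
    vertex set. *)
Lemma glueV_block w i : (w.1 == i) || (w == (ordS i, joint)) =
  ((glueV w).1 == i) || (w == (i, joint)).
Proof.
case: w => i' y; have [->|yj] := eqVneq y joint.
  rewrite glueV_joint_fst /= !xpair_eqE eqxx !andbT orbC; congr (_ || _).
  by apply/eqP/eqP => [->|<-]; rewrite ?ordSK ?ord_predK.
by rewrite glueV_fst//= !xpair_eqE (negbTE yj) !andbF.
Qed.

Lemma block_wf i : hgraph_wf (block_verts i, block_edges i).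
Proof.
apply/forall_inP => e; rewrite inE => /orP[/imsetP[j _ ->]|/imsetP[j _ ->]] /=.
  rewrite -card_gt0 card_odd_edge p_gt0 /=; apply/subsetP => x /imsetP[k _ ->].
  by rewrite mem_block_verts eqxx.
rewrite -card_gt0 card_even_edge p_gt0 /=; apply/subsetP => x /imsetP[k _ ->].
by rewrite mem_block_verts glueV_block gluingK /= eqxx.
Qed.

Definition block i : hgraph T := HGraph (block_wf i).

Lemma realize_wf : hgraph_wf (a @: [set: slots], \bigcup_i block_edges i).
Proof.
apply/forall_inP => e /bigcupP[i _ eU].
have /forall_inP/(_ e eU)/andP[-> h] := block_wf i => /=.
apply: subset_trans h _; apply/subsetP => x; rewrite inE => /orP[/imsetP[y _ ->]|].
  by apply: imset_f; rewrite inE.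
by rewrite inE => /eqP ->; apply: imset_f; rewrite inE.
Qed.

Definition realize : hgraph T := HGraph realize_wf.

Lemma edeg_block i w : edeg (block_edges i) (a w) =
  (w.1 == i) + ((glueV w).1 == i).
Proof.
rewrite /edeg /block_edges.
have -> : [set e in [set odd_edge i j | j : 'I_m] :|: [set even_edge i j | j : 'I_m] | a w \in e] =
  (odd_edge i @: [set j | (w.1 == i) && (w.2.1 == j)]) :|:
  (even_edge i @: [set j | ((glueV w).1 == i) && ((glueV w).2.1 == j)]).
  apply/setP => e; rewrite !inE; apply/andP/orP.
    move=> [/orP[/imsetP[j _ ->]|/imsetP[j _ ->]] h]; [left|right]; apply: imset_f.
      by rewrite inE -mem_odd_edge.
    by rewrite inE -mem_even_edge.
  move=> [/imsetP[j /[!inE] h ->]|/imsetP[j /[!inE] h ->]]; split.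
  - by rewrite imset_f.
  - by rewrite mem_odd_edge.
  - by rewrite [X in _ || X]imset_f ?orbT.
  - by rewrite mem_even_edge.
rewrite cardsU (_ : _ :&: _ = set0) ?cards0 ?subn0; last first.
  apply/setP => e; rewrite !inE; apply/negbTE/negP.
  move=> /andP[/imsetP[j _ ->] /imsetP[j' _ /eqP]].
  by rewrite (negbTE (odd_even_edge _ _ _ _)).
rewrite !card_imset; last 2 first.
- by move=> j j' /even_edge_inj[].
- by move=> j j' /odd_edge_inj[].
congr (_ + _).
  case: eqP => _ /=; last first.
    by rewrite (_ : [set _ | _] = set0) ?cards0//; apply/setP => j; rewrite !inE.
  by rewrite (_ : [set _ | _] = [set w.2.1]) ?cards1//; apply/setP => j; rewrite !inE eq_sym.
case: eqP => _ /=; last first.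
  by rewrite (_ : [set _ | _] = set0) ?cards0//; apply/setP => j; rewrite !inE.
by rewrite (_ : [set _ | _] = [set (glueV w).2.1]) ?cards1//; apply/setP => j; rewrite !inE eq_sym.
Qed.

Lemma block_vertsP x i : x \in block_verts i -> exists w, x = a w.
Proof. by rewrite inE => /orP[/imsetP[y _ ->]|/set1P ->]; eexists. Qed.

Lemma block_leaves i : leaves (block i) = [set a (i, joint); a (ordS i, joint)].
Proof.
apply/setP => x; rewrite inE; apply/andP/set2P.
  move=> [xV]; have [w xE] := block_vertsP xV; move: xV; rewrite xE /verts /=.
  rewrite mem_block_verts [hdeg _ _]edeg_block.
  case/orP => [/eqP wi|/eqP ->]; last by right.
  case: w {xE} wi => i' y /= ->; have [->|yj] := eqVneq y joint; first by left.
  by rewrite glueV_fst// !eqxx.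
move=> H; have [w xE] : exists w, x = a w by case: H => ->; eexists.
split.
  by case: H => ->; rewrite /verts /= mem_block_verts /= !eqxx ?orbT.
rewrite -[hdeg _ _]/(edeg (block_edges i) x).
case: H => ->; rewrite edeg_block /=.
  rewrite eqxx glueV_joint_fst; have := ordS_l_neq (ord_pred i); rewrite ord_predK eq_sym.
  by move=> /negbTE ->.
by rewrite glueV_joint /= eqxx (negbTE (ordS_l_neq i)).
Qed.

Lemma card_block_verts i : #|block_verts i| = m * p + 1.
Proof.
rewrite /block_verts setUC cardsU1; have -> : a (ordS i, joint) \notin [set a (i, y) | y : slot].
  apply/negP => /imsetP[y _ /a_inj[E _]]; have := ordS_l_neq i; by rewrite E eqxx.
by rewrite card_imset ?card_prod ?card_ord 1?addnC// => y y' /a_inj[].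
Qed.

Lemma card_block_edges i : #|block_edges i| = 2 * m.
Proof.
rewrite cardsU (_ : _ :&: _ = set0) ?cards0 ?subn0; last first.
  apply/setP => e; rewrite !inE; apply/negbTE/negP.
  move=> /andP[/imsetP[j _ ->] /imsetP[j' _ /eqP]].
  by rewrite (negbTE (odd_even_edge _ _ _ _)).
rewrite !card_imset; last 2 first.
- by move=> j j' /even_edge_inj[].
- by move=> j j' /odd_edge_inj[].
by rewrite card_ord mul2n addnn.
Qed.

(** * Connectivity of a block after the deletion of at most one vertex *)

Section Connectivity.
Variables (i : 'I_l) (X : {set T}).
Hypothesis X1 : #|X| <= 1.

Let linked : rel {set T} := fun e f =>
  [&& e \in block_edges i, f \in block_edges i & [exists z, [&& z \notin X, z \in e & z \in f]]].

(** Adjacency in the block with [X] removed, written without deletion so that X empty and X a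
    singleton give the two connectivity conditions of [in_calU]. *)
Let adj : rel T := fun x y => [&& x != y, x \notin X, y \notin X &
  [exists e, [&& e \in block_edges i, x \in e & y \in e]]].

Let linked_sym : connect_sym linked.
Proof.
apply: sym_connect_sym => e f; rewrite /linked; apply/and3P/and3P;
move=> -[he hf /existsP[z /and3P[z1 z2 z3]]];
by split => //; apply/existsP; exists z; rewrite z1 z2 z3.
Qed.

Let odd_in j : odd_edge i j \in block_edges i.
Proof. by rewrite inE imset_f. Qed.

Let even_in j : even_edge i j \in block_edges i.
Proof. by rewrite inE [X in _ || X]imset_f ?orbT. Qed.

Let link_odd_even j : a (i, (j, k0)) \notin X -> linked (odd_edge i j) (even_edge i j).
Proof.
move=> zX; rewrite /linked odd_in even_in; apply/existsP; exists (a (i, (j, k0))).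
by rewrite zX mem_odd_edge mem_even_edge glueV_k0 /= !eqxx.
Qed.

Let link_even_odd j : a (i, (ordS j, k1)) \notin X -> linked (even_edge i j) (odd_edge i (ordS j)).
Proof.
move=> zX; rewrite /linked odd_in even_in; apply/existsP; exists (a (i, (ordS j, k1))).
by rewrite zX mem_odd_edge mem_even_edge glueV_k1 /= !eqxx.
Qed.

(* The hyperedges of a block form a cycle with distinct links; deleting a vertex
   breaks at most one link. *)
Let broken_link : exists j, (forall j', j' != j ->
    a (i, (j', k0)) \notin X /\ a (i, (ordS j', k1)) \notin X) /\
  (a (i, (j, k0)) \notin X \/ a (i, (ordS j, k1)) \notin X).
Proof.
have X2 := card_le1_eqP X1.
have [/existsP[j jX]|/existsPn H] := boolP [exists j, a (i, (j, k0)) \in X].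
  exists j; split.
    move=> j' j'j; split; apply/negP => h.
      by move: j'j; have /a_inj[->] := X2 _ _ h jX; rewrite eqxx.
    by have /a_inj := X2 _ _ h jX.
  by right; apply/negP => h; have /a_inj := X2 _ _ h jX.
have [/existsP[j jX]|/existsPn H'] := boolP [exists j, a (i, (ordS j, k1)) \in X].
  exists j; split; last by left.
  move=> j' j'j; split=> //; apply/negP => h; move: j'j.
  by have /a_inj/(congr1 (fun w => w.2.1))/= /ordS_inj -> := X2 _ _ h jX; rewrite eqxx.
by exists j0; split => [j' _|]; [split|left].
Qed.

(** The hub is the odd hyperedge just after the weak index [j]. Going around the cycle from there
    reaches every odd hyperedge without crossing [j]; an even hyperedge hangs on the odd one of the
    same index, except the [j]-th, which uses whichever of its two links survives. *)
Let linked_hub : exists h, forall e, e \in block_edges i -> connect linked h e.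
Proof.
have [j [Hj Hj1]] := broken_link; exists (odd_edge i (ordS j)).
have chain k : k < m -> 
    connect linked (odd_edge i (ordS j)) (odd_edge i (iter k (@ordS m) (ordS j))).
  elim: k => [_|k IH km] /=; first exact: connect0.
  apply: connect_trans (IH (ltnW km)) _.
  (* Between 1 and m - 1 steps from [j] have been made, so the walk has not returned to it. *)
  have nj : iter k (@ordS m) (ordS j) != j.
    by rewrite -iterSr; apply: iter_ordS_neq; lia.
  have [h1 h2] := Hj _ nj.
  by apply: connect_trans (connect1 (link_odd_even h1)) (connect1 (link_even_odd h2)).
have Hodd j' : connect linked (odd_edge i (ordS j)) (odd_edge i j').
  by have [k km <-] := ordS_reach (ordS j) j'; exact: chain.
move=> e; rewrite inE => /orP[/imsetP[j' _ ->]//|/imsetP[j' _ ->]].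
have [->|nj] := eqVneq j' j.
  case: Hj1 => h; first exact: connect_trans (Hodd j) (connect1 (link_odd_even h)).
  by rewrite linked_sym; apply: connect1; exact: link_even_odd.
have [h1 _] := Hj _ nj.
exact: connect_trans (Hodd j') (connect1 (link_odd_even h1)).
Qed.

Let linked_adj e f x y : e \in block_edges i -> connect linked e f ->
  x \in e -> x \notin X -> y \in f -> y \notin X -> connect adj x y.
Proof.
have step g u w : g \in block_edges i -> u \in g -> u \notin X -> w \in g -> w \notin X ->
    connect adj u w.
  move=> gE ug uX wg wX; have [->|uw] := eqVneq u w; first exact: connect0.
  apply: connect1; rewrite /adj uw uX wX; apply/existsP; exists g.
  by rewrite gE ug wg.
move=> eE /connectP[q]; elim: q e x eE => [|g q IH] e x eE /=.
  by move=> _ -> xe xX yf yX; exact: (step e).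
move=> /andP[/and3P[_ gE /existsP[z /and3P[zX ze zg]]] ps] fE xe xX yf yX.
apply: (connect_trans (step e x z eE xe xX ze zX)).
exact: (IH g z).
Qed.

Lemma block_connected x y : x \in block_verts i -> x \notin X ->
  y \in block_verts i -> y \notin X -> connect adj x y.
Proof.
have inedge u : u \in block_verts i -> exists2 e, e \in block_edges i & u \in e.
  rewrite inE => /orP[/imsetP[z _ ->]|/set1P ->].
    by exists (odd_edge i z.1); rewrite ?odd_in// mem_odd_edge /= !eqxx.
  by exists (even_edge i j0); rewrite ?even_in// mem_even_edge glueV_joint /= !eqxx.
move=> /inedge[e eE xe] xX /inedge[f fE yf] yX.
have [h Hh] := linked_hub.
apply: (linked_adj eE _ xe xX yf yX).
by apply: connect_trans (Hh f fE); rewrite linked_sym; exact: Hh.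
Qed.

End Connectivity.

Lemma block_calU i : in_calU m p (block i).
Proof.
apply/and5P; split.
- apply/forall_inP => e; rewrite /edges /= inE => /orP[/imsetP[j _ ->]|/imsetP[j _ ->]].
    by rewrite card_odd_edge.
  by rewrite card_even_edge.
- by rewrite /verts /= card_block_verts.
- by rewrite /edges /= card_block_edges.
- apply/forall_inP => x; rewrite /verts /= => xV; have [w E] := block_vertsP xV.
  rewrite -[hdeg _ _]/(edeg (block_edges i) x) E edeg_block.
  move: xV; rewrite E mem_block_verts => h; move: (h); rewrite glueV_block.
  have -> : w == (i, joint) = (w.1 == i) && (w.2 == joint).
    by case: w {E h} => ? ?; rewrite xpair_eqE.
  move: h; case: (w.1 == i); case: (_.1 == i) => //=.
apply/andP; split.
  apply/forall_inP => x xV; apply/forall_inP => y yV.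
  have := @block_connected i set0 _ x y xV _ yV _; rewrite cards0 !inE => /(_ isT isT isT).
  apply: connect_sub => u v /and4P[uv _ _ /existsP[e /and3P[eE ue ve]]].
  apply: connect1; rewrite /hadj uv; apply/existsP; exists e.
  by rewrite /edges /= eE ue ve.
apply/forall_inP => z zV; apply/forall_inP => x xV; apply/forall_inP => y yV.
move: xV yV; rewrite /verts /= !inE => /andP[xz xV] /andP[yz yV].
have := @block_connected i [set z] _ x y; rewrite cards1 !inE xz yz.
move=> /(_ isT xV isT yV isT); apply: connect_sub => u v.
move=> /and4P[uv uX vX /existsP[e /and3P[eE ue ve]]].
apply: connect1; rewrite /hadj uv; apply/existsP; exists (e :\: [set z]).
rewrite /edges /= !in_setD ue ve uX vX !andbT; apply/imsetP; exists e => //.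
by rewrite inE eE /=; apply/set0Pn; exists u; rewrite in_setD ue uX.
Qed.

Lemma realize_calH : in_calH m p l realize.
Proof.
split.
  apply/forall_inP => e /bigcupP[i _]; rewrite inE => /orP[/imsetP[j _ ->]|/imsetP[j _ ->]].
    by rewrite card_odd_edge.
  by rewrite card_even_edge.
exists block, (fun i => a (i, joint)); split.
- move=> i; split; [exact: block_calU|exact: block_leaves|].
  apply/setP => x; rewrite in_setI in_set1 /verts /=; apply/andP/eqP.
    move=> [xV]; have [w E] := block_vertsP xV; move: xV; rewrite E !mem_block_verts.
    case: w {E} => i' y /=; rewrite !xpair_eqE => /orP[/eqP ->|/andP[/eqP -> /eqP ->]//].
    rewrite eq_sym (negbTE (ordS_l_neq i)) /= eq_sym => /andP[/eqP E _].
    by have := ordSS_l_neq i; rewrite E eqxx.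
  by move=> ->; rewrite /verts /= !mem_block_verts /= !eqxx ?orbT.
- move=> i j ij jSi iSj; rewrite -setI_eq0; apply/eqP/setP => x; rewrite in_setI in_set0 /verts /=.
  apply/negbTE/negP => /andP[xi].
  have [w E] := block_vertsP xi; move: xi; rewrite E !mem_block_verts.
  case: w {E} => i' y /=; rewrite !xpair_eqE => /orP[/eqP ->|/andP[/eqP -> _]].
    by rewrite (negbTE ij) /= => /andP[/eqP E _]; rewrite E eqxx in iSj.
  rewrite eq_sym (negbTE jSi) /= => /andP[/eqP/ordS_inj E _].
  by rewrite E eqxx in ij.
- apply/setP => x; apply/imsetP/bigcupP => [[w _ ->]|[i _ xV]].
    by exists w.1 => //; rewrite /verts /= mem_block_verts eqxx.
  by have [w ->] := block_vertsP xV; exists w.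
- by [].
Qed.

End Realization.
End Gluing.

Lemma edges_realizeP s (son : forall i, perm_on free_slots (s i)) (T : finType)
    (a : slots -> T) (a_inj : injective a) w e :
  e \in edges (realize son a_inj) -> a w \in e ->
  e = odd_edge a w.1 w.2.1 \/
  e = even_edge s a (glueV son w).1 (glueV son w).2.1.
Proof.
move=> /bigcupP[i _]; rewrite inE => /orP[/imsetP[j _ ->]|/imsetP[j _ ->]].
  by rewrite mem_odd_edge// => /andP[/eqP <- /eqP <-]; left.
by rewrite (mem_even_edge son)// => /andP[/eqP <- /eqP <-]; right.
Qed.

Lemma odd_edge_in s (son : forall i, perm_on free_slots (s i)) (T : finType)
    (a : slots -> T) (a_inj : injective a) i j :
  odd_edge a i j \in edges (realize son a_inj).
Proof. by apply/bigcupP; exists i => //; rewrite inE imset_f. Qed.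

Lemma even_edge_in s (son : forall i, perm_on free_slots (s i)) (T : finType)
    (a : slots -> T) (a_inj : injective a) i j :
  even_edge s a i j \in edges (realize son a_inj).
Proof. by apply/bigcupP; exists i => //; rewrite inE [X in _ || X]imset_f ?orbT. Qed.

(** The hyperedges of a realization are the images under the labelling of a fixed family of sets of
    slots, so sending [a w] to [a' w] is an isomorphism. This compares a copy in [n] with one on m p
    l labels. *)
Lemma realize_hiso s (son : forall i, perm_on free_slots (s i)) (T T' : finType)
    (a : slots -> T) (a_inj : injective a) (a' : slots -> T') (a'_inj : injective a') :
  hiso (realize son a_inj) (realize son a'_inj).
Proof.
pose E0 := edges (realize son (@inj_id slots)).
have EE (U : finType) (b : slots -> U) (bi : injective b) :
    edges (realize son bi) = [set b @: (E : {set slots}) | E in E0].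
  have o i j : b @: odd_edge id i j = odd_edge b i j by rewrite -imset_comp.
  have e i j : b @: even_edge s id i j = even_edge s b i j by rewrite -imset_comp.
  apply/setP => A; apply/idP/imsetP.
    move=> /bigcupP[i _]; rewrite inE => /orP[/imsetP[j _ ->]|/imsetP[j _ ->]].
      by exists (odd_edge id i j); rewrite ?o ?odd_edge_in.
    by exists (even_edge s id i j); rewrite ?e ?even_edge_in.
  move=> [E /bigcupP[i _]]; rewrite inE => /orP[/imsetP[j _ ->]|/imsetP[j _ ->]] ->.
    by rewrite o odd_edge_in.
  by rewrite e even_edge_in.
have Hw (u : vertex (realize son a_inj)) : exists w, val u = a w.
  by have /imsetP[w _ ->] := valP u; exists w.
have [om omE] := choice Hw.
have a'V w : a' w \in verts (realize son a'_inj) by apply: imset_f; rewrite inE.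
have aV w : a w \in verts (realize son a_inj) by apply: imset_f; rewrite inE.
pose f (u : vertex (realize son a_inj)) : vertex (realize son a'_inj) := Sub (a' (om u)) (a'V _).
apply/asboolP; exists f; split.
  have Hw' (u : vertex (realize son a'_inj)) : exists w, val u = a' w.
    by have /imsetP[w _ ->] := valP u; exists w.
  have [om' omE'] := choice Hw'.
  exists (fun u => Sub (a (om' u)) (aV _)) => u; apply: val_inj; rewrite SubK.
    by rewrite omE; congr a; apply/eqP; rewrite -(inj_eq a'_inj) -omE' SubK.
  by rewrite omE'; congr a'; apply/eqP; rewrite -(inj_eq a_inj) -omE SubK.
apply/forallP => A; apply/eqP.
have -> : val @: A = a @: (om @: A).
  by rewrite -imset_comp; apply: eq_imset => u; exact: omE.
have -> : val @: (f @: A) = a' @: (om @: A).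
  by rewrite -!imset_comp; apply: eq_imset => u /=.
by rewrite !EE !mem_imset//; exact: imset_inj.
Qed.

(** * Rigidity: a root and the listings determine the gluing *)

Section Rigid.
Variables (T : finType) (a a' : slots -> T) (s s' : 'I_l -> {perm slot}).
Hypotheses (a_inj : injective a) (a'_inj : injective a').
Hypotheses (son : forall i, perm_on free_slots (s i)) (s'on : forall i, perm_on free_slots (s' i)).
Hypothesis same_edges : edges (realize son a_inj) = edges (realize s'on a'_inj).
Hypothesis same_root : odd_edge a i0 j0 = odd_edge a' i0 j0.
Hypothesis same_odd : forall i j, odd_edge a i j = odd_edge a' i j ->
  forall k, a (i, (j, k)) = a' (i, (j, k)).
Hypothesis same_even : forall i j, even_edge s a i j = even_edge s' a' i j ->
  forall k, a (gluing s (i, (j, k))) = a' (gluing s' (i, (j, k))).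

(** Every vertex is in one odd and one even hyperedge. Equal odd hyperedges with equal listings have
    the same vertex in slot [k0], so the other hyperedge there, the even one, is the same in both
    realizations. *)
Let even_of_odd i j : odd_edge a i j = odd_edge a' i j ->
  even_edge s a i j = even_edge s' a' i j.
Proof.
move=> E; have Ek := same_odd E k0.
have ein : even_edge s a i j \in edges (realize s'on a'_inj).
  by rewrite -same_edges even_edge_in.
have : a' (i, (j, k0)) \in even_edge s a i j.
  by rewrite -Ek (mem_even_edge son)// glueV_k0 /= !eqxx.
move=> /(edges_realizeP ein); rewrite glueV_k0 /= -E => -[H|//].
by have := odd_even_edge son a_inj i j i j; rewrite H eqxx.
Qed.

Let odd_of_even i j i' j' k k' :
  gluing s (i, (j, k)) = (i', (j', k')) -> gluing s' (i, (j, k)) = (i', (j', k')) ->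
  even_edge s a i j = even_edge s' a' i j -> odd_edge a i' j' = odd_edge a' i' j'.
Proof.
move=> g g' E; have Ek := same_even E k; rewrite g g' in Ek.
have oin : odd_edge a i' j' \in edges (realize s'on a'_inj).
  by rewrite -same_edges odd_edge_in.
have : a' (i', (j', k')) \in odd_edge a i' j' by rewrite -Ek mem_odd_edge// !eqxx.
move=> /(edges_realizeP oin) /=; rewrite -g' gluingK /= -E => -[//|H].
by have := odd_even_edge son a_inj i' j' i j; rewrite H eqxx.
Qed.

Let all_odd i j : odd_edge a i j = odd_edge a' i j.
Proof.
have root i1 : odd_edge a i1 j0 = odd_edge a' i1 j0.
  have [k _ <-] := ordS_reach i0 i1; elim: k => [//|k IH] /=.
  by apply: (odd_of_even (gluing_joint son _) (gluing_joint s'on _)); exact: even_of_odd.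
have [k _ <-] := ordS_reach j0 j; elim: k => [//|k IH] /=.
by apply: (odd_of_even (gluing_k1 son _ _) (gluing_k1 s'on _ _)); exact: even_of_odd.
Qed.

(** Agreement spreads from the root through [joint] to the first odd hyperedge of every block and
    through [k1] along each block. The even listings then determine the permutations, as [advance]
    is injective. *)
Lemma realize_rigid : a =1 a' /\ forall i, s i =1 s' i.
Proof.
have aa : a =1 a' by move=> [i [j k]]; exact: same_odd.
split=> // i [j k].
have := same_even (even_of_odd (all_odd i j)) k; rewrite -aa => /a_inj/(congr1 snd) /=.
exact: advance_inj.
Qed.

End Rigid.

(** * From gluings to the number of copies *)

Section Counting.
Variable n : nat.
Local Notation N := (m * p * l).

(** The order in which [t] lists its image, as a permutation relative to [enum]. The default is
    never reached when [t] is injective. *)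
Definition listing_code (t : 'I_p -> 'I_n) (x0 : 'I_n) : 'S_p :=
  odflt 1%g [pick q : 'S_p | [forall k, t k == nth x0 (enum [set t k | k : 'I_p]) (q k)]].

Lemma listing_codeE t x0 k : injective t ->
  t k = nth x0 (enum [set t k | k : 'I_p]) (listing_code t x0 k).
Proof.
move=> ti; rewrite /listing_code; case: pickP => [q /forallP/(_ k)/eqP //|H].
pose e := [set t k | k : 'I_p].
have ce : #|e| = p by rewrite card_imset// card_ord.
have lt k' : index (t k') (enum e) < p.
  by rewrite -[X in _ < X]ce cardE index_mem mem_enum imset_f.
pose r k' := Ordinal (lt k').
have ri : injective r.
  move=> k' k'' /(congr1 val) /= E; apply: ti.
  by rewrite -(nth_index x0 (_ : t k' \in enum e)) ?E ?nth_index ?mem_enum ?imset_f.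
have := H (perm ri) => /negP[]; apply/forallP => k'.
by rewrite permE /= nth_index// mem_enum imset_f.
Qed.

Lemma listing_code_inj t t' x0 : injective t -> injective t' ->
  [set t k | k : 'I_p] = [set t' k | k : 'I_p] ->
  listing_code t x0 = listing_code t' x0 -> t =1 t'.
Proof.
by move=> ti ti' E C k; rewrite (listing_codeE x0 k ti) (listing_codeE x0 k ti') E C.
Qed.

Lemma card_slots : #|{: slots}| = N.
Proof. by rewrite !card_prod !card_ord mulnC. Qed.

Lemma realize_copies s (son : forall i, perm_on free_slots (s i)) (a : slots -> 'I_n)
    (a_inj : injective a) : realize son a_inj \in copies n m p l.
Proof.
(* The slots themselves, numbered, serve as the m p l labels on which the transversal is defined. *)
pose b (w : slots) : 'I_N := cast_ord card_slots (enum_rank w).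
have bi : injective b by move=> w w' /cast_ord_inj/enum_rank_inj.
have [H HC iso] := exists_calH (realize_calH son bi).
by apply/copiesP; exists H => //; apply: hiso_trans iso; exact: realize_hiso.
Qed.

Definition edges_of (z : {ffun slots -> 'I_n} * {ffun 'I_l -> {perm slot}}) : {set {set 'I_n}} :=
  \bigcup_i block_edges z.2 z.1 i.

Let e_gt0 : 0 < 2 * m * l. Proof. by rewrite !muln_gt0 m_gt0 l_gt0. Qed.

(* A copy together with a root hyperedge and the listings of all hyperedges determines the slots. *)
Definition gluing_code (x0 : 'I_n) (z : {ffun slots -> 'I_n} * {ffun 'I_l -> {perm slot}}) :
    {set {set 'I_n}} * ('I_(2 * m * l) *
      ({ffun 'I_l * 'I_m -> 'S_p} * {ffun 'I_l * 'I_m -> 'S_p})) :=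
  (edges_of z,
   (insubd (Ordinal e_gt0) (index (odd_edge z.1 i0 j0) (enum (edges_of z))),
    ([ffun q => listing_code (fun k => z.1 (q.1, (q.2, k))) x0],
     [ffun q => listing_code (fun k => z.1 (gluing z.2 (q.1, (q.2, k)))) x0]))).

Definition gluings : {set {ffun slots -> 'I_n} * {ffun 'I_l -> {perm slot}}} :=
  setX [set a : {ffun slots -> 'I_n} | injectiveb a]
       [set s : {ffun 'I_l -> {perm slot}} | [forall i, perm_on free_slots (s i)]].

Lemma card_gluings : #|gluings| = n ^_ N * ((m * (p - 2)).-1)`! ^ l.
Proof.
rewrite cardsX card_inj_ffuns card_slots card_ord; congr (_ * _).
rewrite -card_free_slots -card_perm -[in RHS](card_ord l) -card_ffun_on.
by rewrite cardsE; apply: eq_card => s; apply/forallP/ffun_onP.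
Qed.

(** The code supplies the hypotheses of [realize_rigid]: the hyperedge set, the root, and equality
    of the listings whenever two corresponding hyperedges coincide. *)
Lemma gluing_code_inj x0 : {in gluings &, injective (gluing_code x0)}.
Proof.
move=> [a s] [a' s']; rewrite !inE /= => /andP[/injectiveP ai /forallP son].
move=> /andP[/injectiveP a'i /forallP s'on] [E Ei Eo Ee].
have card_e : #|edges_of (a, s)| = 2 * m * l.
  by have := good_edges (copies_good p3 l4 (realize_copies son ai)).
have rin : odd_edge a i0 j0 \in edges_of (a, s) by have := odd_edge_in son ai i0 j0.
have rin' : odd_edge a' i0 j0 \in edges_of (a, s).
  by rewrite E; have := odd_edge_in s'on a'i i0 j0.
have lt e : e \in edges_of (a, s) -> index e (enum (edges_of (a, s))) < 2 * m * l.
  by move=> eE; rewrite -card_e cardE index_mem mem_enum.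
(* Both indices are below the number of hyperedges, so [insubd] keeps them. *)
have Er : odd_edge a i0 j0 = odd_edge a' i0 j0.
  move: Ei; rewrite /= -E => /(congr1 val); rewrite !val_insubd !lt// => Ei.
  rewrite -(nth_index finset.set0 (_ : odd_edge a i0 j0 \in enum (edges_of (a, s)))) ?mem_enum//.
  by rewrite Ei nth_index ?mem_enum.
have Ho i j : odd_edge a i j = odd_edge a' i j ->
    forall k, a (i, (j, k)) = a' (i, (j, k)).
  move=> Eij; have := congr1 (fun f : {ffun _ -> _} => f (i, j)) Eo; rewrite !ffunE /= => C.
  apply: (listing_code_inj _ _ Eij C).
    by move=> k' k'' /ai[].
  by move=> k' k'' /a'i[].
have He i j : even_edge s a i j = even_edge s' a' i j ->
    forall k, a (gluing s (i, (j, k))) = a' (gluing s' (i, (j, k))).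
  move=> Eij; have := congr1 (fun f : {ffun _ -> _} => f (i, j)) Ee; rewrite !ffunE /= => C.
  apply: (listing_code_inj _ _ Eij C).
    by move=> k' k'' /ai/(gluing_inj son)[].
  by move=> k' k'' /a'i/(gluing_inj s'on)[].
have [aa ss] := @realize_rigid _ a a' s s' ai a'i son s'on E Er Ho He.
congr pair; first exact/ffunP.
by apply/ffunP => i; apply/permP; exact: ss.
Qed.

(** The first component of the injective code is the hyperedge set of a copy; the rest takes E
    (p!)^E values, with (p!)^(lm) for the odd listings and as many for the even ones. *)
Lemma card_copies_ge : 0 < n ->
  n ^_ N * ((m * (p - 2)).-1)`! ^ l <= #|copies n m p l| * (2 * m * l * p`! ^ (2 * m * l)).
Proof.
move=> n0; rewrite -card_gluings -(card_in_imset (gluing_code_inj (x0 := Ordinal n0))).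
apply: (@leq_trans #|setX [set edges S | S in copies n m p l]
  [set: 'I_(2 * m * l) * ({ffun 'I_l * 'I_m -> 'S_p} * {ffun 'I_l * 'I_m -> 'S_p})]|).
  apply: subset_leq_card; apply/subsetP => q /imsetP[[a s]].
  rewrite !inE /= => /andP[/injectiveP ai /forallP son] ->.
  rewrite /= ?andbT; apply/imsetP; exists (realize son ai) => //.
  exact: realize_copies.
rewrite cardsX cardsT !card_prod !card_ffun !card_prod !card_ord card_Sn.
rewrite leq_mul ?leq_imset_card// leq_mul// -expnD.
by rewrite (_ : l * m + l * m = 2 * m * l)//; lia.
Qed.

End Counting.

End Slots.

From mathcomp Require Import ring lra.
Import Order.TTheory GRing.Theory Num.Theory.
Local Open Scope ring_scope.

(** * Overlaps of two copies *)

Section SecondMoment.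
Variables (K : realFieldType) (n m p l : nat).
Hypotheses (m_gt0 : (0 < m)%N) (p3 : (3 <= p)%N) (l4 : (4 <= l)%N) (n_gt0 : (0 < n)%N).
Local Notation N := (m * p * l)%N.
Local Notation E := (2 * m * l)%N.
Local Notation C := (copies n m p l).

Lemma copies_inj : {in C &, injective (@edges 'I_n)}.
Proof.
move=> S S' SC S'C H; apply: hgraph_eqP => //.
by rewrite (good_verts_cover (copies_good p3 l4 SC)) (good_verts_cover (copies_good p3 l4 S'C)) H.
Qed.

Variables (y B L : K).
Hypotheses (yn : y ^+ 2 = n%:R) (y1 : 1 <= y) (L1 : 1 <= L) (B1 : 1 <= B)
  (BL : B <= L * y ^+ p).

(** Here [y] is sqrt n, [B] stands for 1 + a^(-2) and [L] for the constant 1 + lambda^(-2). With c =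
    #|cover J|, the sum is at most L^E N^(pE) y^(2(N-c) + p|J|), and by [good_sub_cover] the
    exponent of y is at most 2N - 1. *)
Lemma overlap_term_le (S : hgraph 'I_n) (J : {set {set 'I_n}}) :
  S \in C -> J \subset edges S -> J != set0 -> J != edges S ->
  \sum_(S' in C | edges S :&: edges S' == J) B ^+ #|J| <=
    L ^+ E * (N ^ (p * E))%:R * n%:R ^+ N / y.
Proof.
move=> SC JS J0 JE; have gS := copies_good p3 l4 SC.
have y0 : 0 < y by apply: lt_le_trans y1.
pose Q := [set S' in C | edges S :&: edges S' == J].
have QE : #|Q| = #|[pred S' in C | edges S :&: edges S' == J]|.
  by apply: eq_card => S'; rewrite !inE.
have N_gt0 : (0 < N)%N by rewrite !muln_gt0 m_gt0; lia.
have cQ : (#|Q| <= n ^ (N - #|cover J|) * N ^ (p * E))%N.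
  apply: card_extensions => // S'; rewrite inE => /andP[S'C /eqP <-].
  by split; [exact: copies_good|exact: subsetIr].
have cover_lt := good_sub_cover gS JS J0 JE.
have cN : (#|cover J| <= N)%N.
  apply: leq_trans (good_verts gS); apply: subset_leq_card.
  rewrite (good_verts_cover gS); apply/bigcupsP => e eJ; apply: bigcup_sup.
  exact: (subsetP JS).
have JleE : (#|J| <= E)%N by rewrite -(good_edges gS) subset_leq_card.
rewrite sumr_const -QE -[_ *+ #|Q|]mulr_natl ler_pdivlMr//.
apply: (@le_trans _ _ ((n ^ (N - #|cover J|) * N ^ (p * E))%:R * (L ^+ E * y ^+ (p * #|J|)) * y)).
  have B0 : 0 <= B by apply: le_trans B1.
  rewrite ler_pM2r//; apply: ler_pM; rewrite ?ler0n ?ler_nat ?exprn_ge0//.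
  apply: le_trans (_ : (L * y ^+ p) ^+ #|J| <= _).
    have L0 : 0 <= L by apply: le_trans L1.
    by apply: lerXn2r => //; rewrite nnegrE ?mulr_ge0 ?exprn_ge0// ltW.
  rewrite exprMn -exprM; apply: ler_wpM2r; first by rewrite exprn_ge0 ?ltW.
  exact: ler_weXn2l.
rewrite natrM natrX -yn -!exprM.
have -> : y ^+ (2 * (N - #|cover J|)) * (N ^ (p * E))%:R * (L ^+ E * y ^+ (p * #|J|)) * y =
  L ^+ E * (N ^ (p * E))%:R * y ^+ (2 * (N - #|cover J|) + p * #|J| + 1).
  rewrite !exprD expr1.
  have gen (u v w z : K) : u * z * (w * v) * y = w * z * (u * v * y) by ring.
  exact: gen.
apply: ler_wpM2l.
  by rewrite mulr_ge0 ?ler0n// exprn_ge0// (le_trans _ L1).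
by apply: ler_weXn2l => //; lia.
Qed.

(** Sorted by the set [J] of common hyperedges: pairs with [J] empty contribute at most |C|^2, a
    full overlap forces S' = S, and at most 2^E sets [J] lie in between. *)
Lemma overlap_sum_le :
  \sum_(S in C) \sum_(S' in C) B ^+ #|edges S :&: edges S'| <=
  #|C|%:R ^+ 2 + #|C|%:R * B ^+ E +
  #|C|%:R * (2 ^+ E * (L ^+ E * (N ^ (p * E))%:R * n%:R ^+ N / y)).
Proof.
set Z := L ^+ E * _ * _ / y.
have y0 : 0 < y by apply: lt_le_trans y1.
have B0 : 0 <= B by apply: le_trans B1.
have L0 : 0 <= L by apply: le_trans L1.
have Z0 : 0 <= Z.
  apply: divr_ge0; last exact: ltW.
  by apply: mulr_ge0; [apply: mulr_ge0; rewrite ?exprn_ge0 ?ler0n|rewrite exprn_ge0 ?ler0n].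
have -> : #|C|%:R ^+ 2 + #|C|%:R * B ^+ E + #|C|%:R * (2 ^+ E * Z) =
  \sum_(S in C) (#|C|%:R + B ^+ E + 2 ^+ E * Z).
  by rewrite sumr_const -mulr_natl; ring.
apply: ler_sum => S SC; have gS := copies_good p3 l4 SC.
rewrite (partition_big (fun S' => edges S :&: edges S')
  (fun J => J \in powerset (edges S)))/=; last first.
  by move=> S' _; rewrite inE subsetIl.
apply: (@le_trans _ _ (\sum_(J in powerset (edges S))
  ((if J == set0 then #|C|%:R else 0) + (if J == edges S then B ^+ E else 0) + Z))).
  apply: ler_sum => J; rewrite inE => JS.
  rewrite (eq_bigr (fun=> B ^+ #|J|)); last by move=> S' /andP[_ /eqP ->].
  have [->|J0] := eqVneq J set0.
    rewrite cards0 expr0 -addrA; apply: ler_wpDr.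
      by rewrite addr_ge0//; case: ifP => // _; rewrite exprn_ge0.
    rewrite sumr_const ler_nat; apply: subset_leq_card.
    by apply/subsetP => S' /andP[].
  rewrite add0r; have [->|JE] := eqVneq J (edges S).
    apply: ler_wpDr => //; rewrite (good_edges gS).
    rewrite sumr_const -[leRHS]mulr1n; apply: ler_wpMn2l; first by rewrite exprn_ge0.
    rewrite -(cards1 S); apply: subset_leq_card; apply/subsetP => S'.
    move=> /andP[S'C /eqP/setIidPl sub]; rewrite inE; apply/eqP; apply: copies_inj => //.
    apply/esym/eqP; rewrite eqEcard sub (good_edges gS).
    by rewrite (good_edges (copies_good p3 l4 S'C)) leqnn.
  by rewrite add0r; exact: overlap_term_le.
rewrite !big_split/= -!big_mkcondr/=; apply: lerD; first apply: lerD.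
- rewrite (big_pred1 set0)// => J /=; rewrite inE; apply/andP/eqP => [[_ /eqP]//|->].
  by rewrite sub0set eqxx.
- rewrite (big_pred1 (edges S))// => J /=; rewrite inE; apply/andP/eqP => [[_ /eqP]//|->].
  by rewrite subxx eqxx.
- by rewrite sumr_const card_powerset (good_edges gS) -natrX mulr_natl.
Qed.

End SecondMoment.

From mathcomp Require Import all_classical all_reals all_analysis measurable_realfun.
Import Order.TTheory GRing.Theory Num.Theory.
Import numFieldNormedType.Exports.
Local Open Scope classical_set_scope.

(** * Moments of normal variables and independence *)

Section NormalMoments.
Variable K : realType.
Local Notation mu := (@lebesgue_measure K).
Local Notation phi := (@normal_pdf K 0 1).
Local Notation nu := (@normal_prob K 0 1).

(** The Gaussian law is absolutely continuous, and its Radon-Nikodym derivative agrees almost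
    everywhere with the explicit density, since both have the same integrals over measurable
    sets. *)
Lemma ge0_integral_normal_prob (f : K -> \bar K) :
  (forall x, 0 <= f x)%E -> measurable_fun setT f ->
  (\int[nu]_x f x = \int[mu]_x (f x * (phi x)%:E))%E.
Proof.
move=> f0 mf.
have dom : nu `<< mu := @normal_prob_dominates K 0 1.
rewrite -(Radon_Nikodym_SigmaFinite.change_of_variables dom)//.
apply: ae_eq_integral => //.
- apply: emeasurable_funM => //; apply: (measurable_int mu).
  exact: Radon_Nikodym_SigmaFinite.f_integrable.
- apply: emeasurable_funM => //; apply/measurable_EFinP.
  exact: measurable_normal_pdf.
- apply: ae_eqe_mul2l => /=; apply: integral_ae_eq => //=.
  + exact: Radon_Nikodym_SigmaFinite.f_integrable.
  + by apply/measurable_EFinP; exact: measurable_normal_pdf.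
  + by move=> E E01 mE; rewrite -Radon_Nikodym_SigmaFinite.f_integral.
Qed.

Lemma normal_pdf01E x : phi x = normal_peak 1 * expR (- x ^+ 2 / 2).
Proof.
by rewrite normal_pdfE ?oner_neq0// /normal_fun subr0 expr1n.
Qed.

Lemma is_derive_normal_pdf01 (x : K) : is_derive x 1 phi (- x * phi x).
Proof.
have -> : phi = (fun x => normal_peak 1 * expR (- x ^+ 2 / 2)).
  by apply/funext => y; rewrite normal_pdf01E.
have H : is_derive x 1 (fun x : K => - x ^+ 2 / 2) (- x).
  apply: is_derive_eq; rewrite /GRing.scale /=.
  by field.
have He : is_derive x 1 (expR \o (fun x : K => - x ^+ 2 / 2))
    (expR (- x ^+ 2 / 2) * - x).
  exact: (@is_derive1_comp K (expR : K -> K) (fun x => - x ^+ 2 / 2) x _ _ (is_derive_expR _) H).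
have -> : - x * (normal_peak 1 * expR (- x ^+ 2 / 2)) =
  normal_peak 1 *: (expR (- x ^+ 2 / 2) * - x) :> K^o.
  by rewrite /GRing.scale /=; ring.
exact: (is_deriveZ (normal_peak 1 : K)).
Qed.

Lemma continuous_normal_pdf01 : continuous phi.
Proof. by apply: continuous_normal_pdf; rewrite oner_neq0. Qed.

Lemma is_derive_xnormal_pdf01 (x : K) :
  is_derive x 1 (fun x => - (x * phi x)) ((x ^+ 2 - 1) * phi x).
Proof.
have H := is_derive_normal_pdf01 x.
apply: is_derive_eq; rewrite /GRing.scale /=; ring.
Qed.

(** From exp(x^2/2) >= x^2/2; this crude bound gives the decay of the boundary term at infinity. *)
Lemma xnormal_pdf01_le (x : K) : 0 < x -> x * phi x <= (normal_peak 1 * 2) / x.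
Proof.
move=> x0; rewrite normal_pdf01E mulrCA -mulrA ler_wpM2l ?normal_peak_ge0//.
rewrite mulNr expRN ler_pdivrMr ?expR_gt0//.
have -> : x = 2 / x * (x ^+ 2 / 2) by field; lra.
have -> : 2 / (2 / x * (x ^+ 2 / 2)) = 2 / x :> K by field; lra.
apply: ler_wpM2l; first by rewrite divr_ge0//; lra.
have -> : 2 / x * (x ^+ 2 / 2) = x :> K by field; lra.
by apply: le_trans (expR_ge1Dx _); rewrite lerDr.
Qed.

Lemma cvg_xnormal_pdf01 : - (x * phi x) @[x --> +oo] --> (0 : K).
Proof.
rewrite -[X in _ --> X]oppr0; apply: cvgN.
apply: (@squeeze_cvgr _ _ _ _ (cst 0) (fun x => (normal_peak 1 * 2) * x^-1)).
- near=> x; rewrite /= xnormal_pdf01_le// andbT mulr_ge0 ?normal_pdf_ge0//.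
- exact: cvg_cst.
- rewrite -[X in _ --> X](mulr0 (normal_peak 1 * 2)).
  apply: cvgM; first exact: cvg_cst.
  apply/gtr0_cvgV0; last exact: cvg_id.
  by near=> x.
Unshelve. all: by end_near. Qed.

Lemma continuous_xnormal_pdf01 : continuous (fun x : K => - (x * phi x)).
Proof.
by move=> x; apply: cvgN; apply: cvgM; [exact: cvg_id|exact: continuous_normal_pdf01].
Qed.

Let meas_poly (f : K -> K) : continuous f ->
  forall D, measurable_fun D (EFin \o (fun x => f x * phi x)).
Proof.
move=> cf D; apply/measurable_funTS/measurable_EFinP/measurable_funM.
  exact: continuous_measurable_fun.
exact: measurable_normal_pdf.
Qed.

Let sqrC : continuous (fun x : K => x ^+ 2).
Proof. exact: sqr_continuous. Qed.

Lemma integral_sqr_normal_pdf01_unit :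
  (\int[mu]_(x in `[0%R, 1%R]) (phi x)%:E =
   \int[mu]_(x in `[0%R, 1%R]) (x ^+ 2 * phi x)%:E + (phi 1)%:E)%E.
Proof.
have F2 : (\int[mu]_(x in `[0%R, 1%R]) ((1 - x ^+ 2) * phi x)%:E = (phi 1)%:E)%E.
  have -> : (phi 1)%:E = ((1 * phi 1)%:E - (0 * phi 0)%:E)%E.
    by rewrite -EFinB mul1r mul0r subr0.
  apply: (@continuous_FTC2 K _ (fun x => x * phi x)) => //.
  - apply: continuous_subspaceT => x; apply: cvgM; last exact: continuous_normal_pdf01.
    by apply: cvgB; [exact: cvg_cst|exact: sqrC].
  - split.
    + by move=> x _; have := is_derive_normal_pdf01 x => H; exact: ex_derive.
    + apply: cvg_at_right_filter; apply: cvgM; [exact: cvg_id|exact: continuous_normal_pdf01].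
    + apply: cvg_at_left_filter; apply: cvgM; [exact: cvg_id|exact: continuous_normal_pdf01].
  - move=> x _; have H := is_derive_normal_pdf01 x.
    rewrite derive1E derive_val /GRing.scale /=; ring.
rewrite -F2 -ge0_integralD//.
- by apply: eq_integral => x _; rewrite -EFinD; congr EFin; ring.
- by move=> x _; rewrite lee_fin mulr_ge0 ?sqr_ge0 ?normal_pdf_ge0.
- exact: (meas_poly sqrC).
- move=> x /=; rewrite in_itv/= => /andP[x0 x1].
  by rewrite lee_fin mulr_ge0 ?normal_pdf_ge0// subr_ge0 expr_le1.
- apply: (meas_poly (f := fun x => 1 - x ^+ 2)) => x.
  by apply: cvgB; [exact: cvg_cst|exact: sqrC].
Qed.

Lemma integral_sqr_normal_pdf01_tail :
  (\int[mu]_(x in `[1%R, +oo[) (x ^+ 2 * phi x)%:E =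
   \int[mu]_(x in `[1%R, +oo[) (phi x)%:E + (phi 1)%:E)%E.
Proof.
have F2 : (\int[mu]_(x in `[1%R, +oo[) ((x ^+ 2 - 1) * phi x)%:E = (phi 1)%:E)%E.
  have -> : (phi 1)%:E = (0%:E - (- (1 * phi 1))%:E)%E.
    by rewrite -EFinB mul1r sub0r opprK.
  apply: (@ge0_continuous_FTC2y K _ (fun x => - (x * phi x))) => //.
  - by move=> x x1; rewrite mulr_ge0 ?normal_pdf_ge0// subr_ge0 expr_ge1//; lra.
  - apply: continuous_subspaceT => x; apply: cvgM; last exact: continuous_normal_pdf01.
    by apply: cvgB; [exact: sqrC|exact: cvg_cst].
  - exact: cvg_xnormal_pdf01.
  - by move=> x _; have := is_derive_xnormal_pdf01 x => H; exact: ex_derive.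
  - by apply: cvg_at_right_filter; exact: continuous_xnormal_pdf01.
  - by move=> x _; have H := is_derive_xnormal_pdf01 x; rewrite derive1E derive_val.
rewrite -F2 -ge0_integralD//.
- by apply: eq_integral => x _; rewrite -EFinD; congr EFin; ring.
- by move=> x _; rewrite lee_fin normal_pdf_ge0.
- by apply/measurable_funTS/measurable_EFinP; exact: measurable_normal_pdf.
- move=> x /=; rewrite in_itv/= andbT => x1.
  by rewrite lee_fin mulr_ge0 ?normal_pdf_ge0// subr_ge0 expr_ge1//; lra.
- apply: (meas_poly (f := fun x => x ^+ 2 - 1)) => x.
  by apply: cvgB; [exact: sqrC|exact: cvg_cst].
Qed.

(** The function -x phi(x) is a primitive of (x^2 - 1) phi(x). The half-line is cut at 1, where this
    integrand changes sign, so that each piece involves nonnegative integrands only; the boundary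
    terms phi(1) of the two pieces cancel. *)
Lemma integral_sqr_normal_pdf01 : (\int[mu]_x (x ^+ 2 * phi x)%:E = 1)%E.
Proof.
have split (f : K -> \bar K) : (forall x, 0 <= f x)%E -> measurable_fun setT f ->
    (\int[mu]_(x in [set x | (0 <= x)%R]) f x =
     \int[mu]_(x in `[0%R, 1%R]) f x + \int[mu]_(x in `[1%R, +oo[) f x)%E.
  move=> f0 mf.
  rewrite -(@integral_itv_obnd_cbnd _ 1%R +oo%O _ (measurable_funTS mf)).
  rewrite -ge0_integral_setU//; last 2 first.
  - exact: measurable_funTS.
  - apply/disj_setPS => x /=; rewrite !in_itv/= andbT => -[/andP[_ h1] h2].
    by have := lt_le_trans h2 h1; rewrite ltxx.
  congr (integral _ _ _); apply/seteqP; split => x /=; rewrite !in_itv/= ?andbT.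
  - by move=> ->; case: (leP x 1) => h; [left|right].
  - by move=> [/andP[]//|/ltW]; apply: le_trans.
rewrite ge0_symfun_integralT//; last 3 first.
- by move=> x; rewrite mulr_ge0 ?sqr_ge0 ?normal_pdf_ge0.
- move=> x; apply: cvgM; [exact: sqrC|exact: continuous_normal_pdf01].
- by move=> x /=; rewrite !normal_pdf01E sqrrN.
rewrite -(integral_normal_pdf 0 1) ge0_symfun_integralT//; last 3 first.
- by move=> x; rewrite normal_pdf_ge0.
- exact: continuous_normal_pdf01.
- by move=> x /=; rewrite !normal_pdf01E sqrrN.
congr (_ * _)%E; rewrite !split//.
- rewrite integral_sqr_normal_pdf01_tail integral_sqr_normal_pdf01_unit.
  by rewrite -[RHS]addeA [((phi 1)%:E + _)%E]addeC.
- by move=> x; rewrite lee_fin normal_pdf_ge0.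
- by apply/measurable_EFinP; exact: measurable_normal_pdf.
- by move=> x; rewrite lee_fin mulr_ge0 ?sqr_ge0 ?normal_pdf_ge0.
- exact: (meas_poly sqrC).
Qed.

Lemma integral_sqr_normal_prob01 : (\int[nu]_x (x ^+ 2)%:E = 1)%E.
Proof.
rewrite ge0_integral_normal_prob//.
- by rewrite -integral_sqr_normal_pdf01; apply: eq_integral => x _; rewrite -EFinM.
- by move=> x; rewrite lee_fin sqr_ge0.
- by apply/measurable_EFinP; exact: continuous_measurable_fun.
Qed.

Lemma integrable_id_normal_prob01 : nu.-integrable setT (fun x : K => x%:E).
Proof.
apply: (@le_integrable _ _ _ nu _ measurableT _ (fun x => 1%:E + (x ^+ 2)%:E)%E).
- exact/measurable_EFinP.
- move=> x _; rewrite -EFinD /= lee_fin ler_norml.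
  rewrite ger0_norm; last by have := sqr_ge0 x; lra.
  have := sqr_ge0 (x - 2^-1); have := sqr_ge0 (x + 2^-1).
  rewrite !expr2 => h1 h2; apply/andP; split; nra.
- apply: integrableD => //; first exact: finite_measure_integrable_cst.
  apply/integrableP; split.
    by apply/measurable_EFinP; exact: continuous_measurable_fun.
  under eq_integral do rewrite gee0_abs ?lee_fin ?sqr_ge0//.
  by rewrite integral_sqr_normal_prob01 ltry.
Qed.

Lemma normal_prob01N (A : set K) : measurable A ->
  nu ((-%R : K -> K) @^-1` A) = nu A.
Proof.
move=> mA; rewrite /normal_prob.
transitivity (\int[mu]_(x in (-%R : K -> K) @^-1` A)
    (((fun x : K => (phi x)%:E) \o (-%R : K -> K)) x))%E.
  by apply: eq_integral => x _ /=; rewrite !normal_pdf01E sqrrN.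
rewrite -(@ge0_integral_pushforward _ _ _ _ _
  (-%R : measurableTypeR K -> measurableTypeR K))//=.
- by apply: eq_measure_integral => B mB _; exact: lebesgue_measureN.
- by apply/measurable_funTS/measurable_EFinP; exact: measurable_normal_pdf.
- by move=> x _; rewrite lee_fin normal_pdf_ge0.
Qed.

(** The law is invariant under x -> -x, so this finite integral equals its opposite. *)
Lemma integral_id_normal_prob01 : (\int[nu]_x x%:E = 0)%E.
Proof.
have fin : (\int[nu]_x x%:E \is a fin_num)%E.
  by apply: integrable_fin_num => //; exact: integrable_id_normal_prob01.
suff : (\int[nu]_x x%:E = - \int[nu]_x x%:E)%E.
  move: fin => /fineK <-; rewrite -EFinN => -[] h; congr EFin; lra.
rewrite -[RHS]integralN//=; last first.
  by apply: integrable_add_def => //; exact: integrable_id_normal_prob01.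
transitivity (\int[pushforward nu
    (-%R : measurableTypeR K -> measurableTypeR K)]_x x%:E)%E.
  by apply: eq_measure_integral => A mA _; exact/esym/normal_prob01N.
rewrite integral_pushforward//=.
rewrite preimage_setT.
exact: (integrableN integrable_id_normal_prob01).
Qed.

End NormalMoments.

Section HasMean.
Context d (T : measurableType d) (K : realType).
Implicit Type P : {measure set T -> \bar K}.

(** Integrability is bundled with the value, so that sums and products of means compose without
    separate side conditions. *)
Definition has_mean P (X : T -> K) (c : K) : Prop :=
  P.-integrable setT (EFin \o X) /\ (\int[P]_w (X w)%:E = c%:E)%E.

Lemma has_mean_eq P (X Y : T -> K) (c c' : K) : X =1 Y -> c = c' ->
  has_mean P X c -> has_mean P Y c'.
Proof. by move=> /funext -> ->. Qed.

Lemma has_mean_measurable P X c : has_mean P X c -> measurable_fun setT X.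
Proof. by move=> [/integrableP[+ _] _] => /measurable_EFinP. Qed.

Lemma has_meanD P X Y a b : has_mean P X a -> has_mean P Y b ->
  has_mean P (fun w => X w + Y w) (a + b).
Proof.
move=> [iX eX] [iY eY]; split.
  by have := integrableD measurableT iX iY; apply: eq_integrable.
under eq_integral do rewrite EFinD.
by rewrite integralD// eX eY.
Qed.

Lemma has_meanZ P X a k : has_mean P X a ->
  has_mean P (fun w => k * X w) (k * a).
Proof.
move=> [iX eX]; split.
  by have := integrableZl measurableT k iX; apply: eq_integrable.
under eq_integral do rewrite EFinM.
by rewrite integralZl// eX.
Qed.

Lemma has_mean0 P : has_mean P (fun=> 0) 0.
Proof. by split; [exact: integrable0|rewrite integral0]. Qed.

Lemma has_mean_sum P (I : Type) (s : seq I) (Q : pred I) (X : I -> T -> K) c :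
  (forall i, Q i -> has_mean P (X i) (c i)) ->
  has_mean P (fun w => \sum_(i <- s | Q i) X i w) (\sum_(i <- s | Q i) c i).
Proof.
move=> H; elim: s => [|i s IH].
  by apply: has_mean_eq (has_mean0 P) => [w|]; rewrite big_nil.
have [Qi|Qi] := boolP (Q i).
  apply: has_mean_eq (has_meanD (H i Qi) IH) => [w|]; by rewrite big_cons Qi.
by apply: has_mean_eq IH => [w|]; rewrite big_cons (negbTE Qi).
Qed.

Lemma has_mean_cst (P : probability T K) c : has_mean P (fun=> c) c.
Proof.
split; first exact: finite_measure_integrable_cst.
by rewrite integral_cst//= probability_setT mule1.
Qed.

Lemma has_mean_ae P X Y a : measurable_fun setT Y -> {ae P, forall w, X w = Y w} ->
  has_mean P X a -> has_mean P Y a.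
Proof.
move=> mY XY [iX eX].
have E : ae_eq P setT (EFin \o X) (EFin \o Y).
  by apply: filterS XY => w /= + _ => ->.
split.
  apply/integrableP; split; first exact/measurable_EFinP.
  move/integrableP: iX => [mX]; apply: le_lt_trans.
  rewrite le_eqVlt; apply/orP; left; apply/eqP; apply: ge0_ae_eq_integral => //.
  - by apply: measurableT_comp => //; exact/measurable_EFinP.
  - by apply: measurableT_comp.
  - by apply: filterS XY => w /= + _ => ->.
rewrite -eX; apply/esym; apply: ae_eq_integral => //; last exact/measurable_EFinP.
exact: measurable_int iX.
Qed.

(** The number [(k != 1%N)%:R] encodes the moments 1, 0, 1. Orders up to two suffice because a
    hyperedge occurs at most once in each of two copies. *)
Lemma has_mean_standard_normal (P : probability T K) (X : {RV P >-> K}) k :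
  standard_normal X -> (k <= 2)%N ->
  has_mean P (fun w => X w ^+ k) (k != 1%N)%:R.
Proof.
move=> sX k2.
suff H : (@normal_prob K 0 1).-integrable setT (fun x : K => (x ^+ k)%:E) /\
    (\int[@normal_prob K 0 1]_x (x ^+ k)%:E = ((k != 1%N)%:R : K)%:E)%E.
  have mk : measurable_fun setT (fun x : K => (x ^+ k)%:E).
    by apply/measurable_EFinP; exact: exprn_measurable.
  (* [normal_prob] lives on [measurableTypeR K], whose display differs from that of [K]. *)
  have mid : measurable_fun setT (fun x : measurableTypeR K => x : K) by [].
  pose id_mixin := isMeasurableFun.Build _ _ _ _ _ mid.
  pose idm : {mfun measurableTypeR K >-> K} := 
    HB.pack (fun x : measurableTypeR K => x : K) id_mixin.
  have E (f : K -> \bar K) : (forall x, 0 <= f x)%E -> measurable_fun setT f ->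
      (\int[distribution P X]_y f y = \int[@normal_prob K 0 1]_y f y)%E.
    move=> f0 mf; transitivity (\int[pushforward (@normal_prob K 0 1) idm]_y f y)%E.
      by apply: eq_measure_integral => A mA _; exact: sX.
    by rewrite ge0_integral_pushforward.
  have E' (f : K -> \bar K) : (@normal_prob K 0 1).-integrable setT f -> measurable_fun setT f ->
      (\int[distribution P X]_y f y = \int[@normal_prob K 0 1]_y f y)%E.
    move=> f0 mf; transitivity (\int[pushforward (@normal_prob K 0 1) idm]_y f y)%E.
      by apply: eq_measure_integral => A mA _; exact: sX.
    by rewrite integral_pushforward.
  have iX : P.-integrable setT ((fun x : K => (x ^+ k)%:E) \o X).
    apply/integrableP; split; first exact: measurableT_comp.
    have -> : (\int[P]_w `|((fun x : K => (x ^+ k)%:E) \o X) w|)%E =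
       (\int[distribution P X]_y `|(y ^+ k)%:E|)%E.
      by rewrite ge0_integral_distribution//; exact: measurableT_comp.
    by rewrite E//; [case: H => /integrableP[]|exact: measurableT_comp].
  split=> //.
  by rewrite -H.2 -E'//; [rewrite integral_distribution|exact: H.1].
case: k k2 => [|[|[|//]]] _ /=.
- split; first exact: finite_measure_integrable_cst.
  rewrite (_ : (fun x : K => (x ^+ 0)%:E) = cst 1%E)//.
  by rewrite integral_cst//= probability_setT mule1.
- split; first exact: integrable_id_normal_prob01.
  exact: integral_id_normal_prob01.
- split; last exact: integral_sqr_normal_prob01.
  apply/integrableP; split.
    by apply/measurable_EFinP; exact: exprn_measurable.
  under eq_integral do rewrite gee0_abs ?lee_fin ?sqr_ge0//.
  by rewrite integral_sqr_normal_prob01 ltry.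
Qed.

End HasMean.

(** * Joint laws determined by boxes, and means of independent products *)

Section Boxes.
Variable K : realType.

Definition boxes (I : Type) : set (set (I -> K)) :=
  [set A | exists2 B : I -> set K, forall i, measurable (B i) &
           A = [set y | forall i, B i (y i)]].

Definition box_space (I : Type) := g_sigma_algebraType (@boxes I).

Lemma boxesI (I : Type) : setI_closed (@boxes I).
Proof.
move=> _ _ [B mB ->] [C mC ->]; exists (fun i => B i `&` C i).
  by move=> i; exact: measurableI.
by apply/seteqP; split => y /=; [move=> [h1 h2] i; split|move=> h; split=> i; have [] := h i].
Qed.

Lemma boxesT (I : Type) : @boxes I setT.
Proof. by exists (fun=> setT) => //; apply/seteqP; split. Qed.

Lemma measurable_coord (I : eqType) (i : I) :
  measurable_fun setT (fun y : box_space I => y i : K).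
Proof.
move=> _ B mB; rewrite setTI; apply: sub_sigma_algebra.
exists (fun j => if j == i then B else setT); first by move=> j; case: ifP.
apply/seteqP; split => y /= h; last by have := h i; rewrite eqxx.
by move=> j; case: eqP => [->|].
Qed.

Lemma measurable_to_box d (T : measurableType d) (I : Type) (X : I -> T -> K) :
  (forall i, measurable_fun setT (X i)) ->
  (forall B : I -> set K, (forall i, measurable (B i)) ->
    measurable [set w | forall i, B i (X i w)]) ->
  measurable_fun setT (fun w => (fun i => X i w) : box_space I).
Proof.
move=> mX mB; apply: (@measurability _ _ _ (box_space I) _ _ (@boxes I)) => //.
by move=> _ [_ [B hB ->] <-]; rewrite setTI; exact: mB.
Qed.

Lemma measurable_box d (T : measurableType d) (I : finType) (X : I -> T -> K)
    (B : I -> set K) :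
  (forall i, measurable_fun setT (X i)) -> (forall i, measurable (B i)) ->
  measurable [set w | forall i, B i (X i w)].
Proof.
move=> mX mB.
have -> : [set w | forall i, B i (X i w)] = \bigcap_(i in [set: I]) (X i @^-1` B i).
  by apply/seteqP; split => w /= h i; [move=> _; exact: h|exact: (h i)].
apply: fin_bigcap_measurable; first exact: finite_finset.
by move=> i _; rewrite -[_ @^-1` _]setTI; exact: mX.
Qed.

(* Boxes form a pi-system, so two families agreeing on boxes have the same joint law. *)
Lemma has_mean_joint d1 d2 (T1 : measurableType d1) (T2 : measurableType d2)
    (P1 : probability T1 K) (P2 : probability T2 K) (I : finType)
    (X : I -> T1 -> K) (Y : I -> T2 -> K) (F : box_space I -> K) (c : K) :
  (forall i, measurable_fun setT (X i)) ->
  (forall i, measurable_fun setT (Y i)) ->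
  (forall B : I -> set K, (forall i, measurable (B i)) ->
    P1 [set w | forall i, B i (X i w)] = P2 [set w | forall i, B i (Y i w)]) ->
  measurable_fun setT F ->
  has_mean P2 (fun w => F (fun i => Y i w)) c ->
  has_mean P1 (fun w => F (fun i => X i w)) c.
Proof.
move=> mX mY XY mF [iY eY].
pose phiX w : box_space I := fun i => X i w.
pose phiY w : box_space I := fun i => Y i w.
have mphiX : measurable_fun setT phiX.
  by apply: measurable_to_box => // B; exact: measurable_box.
have mphiY : measurable_fun setT phiY.
  by apply: measurable_to_box => // B; exact: measurable_box.
pose X_mixin := isMeasurableFun.Build _ _ _ _ _ mphiX.
pose X_pack : {mfun T1 >-> box_space I} := HB.pack phiX X_mixin.
pose Y_mixin := isMeasurableFun.Build _ _ _ _ _ mphiY.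
pose Y_pack : {mfun T2 >-> box_space I} := HB.pack phiY Y_mixin.
have E A : measurable A -> pushforward P1 X_pack A = pushforward P2 Y_pack A.
  move=> mA; apply: (@measure_unique _ _ (box_space I) (@boxes I) (fun=> setT)) => //.
  - exact: boxesI.
  - by move=> _; exact: boxesT.
  - by rewrite bigcup_const.
  - by move=> _ [B mB ->]; exact: XY.
  - by move=> _; rewrite /= /pushforward preimage_setT probability_setT ltry.
have iF : (pushforward P2 Y_pack).-integrable setT (EFin \o F).
  by apply: integrable_pushforward => //; exact/measurable_EFinP.
have iF1 : (pushforward P1 X_pack).-integrable setT (EFin \o F).
  move/integrableP: iF => [m1 m2]; apply/integrableP; split => //.
  by rewrite (eq_measure_integral (pushforward P2 Y_pack)) // => A mA _; exact: E.
have iX : P1.-integrable setT (EFin \o (fun w => F (fun i => X i w))).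
  move/integrableP: iF1 => [m1 m2]; apply/integrableP; split.
    by apply/measurable_EFinP; exact: (measurableT_comp mF mphiX).
  move: m2; rewrite ge0_integral_pushforward//.
  by apply: measurableT_comp => //; exact/measurable_EFinP.
split=> //; rewrite -eY.
transitivity (\int[pushforward P1 X_pack]_y (F y)%:E)%E.
  by rewrite integral_pushforward//; exact/measurable_EFinP.
rewrite (eq_measure_integral (pushforward P2 Y_pack)); last by move=> A mA _; exact: E.
by rewrite integral_pushforward//; exact/measurable_EFinP.
Qed.

(** Tonelli gives integrability, since the iterated integral of |f| |g| is finite; Fubini gives the
    value. *)
Lemma has_mean_prod d1 d2 (T1 : measurableType d1) (T2 : measurableType d2)
    (P1 : probability T1 K) (P2 : probability T2 K) (f : T1 -> K) (g : T2 -> K) a b :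
  has_mean P1 f a -> has_mean P2 g b ->
  has_mean (P1 \x P2)%E (fun z => f z.1 * g z.2) (a * b).
Proof.
move=> [i1 e1] [i2 e2].
have m1 : measurable_fun setT f by apply/measurable_EFinP; exact: measurable_int i1.
have m2 : measurable_fun setT g by apply/measurable_EFinP; exact: measurable_int i2.
have mfg : measurable_fun setT (EFin \o (fun z : T1 * T2 => f z.1 * g z.2)).
  by apply/measurable_EFinP/measurable_funM; exact: measurableT_comp.
have ifg : (P1 \x P2)%E.-integrable setT (EFin \o (fun z : T1 * T2 => f z.1 * g z.2)).
  apply/integrable12ltyP => //=.
  under eq_integral => x _.
    under eq_integral do rewrite normrM EFinM.
    rewrite ge0_integralZl//; last by apply/measurable_EFinP; exact: measurableT_comp.
    over.
  rewrite ge0_integralZr//; last 2 first.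
  - by apply/measurable_EFinP; exact: measurableT_comp.
  - exact: integral_ge0.
  by apply: lte_mul_pinfty; [exact: integral_ge0| |];
    move/integrableP: i1 i2 => [_ ?] /integrableP[_ ?] //;
    rewrite ge0_fin_numE//; exact: integral_ge0.
split=> //.
rewrite -integral12_prod_meas1//= /fubini_F.
under eq_integral => x _.
  under eq_integral do rewrite /= EFinM.
  rewrite integralZl// e2.
  over.
by rewrite integralZr//= e1.
Qed.

(** Independence says that (X, Z) on [T] has the same box probabilities as the pair read off at two
    independent points of [T]; the mean can therefore be computed under the product measure. *)
Lemma has_mean_independent d (T : measurableType d) (P : probability T K)
    (I J : finType) (X : I -> T -> K) (Z : J -> T -> K)
    (g : I -> K -> K) (h : J -> K -> K) (a b : K) :
  (forall i, measurable_fun setT (X i)) -> (forall j, measurable_fun setT (Z j)) ->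
  independent_vectors P X Z ->
  (forall i, measurable_fun setT (g i)) -> (forall j, measurable_fun setT (h j)) ->
  has_mean P (fun w => \prod_i g i (X i w)) a ->
  has_mean P (fun w => \prod_j h j (Z j w)) b ->
  has_mean P (fun w => (\prod_i g i (X i w)) * \prod_j h j (Z j w)) (a * b).
Proof.
move=> mX mZ ind mg mh Ha Hb.
pose U (s : I + J) w := match s with inl i => X i w | inr j => Z j w end.
pose V (s : I + J) (w : T * T) :=
  match s with inl i => X i w.1 | inr j => Z j w.2 end.
pose F (y : box_space (I + J)%type) :=
  (\prod_i g i (y (inl i))) * \prod_j h j (y (inr j)).
apply: (@has_mean_joint _ _ _ _ P (P \x P)%E _ U V F).
- by case.
- by case=> i; apply: measurableT_comp.
- move=> B mB.
  have -> : [set w | forall i, B i (U i w)] =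
    [set w | (forall i, B (inl i) (X i w)) /\ (forall j, B (inr j) (Z j w))].
    apply/seteqP; split => w /=.
      by move=> h0; split => i; [exact: (h0 (inl i))|exact: (h0 (inr i))].
    by move=> [h1 h2] [].
  rewrite (ind (fun i => B (inl i)) (fun j => B (inr j)))//.
  have -> : [set w | forall i, B i (V i w)] =
    [set w | forall i, B (inl i) (X i w)] `*` [set w | forall j, B (inr j) (Z j w)].
    apply/seteqP; split => -[w1 w2] /=.
      by move=> h0; split => i; [exact: (h0 (inl i))|exact: (h0 (inr i))].
    by move=> [h1 h2] [].
  have mA : measurable [set w | forall i, B (inl i) (X i w)].
    exact: (measurable_box (B := fun i => B (inl i)) mX).
  have mC : measurable [set w | forall j, B (inr j) (Z j w)].
    exact: (measurable_box (B := fun i => B (inr i)) mZ).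
  by have /= <- := @product_measure1E _ _ T T K P P _ _ mA mC.
- apply: measurable_funM; apply: measurable_prod => i _.
    by apply: measurableT_comp => //; exact: measurable_coord.
  by apply: measurableT_comp => //; exact: measurable_coord.
- exact: (has_mean_prod Ha Hb).
Qed.

Lemma mutually_independent_split d (T : measurableType d) (P : probability T K)
    (I : finType) (X : I -> T -> K) (i0 : I) (J : {set I}) :
  mutually_independent P X -> i0 \notin J ->
  independent_vectors P (fun _ : unit => X i0) (fun j : {j | j \in J} => X (val j)).
Proof.
move=> ind i0J A B mA mB.
(* One box over the whole index set; [setT] outside [i0] and [J] imposes no condition. *)
pose C i := if i == i0 then A tt else
  if insub i is Some j then B j else setT.
have mC i : measurable (C i).
  by rewrite /C; case: ifP => // _; case: insub.
have CJ (j : {j | j \in J}) : C (val j) = B j.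
  rewrite /C; case: eqP => [E|_]; last by rewrite valK.
  by have := valP j; rewrite /= E (negbTE i0J).
have C0 : C i0 = A tt by rewrite /C eqxx.
have -> : [set w | (forall i : unit, A i (X i0 w)) /\
    (forall j : {j | j \in J}, B j (X (val j) w))] =
  [set w | forall i, i \in (i0 |: J)%SET -> C i (X i w)].
  apply/seteqP; split => w /=.
    move=> [h1 h2] i; rewrite !inE => /predU1P[->|iJ]; first by rewrite C0; exact: h1.
    by have := h2 (Sub i iJ); rewrite -CJ.
  move=> h; split => [[]|j]; first by rewrite -C0; apply: h; rewrite !inE eqxx.
  by rewrite -CJ; apply: h; rewrite !inE (valP j) orbT.
rewrite ind// big_setU1//=; congr (_ * _)%E.
  by congr (P _); apply/seteqP; split => w /=; rewrite C0; [move=> h []|move/(_ tt)].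
rewrite -ind//; congr (P _); apply/seteqP; split => w /= h j.
  by rewrite -CJ; apply: h; exact: (valP j).
by move=> jJ; have := h (Sub j jJ); rewrite -CJ.
Qed.

Lemma has_mean_mutually_independent d (T : measurableType d) (P : probability T K)
    (I : finType) (X : I -> T -> K) (g : I -> K -> K) (c : I -> K) :
  (forall i, measurable_fun setT (X i)) -> mutually_independent P X ->
  (forall i, measurable_fun setT (g i)) ->
  (forall i, has_mean P (fun w => g i (X i w)) (c i)) ->
  has_mean P (fun w => \prod_i g i (X i w)) (\prod_i c i).
Proof.
move=> mX ind mg H.
suff : forall J : {set I},
  has_mean P (fun w => \prod_(i in J) g i (X i w)) (\prod_(i in J) c i).
  move/(_ [set: I]%SET); apply: has_mean_eq => [w|]; apply: eq_bigl => i; by rewrite inE.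
move=> J; have [n] := ubnP #|J|; elim: n J => // n IH J.
have [->|[i0 i0J]] := set_0Vmem J.
  by move=> _; apply: has_mean_eq (has_mean_cst P 1) => [w|]; rewrite big_set0.
rewrite (cardsD1 i0) i0J ltnS => /IH H1.
have i0D : i0 \notin (J :\ i0)%SET by rewrite !inE eqxx.
have := @has_mean_independent _ _ P _ _ _ _ (fun=> g i0)
  (fun j : {j | j \in (J :\ i0)%SET} => g (val j)) (c i0) (\prod_(i in (J :\ i0)%SET) c i)
  (fun=> mX i0) (fun j => mX (val j)) (mutually_independent_split ind i0D)
  (fun=> mg i0) (fun j => mg (val j)).
have e1 w : \prod_(i : unit) g i0 (X i0 w) = g i0 (X i0 w).
  by rewrite (big_pred1 tt)// => -[].
have e2 w : \prod_(j : {j | j \in (J :\ i0)%SET}) g (val j) (X (val j) w) =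
    \prod_(i in (J :\ i0)%SET) g i (X i w).
  by rewrite -(big_sub (mem (J :\ i0)%SET) (fun i => g i (X i w))).
have Ha : has_mean P (fun w => \prod_(i : unit) g i0 (X i0 w)) (c i0).
  by apply: has_mean_eq (H i0).
have Hb : has_mean P (fun w => \prod_(j : {j | j \in (J :\ i0)%SET}) g (val j) (X (val j) w))
  (\prod_(i in (J :\ i0)%SET) c i) by apply: has_mean_eq H1.
move=> /(_ Ha Hb); apply: has_mean_eq => [w|]; last by rewrite [RHS](big_setD1 i0).
by rewrite e1 e2 [RHS](big_setD1 i0).
Qed.

End Boxes.

(** * Moments of the spiked tensor *)

(** The product of sums is expanded over all choice functions. This serves both for the permutations
    in the symmetrised noise and for the binomial expansion around the signal. *)
Lemma has_mean_prod_sum d (T : measurableType d) (K : realType)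
    (P : {measure set T -> \bar K}) (E J : finType) (Z : T -> K) (c : K)
    (a : E -> J -> K) (F : E -> J -> T -> K) (m : E -> J -> K) :
  (forall s : {ffun E -> J},
     has_mean P (fun w => Z w * \prod_e F e (s e) w) (c * \prod_e m e (s e))) ->
  has_mean P (fun w => Z w * \prod_e \sum_j a e j * F e j w)
    (c * \prod_e \sum_j a e j * m e j).
Proof.
move=> H.
have := has_mean_sum (index_enum _) (fun (s : {ffun E -> J}) (_ : true) =>
  has_meanZ (\prod_e a e (s e)) (H s)).
apply: has_mean_eq => [w|].
  rewrite bigA_distr_bigA mulr_sumr; apply: eq_bigr => s _.
  by rewrite big_split/= mulrCA.
rewrite bigA_distr_bigA mulr_sumr; apply: eq_bigr => s _.
by rewrite big_split/= mulrCA.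
Qed.

Section Listings.
Variables (n p : nat).
Implicit Types (t : {ffun 'I_p -> 'I_n}) (e : {set 'I_n}).

Definition tsupp t : {set 'I_n} := (t @: [set: 'I_p])%SET.

(* [setT] below is the classical set, as in [tensor_at]. *)
Lemma tsuppE t : t @: setT = tsupp t.
Proof. by apply/setP => x; apply/imsetP/imsetP => -[i _ ->]; exists i; rewrite ?inE. Qed.

Lemma tensor_at_listing (K : realType) e : #|e| = p ->
  exists2 t : {ffun 'I_p -> 'I_n}, injective t /\ tsupp t = e &
    forall Y : tensor K n p, tensor_at Y e = Y t.
Proof.
move=> ep; rewrite /tensor_at; case: pickP => [t /andP[/injectiveP ti /eqP te]|H].
  by exists t; rewrite // -te tsuppE.
(* The empty set is treated apart, because enumerating [e] below requires a default element. *)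
have [n0|n0] := posnP #|e|.
  have p0 : p = 0%N by rewrite -ep.
  have : (0 < #|{ffun 'I_p -> 'I_n}|)%N by rewrite card_ffun !card_ord p0.
  move=> /card_gt0P[t _]; have := H t => /negP[]; apply/andP; split.
    by apply/injectiveP => i; have := ltn_ord i; rewrite [X in (_ < X)%N]p0.
  rewrite tsuppE eqEcard ep p0 andbT; apply/fintype.subsetP => x /imsetP[i _].
  by have := ltn_ord i; rewrite [X in (_ < X)%N]p0.
have [x0 x0e] : exists x0, x0 \in e by apply/card_gt0P.
pose t : {ffun 'I_p -> 'I_n} := [ffun k : 'I_p => nth x0 (enum e) k].
have ti : injective t.
  move=> i j; rewrite !ffunE => /eqP; rewrite nth_uniq ?enum_uniq -?cardE ?ep//.
  by move=> /eqP/val_inj.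
have := H t => /negP[]; apply/andP; split; first exact/injectiveP.
rewrite tsuppE eqEcard card_imset// cardsT card_ord ep leqnn andbT.
apply/fintype.subsetP => x /imsetP[i _ ->]; rewrite ffunE -mem_enum mem_nth//.
by rewrite -cardE ep.
Qed.

Lemma exists_listing (K : realType) : (0 < n)%N ->
  exists tau : {set 'I_n} -> {ffun 'I_p -> 'I_n}, forall e : {set 'I_n}, #|e| = p ->
    [/\ injective (tau e), tsupp (tau e) = e &
        forall Y : tensor K n p, tensor_at Y e = Y (tau e)].
Proof.
move=> n0.
have H e : exists t : {ffun 'I_p -> 'I_n}, #|e| = p ->
    [/\ injective t, tsupp t = e & forall Y : tensor K n p, tensor_at Y e = Y t].
  have [ep|] := eqVneq #|e| p; last first.
    by move=> /eqP ep; exists [ffun=> Ordinal n0].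
  by have [t [t1 t2 t3]] := tensor_at_listing K ep; exists t.
by have [tau Htau] := choice H; exists tau.
Qed.

(** The exponent on the left vanishes except at the chosen listing of each set, so a product over
    hyperedges becomes one over all index tuples, the form to which independence of the entries
    applies. *)
Lemma prod_listing (K : realType) (F : {ffun 'I_p -> 'I_n} -> K)
    (tau : {set 'I_n} -> {ffun 'I_p -> 'I_n}) (k : {set 'I_n} -> nat) :
  (forall e : {set 'I_n}, k e != 0%N -> tsupp (tau e) = e) ->
  \prod_t F t ^+ (k (tsupp t) * (t == tau (tsupp t))) = \prod_e F (tau e) ^+ k e.
Proof.
move=> H; rewrite (partition_big tsupp xpredT)//=; apply: eq_bigr => e _.
have [k0|k0] := eqVneq (k e) 0%N.
  by rewrite k0 expr0 big1// => t /eqP ->; rewrite k0 mul0n.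
rewrite (bigD1 (tau e)) ?H//= eqxx muln1 big1 ?mulr1//.
by move=> t /andP[/eqP -> /negbTE ->]; rewrite muln0.
Qed.

Definition perm_listing t (s : 'S_p) : {ffun 'I_p -> 'I_n} := [ffun k => t (s k)].

Lemma tsupp_perm t s : tsupp (perm_listing t s) = tsupp t.
Proof.
apply/setP => x; apply/imsetP/imsetP => -[i _ ->].
  by exists (s i); rewrite ?inE// ffunE.
by exists (s^-1%g i); rewrite ?inE// ffunE permKV.
Qed.

Lemma perm_listing_inj t : injective t -> injective (perm_listing t).
Proof.
move=> ti s s' /ffunP H; apply/permP => k; apply: ti.
by have := H k; rewrite !ffunE.
Qed.

End Listings.

(** * Mixed moments of the noise at hyperedges *)

Section NoiseMoments.
Context d (T : measurableType d) (K : realType) (P : probability T K) (n p : nat).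
Variables (W : {ffun 'I_p -> 'I_n} -> {RV P >-> K}) (x : 'I_n -> {RV P >-> K}).
Hypothesis model : tensor_pca_model W x.
Hypothesis n_gt0 : (0 < n)%N.

(* For k <= 2, z^k = z^(k1 k) * z^(k2 k) with exponents at most 1. *)
Let k1 (k : nat) : nat := (0 < k)%N.
Let k2 (k : nat) : nat := (1 < k)%N.

(** Entries chosen for distinct hyperedges are distinct, as their supports differ. The mean vanishes
    when some entry has exponent one: a hyperedge used once, or used twice with two different
    permutations. *)
Lemma has_mean_listing_prod (tau : {set 'I_n} -> {ffun 'I_p -> 'I_n})
    (k : {set 'I_n} -> nat) (s : {set 'I_n} -> 'S_p * 'S_p) :
  (forall e : {set 'I_n}, (k e <= 2)%N) -> (forall e : {set 'I_n}, k e != 0%N -> #|e| = p) ->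
  (forall e : {set 'I_n}, #|e| = p -> injective (tau e) /\ tsupp (tau e) = e) ->
  has_mean P (fun w => \prod_e (W (perm_listing (tau e) (s e).1) w ^+ k1 (k e) *
                                W (perm_listing (tau e) (s e).2) w ^+ k2 (k e)))
    (\prod_e ((k e != 1%N) && ((k e == 2%N) ==> ((s e).1 == (s e).2)))%:R).
Proof.
move=> kle kp Htau; case: model => Wn Wi _ _.
pose t1 (e : {set 'I_n}) := perm_listing (tau e) (s e).1.
pose t2 (e : {set 'I_n}) := perm_listing (tau e) (s e).2.
pose r t := (k1 (k (tsupp t)) * (t == t1 (tsupp t)) +
             k2 (k (tsupp t)) * (t == t2 (tsupp t)))%N.
have mW t : measurable_fun setT (W t) by [].
have rle t : (r t <= 2)%N by rewrite /r /k1 /k2; do 2 case: (_ < _)%N; do 2 case: eqP.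
have := has_mean_mutually_independent mW Wi
  (fun t => exprn_measurable (r t)) (fun t => has_mean_standard_normal (Wn t) (rle t)).
have H1 (e : {set 'I_n}) : k1 (k e) != 0%N -> tsupp (t1 e) = e.
  rewrite /k1; case: posnP => // k0 _.
  by rewrite tsupp_perm; apply: (Htau e _).2; apply: kp; rewrite -lt0n.
have H2 (e : {set 'I_n}) : k2 (k e) != 0%N -> tsupp (t2 e) = e.
  rewrite /k2; case: ltnP => // k0 _.
  by rewrite tsupp_perm; apply: (Htau e _).2; apply: kp; rewrite -lt0n; exact: ltnW.
apply: has_mean_eq => [w|].
  under eq_bigr do rewrite exprD.
  rewrite !big_split/= (prod_listing (fun t => W t w) H1).
  by rewrite (prod_listing (fun t => W t w) H2).
rewrite (partition_big (@tsupp n p) xpredT)//=; apply: eq_bigr => e _.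
have [k0|k0] := eqVneq (k e) 0%N.
  by rewrite k0/= big1// => t /eqP te; rewrite /r te k0.
have [ti te] := Htau e (kp e k0).
have [k1'|k1'] := eqVneq (k e) 1%N.
  have h1 : tsupp (t1 e) = e by apply: H1; rewrite /k1 k1'.
  by rewrite (bigD1 (t1 e)) ?h1//= /r h1 /k1 /k2 k1' eqxx/= mul0r.
have k2' : k e = 2%N by apply/eqP; rewrite eqn_leq kle ltn_neqAle eq_sym k1' lt0n.
rewrite k2' /=; have [ss|ss] := eqVneq (s e).1 (s e).2.
  rewrite big1// => t /eqP tt; rewrite /r tt /k1 /k2 k2' /t1 /t2 ss.
  by case: (t == _).
have h1 : tsupp (t1 e) = e by apply: H1; rewrite /k1 k2'.
rewrite (bigD1 (t1 e)) ?h1//= /r h1 /k1 /k2 k2' eqxx/=.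
have -> : (t1 e == t2 e) = false.
  by apply/negbTE; apply: contra ss => /eqP /(perm_listing_inj ti) ->.
by rewrite mul0r.
Qed.

(** Of the (p!)^2 pairs of permutations only the p! equal ones contribute to a square, and the
    normalisation in [symmetrize] turns this into variance 1. *)
Lemma has_mean_noise (k : {set 'I_n} -> nat) :
  (forall e : {set 'I_n}, (k e <= 2)%N) -> (forall e : {set 'I_n}, k e != 0%N -> #|e| = p) ->
  has_mean P (fun w => \prod_e tensor_at (noise W w) e ^+ k e)
    (\prod_e (k e != 1%N)%:R).
Proof.
move=> kle kp.
have [tau Htau] := exists_listing p K n_gt0.
have Htau' (e : {set 'I_n}) : #|e| = p -> injective (tau e) /\ tsupp (tau e) = e.
  by move=> /Htau[].
pose f : K := p`!%:R.
have f0 : f != 0 by rewrite pnatr_eq0 -lt0n fact_gt0.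
have sf : Num.sqrt f ^+ 2 = f by rewrite sqr_sqrtr// ler0n.
have sf0 : Num.sqrt f != 0 by apply: contra f0 => /eqP h; rewrite -sf h expr0n.
pose b (k : nat) : K := (Num.sqrt f)^-1 ^+ k * f^-1 ^+ (2 - k).
have := @has_mean_prod_sum _ _ _ P {set 'I_n} ('S_p * 'S_p)%type (fun=> 1) 1
  (fun e _ => b (k e))
  (fun e s w => W (perm_listing (tau e) s.1) w ^+ k1 (k e) *
                W (perm_listing (tau e) s.2) w ^+ k2 (k e))
  (fun e s => ((k e != 1%N) && ((k e == 2%N) ==> (s.1 == s.2)))%:R).
have H0 (s : {ffun {set 'I_n} -> 'S_p * 'S_p}) := has_mean_listing_prod s kle kp Htau'.
have H1 (s : {ffun {set 'I_n} -> 'S_p * 'S_p}) :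
  has_mean P (fun w => 1 * \prod_e (W (perm_listing (tau e) (s e).1) w ^+ k1 (k e) *
                W (perm_listing (tau e) (s e).2) w ^+ k2 (k e)))
    (1 * \prod_e ((k e != 1%N) && ((k e == 2%N) ==> ((s e).1 == (s e).2)))%:R).
  by apply: has_mean_eq (H0 s) => [w|]; rewrite mul1r.
move=> /(_ H1); apply: has_mean_eq => [w|]; rewrite mul1r; apply: eq_bigr => e _.
- rewrite -mulr_sumr -(pair_big xpredT xpredT (fun s1 s2 =>
    W (perm_listing (tau e) s1) w ^+ k1 (k e) * W (perm_listing (tau e) s2) w ^+ k2 (k e)))/=.
  rewrite -big_distrlr/=.
  have C : \sum_(s : 'S_p) (1 : K) = f by rewrite sumr_const card_Sn.
  have := kle e; case E : (k e) => [|[|[|//]]] _; rewrite /k1 /k2 /b /= ?expr0 ?expr1 ?C.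
  + by rewrite subn0 mul1r expr2; field.
  + have ep : #|e| = p by apply: kp; rewrite E.
    have [_ _ ->] := Htau e ep.
    rewrite /noise /symmetrize -/f.
    under eq_bigr do rewrite expr1.
    rewrite -[X in _ = _ * X]/(\sum_s W (perm_listing (tau e) s) w).
    by field; rewrite sf0 -/f f0.
  + have ep : #|e| = p by apply: kp; rewrite E.
    have [_ _ ->] := Htau e ep.
    rewrite /noise /symmetrize -/f mulr1 exprMn -expr2.
    by under eq_bigr do rewrite expr1.
- rewrite -mulr_sumr; have := kle e; case E : (k e) => [|[|[|//]]] _; rewrite /b /=.
  + rewrite expr0 mul1r sumr_const card_prod !card_Sn subn0.
    by rewrite natrM -/f expr2; field.
  + by rewrite big1// mulr0.
  + rewrite -(pair_big xpredT xpredT (fun s1 s2 : 'S_p => (s1 == s2)%:R))/=.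
    rewrite subnn expr0 mulr1.
    have -> : \sum_(i : 'S_p) \sum_(j : 'S_p) ((i == j)%:R : K) = f.
      rewrite -[RHS](_ : \sum_(s : 'S_p) (1 : K) = f); last by rewrite sumr_const card_Sn.
      apply: eq_bigr => s _; rewrite (bigD1 s)//= eqxx big1 ?addr0//.
      by move=> s' /negbTE; rewrite eq_sym => ->.
    by rewrite exprVn sf mulVf.
Qed.

End NoiseMoments.

(** * Moments under the planted law, one sign vector at a time *)

Section SpikedMoments.
Context d (T : measurableType d) (K : realType) (P : probability T K) (n p : nat).
Variables (W : {ffun 'I_p -> 'I_n} -> {RV P >-> K}) (x : 'I_n -> {RV P >-> K}).
Hypothesis model : tensor_pca_model W x.
Hypothesis n_gt0 : (0 < n)%N.

Definition sign_vector (s : {ffun 'I_n -> bool}) (j : 'I_n) : K := (-1) ^+ s j.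

Definition signal_event (s : {ffun 'I_n -> bool}) : set T :=
  [set w | forall j, x j w = sign_vector s j].

Lemma measurable_signal_event s : measurable (signal_event s).
Proof.
apply: (@measurable_box K _ T _ (fun j w => x j w) (fun j => [set sign_vector s j])) => //.
Qed.

Lemma probability_signal_event s : P (signal_event s) = ((2 ^+ n)^-1)%:E.
Proof. by case: model => _ _ U _; exact: U. Qed.

Lemma signal_event_disj s s' w : signal_event s w -> signal_event s' w -> s = s'.
Proof.
move=> h h'; apply/ffunP => j; have := h j; rewrite h' /sign_vector.
by case: (s j); case: (s' j) => // /eqP; rewrite ?expr0 ?expr1 -subr_eq0 => /eqP; lra.
Qed.

Lemma has_mean_signal_event s : has_mean P \1_(signal_event s) (2 ^+ n)^-1.
Proof.
split; first by apply: integrable_indic => //; exact: measurable_signal_event.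
rewrite integral_indic//; last exact: measurable_signal_event.
by rewrite setIT; exact: probability_signal_event.
Qed.

(** The 2^n events are disjoint and have mass 2^(-n) each, so they exhaust the space up to a null
    set. *)
Lemma ae_signal_event : {ae P, forall w, \sum_s \1_(signal_event s) w = 1 :> K}.
Proof.
pose A := [set w | exists s, signal_event s w].
have sumE w : \sum_s \1_(signal_event s) w = \1_A w :> K.
  rewrite [in RHS]indicE; case: (boolP (w \in A)) => [/set_mem[s hs]|/negP nA].
    rewrite (bigD1 s)//= indicE mem_set// big1 ?addr0// => s' s's.
    rewrite indicE memNset// => h; move: s's; rewrite (signal_event_disj h hs).
    by rewrite eqxx.
  rewrite big1// => s _; rewrite indicE memNset// => hs; apply: nA.
  by apply/mem_set; exists s.
have mA : measurable A.
  have -> : A = \bigcup_(s in [set: {ffun 'I_n -> bool}]) signal_event s.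
    by apply/seteqP; split => w /= [s]; [move=> h; exists s|move=> _ h; exists s].
  apply: fin_bigcup_measurable; first exact: finite_finset.
  by move=> s _; exact: measurable_signal_event.
have H := has_mean_sum (index_enum _) (fun s (_ : true) => has_mean_signal_event s).
have PA : P A = 1%E.
  case: H => _; under eq_integral do rewrite sumE.
  rewrite integral_indic// setIT => ->.
  rewrite sumr_const card_ffun card_bool card_ord -[_ *+ (2 ^ n)]mulr_natl natrX mulfV//.
exists (~` A); split => /=; first exact: measurableC.
  by rewrite probability_setC// PA subee.
by move=> w /= H' Aw; apply: H'; rewrite sumE indicE mem_set.
Qed.

(** The indicator of a sign vector is a product of indicators of single coordinates, which is the
    form required by [has_mean_independent]. *)
Lemma has_mean_signal_noise s (k : {set 'I_n} -> nat) :
  (forall e : {set 'I_n}, (k e <= 2)%N) -> (forall e : {set 'I_n}, k e != 0%N -> #|e| = p) ->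
  has_mean P (fun w => \1_(signal_event s) w * \prod_e tensor_at (noise W w) e ^+ k e)
    ((2 ^+ n)^-1 * \prod_e (k e != 1%N)%:R).
Proof.
move=> kle kp; have [_ _ _ ind] := model.
have [tau Htau] := exists_listing p K n_gt0.
have tauE (e : {set 'I_n}) : k e != 0%N -> tsupp (tau e) = e.
  by move=> /kp /Htau[].
pose g (j : 'I_n) : K -> K := \1_[set sign_vector s j].
pose h (t : {ffun 'I_p -> 'I_n}) (y : K) := y ^+ (k (tsupp t) * (t == tau (tsupp t))).
have mZ t : measurable_fun setT (fun w => noise W w t).
  by apply: measurable_funM => //; apply: measurable_sum.
have eg w : \prod_j g j (x j w) = \1_(signal_event s) w.
  rewrite indicE; case: (boolP (w \in signal_event s)).
    move=> /set_mem H; rewrite big1// => j _.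
    by rewrite /g indicE mem_set//=; exact: H.
  move=> /negP H; apply/eqP/prodf_eq0 => /=.
  have [j Hj] : exists j, x j w != sign_vector s j.
    apply: contrapT => /forallNP H'; apply: H; apply/mem_set => j.
    by apply/eqP; have := H' j => /negP; rewrite negbK.
  by exists j => //; rewrite /g indicE memNset// => /eqP; exact/negP.
have eh w : \prod_t h t (noise W w t) = \prod_e tensor_at (noise W w) e ^+ k e.
  rewrite (prod_listing (noise W w) tauE); apply: eq_bigr => e _.
  have [->|k0] := eqVneq (k e) 0%N; first by rewrite !expr0.
  by have [_ _ ->] := Htau e (kp e k0).
have Ha : has_mean P (fun w => \prod_j g j (x j w)) (2 ^+ n)^-1.
  by apply: has_mean_eq (has_mean_signal_event s) => // w; rewrite eg.
have Hb : has_mean P (fun w => \prod_t h t (noise W w t)) (\prod_e (k e != 1%N)%:R).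
  by apply: has_mean_eq (has_mean_noise model n_gt0 kle kp) => // w; rewrite eh.
have mg j : measurable_fun setT (g j).
  by apply: measurable_indic; exact: measurable_set1.
have mx j : measurable_fun setT (x j) by [].
have := has_mean_independent mx mZ ind mg (fun t => exprn_measurable _) Ha Hb.
by apply: has_mean_eq => // w; rewrite eg eh.
Qed.

Variable lambda : K.
Definition spike_strength : K := lambda * n%:R `^ (- (p%:R / 4)).
Local Notation a := spike_strength.

Lemma tensor_at_spiked (w : T) (e : {set 'I_n}) : #|e| = p ->
  tensor_at (Y_P lambda W x w) e = a * (\prod_(v in e) x v w) + tensor_at (noise W w) e.
Proof.
move=> ep; have [t [ti te] H] := tensor_at_listing K ep.
rewrite !H /Y_P /spiked -/a; congr (_ * _ + _).
rewrite -te big_imset/=; last by move=> ? ? _ _; exact: ti.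
by apply: eq_bigl => i; rewrite inE.
Qed.

(* The k-th moment of b + Z for Z standard normal, only for k <= 2. *)
Definition shifted_moment (k : nat) (b : K) : K :=
  match k with 0 => 1 | 1 => b | _ => b ^+ 2 + 1 end.

Lemma has_mean_spiked_event s (k : {set 'I_n} -> nat) :
  (forall e : {set 'I_n}, (k e <= 2)%N) -> (forall e : {set 'I_n}, k e != 0%N -> #|e| = p) ->
  has_mean P (fun w => \1_(signal_event s) w *
                       \prod_e tensor_at (Y_P lambda W x w) e ^+ k e)
    ((2 ^+ n)^-1 *
     \prod_e shifted_moment (k e) (a * \prod_(v in e) sign_vector s v)).
Proof.
move=> kle kp.
pose b (e : {set 'I_n}) : K := a * \prod_(v in e) sign_vector s v.
(* On the event the spike is the constant [b e], and powers are expanded binomially in the noise.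
   The index j runs over 0, 1, 2 for all sets; when it exceeds [k e] the binomial coefficient is 0
   and [minn] merely keeps the exponent admissible. *)
have := @has_mean_prod_sum _ _ _ P {set 'I_n} 'I_3 (\1_(signal_event s)) (2 ^+ n)^-1
  (fun e j => 'C(k e, j)%:R * b e ^+ (k e - j))
  (fun e j w => tensor_at (noise W w) e ^+ minn j (k e))
  (fun e j => (minn j (k e) != 1%N)%:R).
have H (f : {ffun {set 'I_n} -> 'I_3}) := @has_mean_signal_noise s (fun e => minn (f e) (k e)).
have H1 (f : {ffun {set 'I_n} -> 'I_3}) :
  has_mean P
         (fun w => \1_(signal_event s) w *
          \prod_e tensor_at (noise W w) e ^+ minn (f e) (k e))
         ((2 ^+ n)^-1 * \prod_e (minn (f e) (k e) != 1%N)%:R).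
  apply: H => e; first by rewrite geq_min kle orbT.
  by move=> h; apply: kp; apply: contra h => /eqP ->; rewrite minn0.
move=> /(_ H1); apply: has_mean_eq => [w|].
- rewrite indicE; case: (boolP (w \in signal_event s)) => [/set_mem ws|_]; last by rewrite !mul0r.
  rewrite !mul1r; apply: eq_bigr => e _.
  have xs : \prod_(v in e) x v w = \prod_(v in e) sign_vector s v.
    by apply: eq_bigr => v _; exact: ws.
  have := kle e; have := kp e; case: (k e) => [|[|[|//]]] kpe _.
  + by rewrite !big_ord_recl big_ord0 /= !bin0n /=; ring.
  + rewrite tensor_at_spiked ?kpe// xs.
    by rewrite !big_ord_recl big_ord0 /= /bump /b /= ; rewrite /binomial/=; ring.
  + rewrite tensor_at_spiked ?kpe// xs.
    by rewrite !big_ord_recl big_ord0 /= /bump /b /= ; rewrite /binomial/=; ring.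
- congr (_ * _); apply: eq_bigr => e _; rewrite -/(b e).
  have := kle e; case: (k e) => [|[|[|//]]] _;
  by rewrite !big_ord_recl big_ord0 /= /bump /= /binomial /=; ring.
Qed.

Lemma has_mean_spiked (k : {set 'I_n} -> nat) :
  (forall e : {set 'I_n}, (k e <= 2)%N) -> (forall e : {set 'I_n}, k e != 0%N -> #|e| = p) ->
  has_mean P (fun w => \prod_e tensor_at (Y_P lambda W x w) e ^+ k e)
    ((2 ^+ n)^-1 * \sum_s \prod_e shifted_moment (k e) (a * \prod_(v in e) sign_vector s v)).
Proof.
move=> kle kp.
have := has_mean_sum (index_enum _) (fun s (_ : true) => has_mean_spiked_event s kle kp).
rewrite -mulr_sumr; apply: has_mean_ae; last first.
  apply: filterS ae_signal_event => w /= E.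
  by rewrite -mulr_suml E mul1r.
apply: measurable_prod => e _.
have [->|k0] := eqVneq (k e) 0%N; first exact: measurable_cst.
apply: measurable_funX.
under eq_fun do rewrite tensor_at_spiked ?kp//.
apply: measurable_funD.
  apply: measurable_funM => //; under eq_fun do rewrite -big_enum.
  by apply: measurable_prod => i _.
have [tau Htau] := exists_listing p K n_gt0.
have [_ _ Ht] := Htau e (kp e k0).
under eq_fun do rewrite Ht.
by apply: measurable_funM => //; apply: measurable_sum.
Qed.

Definition even_edges (A : {set {set 'I_n}}) : Prop :=
  (forall e : {set 'I_n}, e \in A -> #|e| = p) /\
  (forall v, ~~ odd #|[set e in A | v \in e]%SET|).

Lemma prod_sign_even (A : {set {set 'I_n}}) s : even_edges A ->
  \prod_(e in A) \prod_(v in e) sign_vector s v = 1.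
Proof.
move=> [_ H].
under eq_bigr => e _ do rewrite big_mkcond.
rewrite exchange_big/= big1// => v _.
rewrite -big_mkcondr/=.
rewrite (eq_bigl (mem [set e in A | v \in e]%SET)); last by move=> e; rewrite !inE.
by rewrite prodr_const /sign_vector -exprM mulnC exprM -signr_odd (negbTE (H v)) expr0 expr1n.
Qed.

Lemma sqr_prod_sign (e : {set 'I_n}) s : (\prod_(v in e) sign_vector s v) ^+ 2 = 1.
Proof.
by rewrite -prodrXl big1// => v _; rewrite /sign_vector -exprM mulnC exprM sqrrN expr1n expr1n.
Qed.

Lemma has_mean_spiked_pair (A B : {set {set 'I_n}}) : even_edges A -> even_edges B ->
  has_mean P (fun w => (\prod_(e in A) tensor_at (Y_P lambda W x w) e) *
                       (\prod_(e in B) tensor_at (Y_P lambda W x w) e))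
    ((1 + a ^+ 2) ^+ #|A :&: B| * a ^+ (#|A| + #|B| - 2 * #|A :&: B|)).
Proof.
move=> eA eB.
pose k (e : {set 'I_n}) := ((e \in A) + (e \in B))%N.
have kle (e : {set 'I_n}) : (k e <= 2)%N by rewrite /k; do 2 case: (_ \in _).
have kp (e : {set 'I_n}) : k e != 0%N -> #|e| = p.
  rewrite /k; case: (boolP (e \in A)) => [/eA.1//|_].
  by case: (boolP (e \in B)) => [/eB.1//|_].
apply: has_mean_eq (has_mean_spiked kle kp) => [w|].
  under eq_bigr do rewrite exprD.
  rewrite big_split/=; congr (_ * _); rewrite [RHS]big_mkcond; apply: eq_bigr => e _;
  by case: ifP.
transitivity ((2 ^+ n)^-1 * \sum_(s : {ffun 'I_n -> bool})
  ((1 + a ^+ 2) ^+ #|A :&: B| * a ^+ (#|A| + #|B| - 2 * #|A :&: B|))); last first.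
  set X := _ * a ^+ _; rewrite sumr_const card_ffun card_bool card_ord.
  by rewrite -[_ *+ (2 ^ n)]mulr_natl natrX mulKf.
congr (_ * _); apply: eq_bigr => s _.
pose sg (e : {set 'I_n}) : K := \prod_(v in e) sign_vector s v.
(* The signs of [A] and of [B] are kept as separate products: on [A :&: B] they cancel in pairs, and
   each product is 1 by evenness of the degrees. *)
have E1 : \prod_e shifted_moment (k e) (a * sg e) =
  \prod_e ((if e \in A :&: B then 1 + a ^+ 2 else 1) *
           ((if e \in (A :\: B) :|: (B :\: A) then a else 1) *
            ((if e \in A then sg e else 1) * (if e \in B then sg e else 1)))).
  apply: eq_bigr => e _; rewrite /k !inE.
  have sg2 : sg e * sg e = 1 by rewrite -expr2 sqr_prod_sign.
  case: (e \in A); case: (e \in B) => /=; rewrite ?mul1r ?mulr1//.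
  by rewrite exprMn sqr_prod_sign sg2 !mulr1 addrC.
rewrite E1 !big_split/= -!big_mkcond/= !(prod_sign_even _) // !mulr1 !prodr_const.
congr (_ * a ^+ _).
rewrite cardsU (_ : (_ :\: _) :&: _ = finset.set0); last first.
  by apply/setP => e; rewrite !inE; case: (e \in A); case: (e \in B).
rewrite cards0 subn0 !cardsD (finset.setIC B A).
have h1 : (#|A :&: B| <= #|A|)%N by apply: subset_leq_card; exact: finset.subsetIl.
have h2 : (#|A :&: B| <= #|B|)%N by apply: subset_leq_card; exact: finset.subsetIr.
by move: #|A :&: B| #|A| #|B| h1 h2; clear=> *; lia.
Qed.

Lemma has_mean_noise_pair (A B : {set {set 'I_n}}) :
  (forall e : {set 'I_n}, e \in A -> #|e| = p) ->
  (forall e : {set 'I_n}, e \in B -> #|e| = p) ->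
  has_mean P (fun w => (\prod_(e in A) tensor_at (Y_Q W w) e) *
                       (\prod_(e in B) tensor_at (Y_Q W w) e)) (A == B)%:R.
Proof.
move=> eA eB.
pose k (e : {set 'I_n}) := ((e \in A) + (e \in B))%N.
have kle (e : {set 'I_n}) : (k e <= 2)%N by rewrite /k; do 2 case: (_ \in _).
have kp (e : {set 'I_n}) : k e != 0%N -> #|e| = p.
  rewrite /k; case: (boolP (e \in A)) => [/eA//|_].
  by case: (boolP (e \in B)) => [/eB//|_].
apply: has_mean_eq (has_mean_noise model n_gt0 kle kp) => [w|].
  under eq_bigr do rewrite exprD.
  rewrite big_split/=; congr (_ * _); rewrite [RHS]big_mkcond; apply: eq_bigr => e _;
  by case: ifP.
have [AB|AB] := eqVneq A B.
  by rewrite big1// => e _; rewrite /k AB; case: (_ \in _).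
have [e He] : exists e, (e \in A) != (e \in B).
  apply: contrapT => /forallNP H; move/eqP: AB; apply; apply/setP => e.
  by apply/eqP; have := H e => /negP; rewrite negbK.
by rewrite (bigD1 e)//= /k; move: He; case: (e \in A); case: (e \in B) => //=; rewrite mul0r.
Qed.

End SpikedMoments.

(** * Growth of the parameters *)

Section Growth.
Variable K : realType.

(** With L = ln n and LL = ln L, the growth condition gives x = D ell <= L / (2 LL). Then ln x <=
    LL, so that x ln x <= L / 2, which is the logarithm of sqrt n. *)
Lemma self_power_le_sqrt (ell : nat -> nat) (D : nat) :
  (fun n => (ell n)%:R : K) =o_\oo (fun n => ln n%:R / ln (ln n%:R) : K) ->
  \forall n \near \oo, ((D * ell n) ^ (D * ell n))%:R <= Num.sqrt n%:R :> K.
Proof.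
move=> /eqoP H.
(* [D.+1] avoids a division by zero; the factor 2 yields the square root. *)
have e0 : 0 < (2 * D.+1%:R)^-1 :> K by rewrite invr_gt0 mulr_gt0.
have := H _ e0; apply: filter_app.
(* This lower bound on n ensures ln (ln n) >= 1. *)
have := nbhs_infty_ger (expR (expR 1) : K); apply: filterS => n nbig.
have n0 : (0 : K) < n%:R by apply: lt_le_trans nbig; exact: expR_gt0.
set L := ln n%:R; set LL := ln L => Hl.
have L1 : expR 1 <= L by rewrite -[expR 1]expRK ler_ln ?posrE ?expR_gt0.
have L0 : 0 < L by apply: lt_le_trans L1; exact: expR_gt0.
have LL1 : 1 <= LL by rewrite -[1]expRK ler_ln ?posrE ?expR_gt0.
have sqrtE : Num.sqrt n%:R = expR (L / 2).
  rewrite -[n%:R]lnK ?posrE// -/L.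
  have -> : expR L = expR (L / 2) ^+ 2 by rewrite -expRM_natr; congr expR; field.
  by rewrite sqrtr_sqr ger0_norm ?expR_ge0.
rewrite sqrtE; set x := (D * ell n)%N.
have [->|x0] := posnP x.
  by rewrite -[X in X <= _]expR0 ler_expR divr_ge0// ltW.
have x1 : (1 : K) <= x%:R by rewrite ler1n.
have xL : x%:R <= L / LL / 2.
  move: Hl; rewrite !ger0_norm; last 2 first.
  - by rewrite divr_ge0// ltW// (lt_le_trans _ LL1).
  - by rewrite ler0n.
  move=> Hl; have D0 : 0 < D.+1%:R :> K by [].
  apply: (@le_trans _ _ (D.+1%:R * (ell n)%:R)).
    by rewrite -natrM ler_nat leq_mul2r leqnSn orbT.
  rewrite -ler_pdivlMl//; apply: le_trans Hl _.
  by rewrite le_eqVlt; apply/orP; left; apply/eqP; field; rewrite !gt_eqF// (lt_le_trans _ LL1).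
have LL0 : 0 < LL by apply: lt_le_trans LL1.
have lnx : ln x%:R <= LL.
  rewrite ler_ln ?posrE ?ltr0n//; apply: le_trans xL _.
  rewrite -mulrA -invfM ler_pdivrMr; last by lra.
  by rewrite ler_peMr ?ltW//; lra.
have lnx0 : 0 <= ln x%:R :> K by rewrite ln_ge0.
rewrite natrX -[x%:R in X in X <= _]lnK ?posrE ?ltr0n// -expRM_natr ler_expR.
apply: (@le_trans _ _ (LL * (L / LL / 2))).
  by apply: ler_pM.
by rewrite le_eqVlt; apply/orP; left; apply/eqP; field; rewrite gt_eqF.
Qed.

Lemma sqr_le_exp2 l : (l ^ 2 <= 2 * 2 ^ l)%N.
Proof.
case: l => [|[|[|l]]] //; elim: l => // l IH.
by have := expnS 2 l.+3; move: IH; rewrite -!mulnn; nia.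
Qed.

(** The conclusion is the gain per block: lambda^(4m) times the number of permutations of the free
    slots outweighs the orderings of the 2m hyperedges by a factor 2. The base 5 in the proof arises
    as 10 * 2 / 4. *)
Lemma threshold_condition (m p : nat) (lambda : K) :
  (3 <= m)%N -> (3 <= p)%N -> 0 < lambda ->
  10 ^+ (p * m) <
    lambda ^+ (4 * m) * ((2 * p * m)`!)%:R /
    (2 ^+ (p * m) * (p`!)%:R ^+ (2 * m) * ((m * p)`!)%:R * ((2 * m)`!)%:R) ->
  2 * (p`!)%:R ^+ (2 * m) <= lambda ^+ (4 * m) * (((m * (p - 2)).-1)`!)%:R.
Proof.
move=> m3 p3 lambda0; set F := (_.-1`!)%:R.
have f0 k : (0 : K) < k`!%:R by rewrite ltr0n fact_gt0.
rewrite ltr_pdivlMr; last by rewrite !mulr_gt0 ?exprn_gt0.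
set q := (m * p)%N; rewrite [(p * m)%N]mulnC -/q => H.
have lam0 : 0 < lambda ^+ (4 * m) by rewrite exprn_gt0.
have H1 : ((2 * p * m)`!)%:R <= 4 ^+ q * q`!%:R ^+ 2 :> K.
  have -> : (2 * p * m = q.*2)%N by rewrite /q -mul2n; lia.
  by rewrite -!natrX -natrM ler_nat fact_double_le.
have H2 : 2 * q`!%:R <= 5 ^+ q * (2 * m)`!%:R * F.
  by rewrite -!natrX -!natrM ler_nat fact_ratio_le.
set P := (p`!)%:R ^+ (2 * m) in H *; have P0 : 0 < P by rewrite exprn_gt0.
have H3 : 5 ^+ q * P * (2 * m)`!%:R <= lambda ^+ (4 * m) * q`!%:R.
  have c0 : 0 < 4 ^+ q * q`!%:R :> K by rewrite mulr_gt0 ?exprn_gt0.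
  rewrite -(ler_pM2r c0).
  have -> : 5 ^+ q * P * (2 * m)`!%:R * (4 ^+ q * q`!%:R) =
    10 ^+ q * (2 ^+ q * P * q`!%:R * (2 * m)`!%:R).
    have -> : 10 = 5 * 2 :> K by rewrite -natrM.
    have -> : 4 = 2 * 2 :> K by rewrite -natrM.
    by rewrite !exprMn; ring.
  apply/ltW/(lt_le_trans H).
  have -> : lambda ^+ (4 * m) * q`!%:R * (4 ^+ q * q`!%:R) =
    lambda ^+ (4 * m) * (4 ^+ q * q`!%:R ^+ 2) by ring.
  by rewrite ler_pM2l.
have c0 : 0 < 5 ^+ q * (2 * m)`!%:R :> K by rewrite mulr_gt0 ?exprn_gt0.
rewrite -(ler_pM2r c0).
apply: (@le_trans _ _ (2 * (lambda ^+ (4 * m) * q`!%:R))).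
  rewrite -mulrA ler_pM2l//; apply: le_trans H3.
  by rewrite le_eqVlt; apply/orP; left; apply/eqP; ring.
rewrite -[leRHS]mulrA mulrCA ler_pM2l//; apply: le_trans H2 _.
by rewrite le_eqVlt; apply/orP; left; apply/eqP; ring.
Qed.

End Growth.

(** * Bounds on the two second-moment ratios *)

Section Ratios.
Variables (K : realType) (n m p l : nat) (lambda : K).
Hypotheses (m3 : (3 <= m)%N) (p3 : (3 <= p)%N) (l4 : (4 <= l)%N) (lambda0 : 0 < lambda).
Local Notation N := (m * p * l)%N.
Local Notation E := (2 * m * l)%N.
Local Notation C := (copies n m p l).
Local Notation M := (#|C|%:R : K).
Local Notation y := (Num.sqrt n%:R : K).
Local Notation F := (((m * (p - 2)).-1)`!%:R : K).

(* [null_ratio] is E_Q f^2 / (E_P f)^2 and [planted_ratio] is Var_P f / (E_P f)^2. *)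
Definition null_ratio : K := n%:R ^+ N / (lambda ^+ (4 * m * l) * M).

Definition planted_ratio : K :=
  \sum_(S in C) \sum_(S' in C)
    (1 + lambda ^- 2 * y ^+ p) ^+ #|edges S :&: edges S'| / M ^+ 2 - 1.

Hypothesis nN : (2 * N ^ 2 <= n)%N.
Hypothesis theta : 2 * (p`!)%:R ^+ (2 * m) <= lambda ^+ (4 * m) * F.

Let N0 : (0 < N)%N. Proof. by clear - m3 p3 l4; rewrite !muln_gt0; lia. Qed.
Let Nn : (N <= n)%N.
Proof. by apply: leq_trans nN; clear - N0; nia. Qed.
Let n0 : (0 < n)%N. Proof. exact: leq_trans Nn. Qed.

(** Bernoulli's inequality gives (1 - N/n)^N >= 1 - N^2/n, which is at least 1/2 by [nN]. *)
Lemma exp_le_ffact : n%:R ^+ N <= 2 * (n ^_ N)%:R :> K.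
Proof.
have nK : (0 : K) < n%:R by rewrite ltr0n.
have H : ((n - N) ^ N <= n ^_ N)%N.
  have : forall j, (j <= N)%N -> ((n - N) ^ j <= n ^_ j)%N.
    elim=> [|j IH jN]; first by rewrite expn0 ffactn0.
    by rewrite expnSr ffactnSr leq_mul ?IH//; lia.
  by apply.
have B : forall j, 1 - j%:R * (N%:R / n%:R) <= (1 - N%:R / n%:R) ^+ j :> K.
  have t0 : 0 <= N%:R / n%:R :> K by rewrite divr_ge0.
  have t1 : N%:R / n%:R <= 1 :> K by rewrite ler_pdivrMr// mul1r ler_nat.
  elim=> [|j IH]; first by rewrite expr0 mul0r subr0.
  rewrite exprS; apply: le_trans (_ : (1 - N%:R / n%:R) * (1 - j%:R * (N%:R / n%:R)) <= _); last first.
    by apply: ler_wpM2l => //; rewrite subr_ge0.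
  rewrite -natr1; have : 0 <= j%:R * (N%:R / n%:R) ^+ 2 :> K by rewrite mulr_ge0// exprn_ge0.
  by rewrite expr2; nra.
have half : 1 / 2 <= (1 - N%:R / n%:R) ^+ N :> K.
  apply: le_trans (B N).
  suff : N%:R * (N%:R / n%:R) <= 1 / 2 :> K by lra.
  rewrite mulrA ler_pdivrMr//.
  have : (2 * N ^ 2)%:R <= n%:R :> K by rewrite ler_nat.
  by rewrite natrM natrX expr2; lra.
have E1 : n%:R ^+ N * (1 - N%:R / n%:R) ^+ N = ((n - N) ^ N)%:R :> K.
  rewrite -exprMn natrX natrB//; congr (_ ^+ _); field.
  by rewrite gt_eqF.
have : n%:R ^+ N * (1 / 2) <= (n ^_ N)%:R :> K.
  apply: le_trans (_ : ((n - N) ^ N)%:R <= _); last by rewrite ler_nat.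
  by rewrite -E1 ler_pM2l ?exprn_gt0.
by lra.
Qed.

Lemma copies_gt0 : 0 < M.
Proof.
have := card_copies_ge (ltnW m3) p3 l4 n0.
rewrite ltr0n; case: #|C| => //; rewrite mul0n leqn0 muln_eq0 expn_eq0.
by rewrite -leqn0 leqNgt ffact_gt0 Nn -leqn0 leqNgt fact_gt0.
Qed.

Lemma null_ratio_ge0 : 0 <= null_ratio.
Proof.
by rewrite /null_ratio divr_ge0 ?exprn_ge0// mulr_ge0 ?exprn_ge0 ?ltW// copies_gt0.
Qed.

(** The l-th power of [theta] yields 2^l, against which stand the E roots and the 2 of
    [exp_le_ffact]; by [sqr_le_exp2], 2E / 2^l is at most 8m / l. *)
Lemma null_ratio_le : null_ratio <= 8 * m%:R / l%:R.
Proof.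
have F0 : 0 < F by rewrite ltr0n fact_gt0.
have M0 := copies_gt0.
have lam0 : 0 < lambda ^+ (4 * m) by rewrite exprn_gt0.
have H := card_copies_ge (ltnW m3) p3 l4 n0.
have {}H : (n ^_ N)%:R * F ^+ l <= M * (E%:R * (p`!)%:R ^+ E).
  by rewrite -!natrX -!natrM ler_nat.
have l0 : 0 < l%:R :> K by rewrite ltr0n; lia.
have th := theta.
set Q := (p`!)%:R ^+ (2 * m) in th *; set G := lambda ^+ (4 * m) in lam0 th *.
have Q0 : 0 < Q by rewrite exprn_gt0// ltr0n fact_gt0.
have HQ : (p`!)%:R ^+ E = Q ^+ l by rewrite /Q exprM.
have HG : lambda ^+ (4 * m * l) = G ^+ l by rewrite /G exprM.
have E0 : 0 < E%:R :> K.
  by rewrite ltr0n !muln_gt0 (ltnW (ltnW m3)) (ltnW (ltnW (ltnW l4))).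
have H2 : 2 ^+ l * Q ^+ l <= G ^+ l * F ^+ l.
  by rewrite -!exprMn; apply: lerXn2r => //; rewrite nnegrE mulr_ge0// ltW.
have Gl : 0 < G ^+ l by rewrite exprn_gt0.
have Fl : 0 < F ^+ l by rewrite exprn_gt0.
have Ql : 0 < Q ^+ l by rewrite exprn_gt0.
have T0 : 0 < 2 ^+ l :> K by rewrite exprn_gt0.
have H3 : n%:R ^+ N * 2 ^+ l <= 2 * E%:R * (G ^+ l * M).
  rewrite -(ler_pM2r Fl).
  apply: (@le_trans _ _ (2 * ((n ^_ N)%:R * F ^+ l) * 2 ^+ l)).
    have -> : 2 * ((n ^_ N)%:R * F ^+ l) * 2 ^+ l = 2 * (n ^_ N)%:R * (2 ^+ l * F ^+ l).
      by move: ((n ^_ N)%:R) (F ^+ l) (2 ^+ l) => *; ring.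
    rewrite -[leLHS]mulrA; apply: ler_wpM2r; last exact: exp_le_ffact.
    by rewrite mulr_ge0 ?ltW.
  apply: (@le_trans _ _ (2 * (M * (E%:R * Q ^+ l)) * 2 ^+ l)).
    by rewrite ler_pM2r// ler_pM2l// -HQ.
  have -> : 2 * (M * (E%:R * Q ^+ l)) * 2 ^+ l = 2 * E%:R * M * (2 ^+ l * Q ^+ l).
    by move: M (E%:R) (Q ^+ l) (2 ^+ l) => *; ring.
  have -> : 2 * E%:R * (G ^+ l * M) * F ^+ l = 2 * E%:R * M * (G ^+ l * F ^+ l).
    by move: M (E%:R) (G ^+ l) (F ^+ l) => *; ring.
  by rewrite ler_pM2l// !mulr_gt0.
have H4 : E%:R * l%:R <= 4 * m%:R * 2 ^+ l :> K.
  rewrite -natrX -!natrM ler_nat; have := sqr_le_exp2 l; rewrite -mulnn => h.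
  have -> : (4 * m * 2 ^ l = 2 * m * (2 * 2 ^ l))%N by rewrite mulnACA mulnA.
  by rewrite -mulnA leq_mul.
rewrite /null_ratio HG ler_pdivrMr ?mulr_gt0// mulrAC ler_pdivlMr//.
rewrite -(ler_pM2r T0).
apply: (@le_trans _ _ (2 * E%:R * (G ^+ l * M) * l%:R)).
  have -> : n%:R ^+ N * l%:R * 2 ^+ l = n%:R ^+ N * 2 ^+ l * l%:R :> K.
    by move: (n%:R ^+ N) (l%:R) (2 ^+ l) => *; ring.
  by rewrite ler_pM2r.
have -> : 2 * E%:R * (G ^+ l * M) * l%:R = 2 * (G ^+ l * M) * (E%:R * l%:R).
  by move: (G ^+ l) M (E%:R) (l%:R) => *; ring.
have -> : 8 * m%:R * (G ^+ l * M) * 2 ^+ l = 2 * (G ^+ l * M) * (4 * m%:R * 2 ^+ l) :> K.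
  by move: (G ^+ l) M (m%:R) (2 ^+ l) => *; ring.
by rewrite ler_pM2l// mulr_gt0// mulr_gt0.
Qed.

(** After division by M^2 the diagonal gives B^E / M. Writing B = (1 + lambda^2 / y^p) y^p /
    lambda^2, the first factor to the power E is at most e and the second becomes n^N / lambda^(2E).
    In the partial overlaps the saved 1/y pays for 2^E, N^(pE) and (1 + lambda^2)^E, which leaves
    one more [null_ratio]. *)
Lemma planted_ratio_le :
  (2 * (1 + lambda ^+ 2)) ^+ E * (N ^ (p * E))%:R <= y ->
  E%:R * lambda ^+ 2 <= y ->
  planted_ratio <= (expR 1 + 1) * null_ratio.
Proof.
move=> Hy1 Hy2; have M0 := copies_gt0; have r0 := null_ratio_ge0.
have n1 : (1 : K) <= n%:R by rewrite ler1n.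
have yn : y ^+ 2 = n%:R by rewrite sqr_sqrtr// ler0n.
have y1 : 1 <= y.
  by have : Num.sqrt 1 <= y; [rewrite ler_sqrt ?ltr0n|rewrite sqrtr1].
have y0 : 0 < y by apply: lt_le_trans y1.
have lam2 : 0 < lambda ^+ 2 by rewrite exprn_gt0.
have ilam : 0 < lambda ^- 2 by rewrite invr_gt0.
set B := 1 + lambda ^- 2 * y ^+ p; set L := 1 + lambda ^- 2.
have yp0 : 0 < y ^+ p by rewrite exprn_gt0.
have yp1 : 1 <= y ^+ p by rewrite exprn_ege1.
have B1 : 1 <= B by rewrite lerDl mulr_ge0 ?ltW.
have L1 : 1 <= L by rewrite lerDl ltW.
have BL : B <= L * y ^+ p by rewrite /L mulrDl mul1r lerD2r.
have := @overlap_sum_le K n m p l (ltnW (ltnW m3)) p3 l4 n0 y B L yn y1 L1 B1 BL.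
have PE : (p * E = 2 * N)%N by rewrite mulnCA !mulnA.
have yPE : y ^+ (p * E) = n%:R ^+ N by rewrite PE exprM yn.
have lamE : lambda ^+ (4 * m * l) = (lambda ^+ 2) ^+ E by rewrite -exprM !mulnA.
have lE0 : 0 < (lambda ^+ 2) ^+ E by rewrite exprn_gt0.
set Z := 2 ^+ E * _ => H.
have T1 : B ^+ E <= expR 1 * null_ratio * M.
  have -> : B = (1 + lambda ^+ 2 / y ^+ p) * ((lambda ^+ 2)^-1 * y ^+ p).
    by rewrite /B; field; rewrite !gt_eqF.
  rewrite exprMn; have -> : expR 1 * null_ratio * M = expR 1 * ((lambda ^+ 2)^-1 * y ^+ p) ^+ E.
    have -> : ((lambda ^+ 2)^-1 * y ^+ p) ^+ E = n%:R ^+ N / (lambda ^+ 2) ^+ E.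
      by rewrite exprMn_comm; [rewrite exprVn -[y ^+ p ^+ E]exprM yPE mulrC|exact: mulrC].
    rewrite /null_ratio lamE.
    by move: ((lambda ^+ 2) ^+ E) lE0 (n%:R ^+ N) M M0 (expR 1) => u u0 v w w0 z; field; rewrite !gt_eqF.
  apply: ler_wpM2r; first by apply: exprn_ge0; apply: mulr_ge0; apply: ltW.
  apply: le_trans (_ : expR (lambda ^+ 2 / y ^+ p) ^+ E <= _).
    apply: lerXn2r; rewrite ?nnegrE ?expR_ge0 ?expR_ge1Dx//.
    by apply: addr_ge0 => //; apply: divr_ge0; apply: ltW.
  rewrite -expRM_natr ler_expR mulrAC ler_pdivrMr// mul1r mulrC.
  apply: le_trans Hy2 _; rewrite -[leLHS]expr1; apply: ler_weXn2l => //.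
  exact: ltnW (ltnW p3).
have T2 : Z <= null_ratio * M.
  rewrite /Z; set W := (N ^ (p * E))%:R : K.
  have -> : 2 ^+ E * (L ^+ E * W * n%:R ^+ N / y) =
    ((2 * (1 + lambda ^+ 2)) ^+ E * W) / y * (n%:R ^+ N / (lambda ^+ 2) ^+ E).
    have hL : L ^+ E = (1 + lambda ^+ 2) ^+ E / (lambda ^+ 2) ^+ E.
      by rewrite -expr_div_n; congr (_ ^+ _); rewrite /L; field; rewrite gt_eqF.
    have gen (u v w z t s : K) : 0 < w -> 0 < s ->
      u * (v / w * z * t / s) = u * v * z / s * (t / w).
      by move=> w0 s0; field; rewrite !gt_eqF.
    by rewrite hL [in RHS]exprMn; exact: gen.
  have -> : null_ratio * M = 1 * (n%:R ^+ N / (lambda ^+ 2) ^+ E).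
    rewrite /null_ratio lamE.
    by move: ((lambda ^+ 2) ^+ E) lE0 (n%:R ^+ N) M M0 => u u0 v w w0; field; rewrite !gt_eqF.
  apply: ler_wpM2r; first by apply: divr_ge0; [exact: exprn_ge0|exact: ltW].
  by rewrite ler_pdivrMr// mul1r.
have M20 : 0 < M ^+ 2 by rewrite exprn_gt0.
rewrite /planted_ratio; under eq_bigr do rewrite -mulr_suml.
rewrite -mulr_suml lerBlDr ler_pdivrMr//; apply: le_trans H _.
apply: (@le_trans _ _ (M ^+ 2 + M * (expR 1 * null_ratio * M) + M * (null_ratio * M))).
  by apply: lerD; [apply: lerD => //|]; apply: ler_wpM2l => //; exact: ltW.
by rewrite le_eqVlt; apply/orP; left; apply/eqP; ring.
Qed.

End Ratios.

(** * The second moment method *)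

Section Markov.
Context d (T : measurableType d) (K : realType) (P : probability T K).

Lemma has_mean_markov (Z : T -> K) (z : K) (A : set T) (t : K) : has_mean P Z z ->
  (forall w, 0 <= Z w) -> measurable A -> 0 < t -> (forall w, A w -> t <= Z w) ->
  (P A <= (z / t)%:E)%E.
Proof.
move=> [iZ eZ] Z0 mA t0 At.
have mZ : measurable_fun setT (EFin \o Z) := measurable_int _ iZ.
have mA1 : measurable_fun setT (fun w => t * \1_A w).
  by apply: measurable_funM; [exact: measurable_cst | exact: measurable_indic].
have H : (\int[P]_w (t * \1_A w)%:E <= \int[P]_w (Z w)%:E)%E.
  apply: ge0_le_integral => //.
  - by move=> w _; rewrite lee_fin mulr_ge0 ?(ltW t0)// indicE ler0n.
  - exact/measurable_EFinP.
  - move=> w _; rewrite lee_fin indicE; case: (boolP (w \in A)) => wA.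
      by rewrite mulr1; apply: At; exact/set_mem.
    by rewrite mulr0.
move: H; rewrite eZ.
under eq_integral do rewrite EFinM.
rewrite ge0_integralZl//; last first.
- by rewrite lee_fin ltW.
- exact/measurable_EFinP.
rewrite integral_indic// setIT => H.
have {H} : (t%:E * P A <= z%:E)%E by [].
have /fineK <- : P A \is a fin_num by rewrite fin_num_measure.
rewrite -EFinM !lee_fin => H.
by rewrite ler_pdivlMr// mulrC.
Qed.

Lemma measurable_le_event (X : T -> K) (c : K) : measurable_fun setT X ->
  measurable [set w | X w <= c].
Proof.
move=> mX; have := mX measurableT `]-oo, c] (measurable_itv _).
by rewrite setTI; congr measurable; apply/seteqP; split=> w /=; rewrite in_itv.
Qed.

Lemma measurable_ge_event (X : T -> K) (c : K) : measurable_fun setT X ->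
  measurable [set w | c <= X w].
Proof.
move=> mX; have := mX measurableT `[c, +oo[ (measurable_itv _).
by rewrite setTI; congr measurable; apply/seteqP; split=> w /=; rewrite in_itv/= andbT.
Qed.

(** Chebyshev: on the event, X deviates from mu by at least (1 - C) mu. As [v] is the second moment,
    v / mu^2 - 1 is the relative variance. *)
Lemma lower_tail_le (X : T -> K) (mu v C : K) : has_mean P X mu ->
  has_mean P (fun w => X w * X w) v -> 0 < mu -> 0 < C < 1 ->
  (P [set w | (X w <= C * mu)%R] <= ((v / mu ^+ 2 - 1) / (1 - C) ^+ 2)%:E)%E.
Proof.
move=> H1 H2 mu0 /andP[C0 C1].
have Hv : has_mean P (fun w => (X w - mu) ^+ 2) (v - mu ^+ 2).
  have := has_meanD H2 (has_meanD (has_meanZ (- 2 * mu) H1) (has_mean_cst P (mu ^+ 2))).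
  by apply: has_mean_eq => [w|]; ring.
have t0 : 0 < ((1 - C) * mu) ^+ 2 by rewrite exprn_gt0// mulr_gt0// subr_gt0.
have := has_mean_markov Hv (fun w => sqr_ge0 _)
  (measurable_le_event (C * mu) (has_mean_measurable H1)) t0.
have -> : (v - mu ^+ 2) / ((1 - C) * mu) ^+ 2 = (v / mu ^+ 2 - 1) / (1 - C) ^+ 2.
  by field; rewrite !gt_eqF// subr_gt0.
apply => w /= Xw.
have : (1 - C) * mu <= mu - X w by lra.
have : 0 <= (1 - C) * mu by rewrite mulr_ge0 ?ltW// subr_gt0.
by move: ((1 - C) * mu) => u; rewrite !expr2; nra.
Qed.

Lemma upper_tail_le (X : T -> K) (mu v C : K) : measurable_fun setT X ->
  has_mean P (fun w => X w * X w) v -> 0 < mu -> 0 < C ->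
  (P [set w | (C * mu <= X w)%R] <= (v / mu ^+ 2 / C ^+ 2)%:E)%E.
Proof.
move=> mX H2 mu0 C0.
have t0 : 0 < (C * mu) ^+ 2 by rewrite exprn_gt0// mulr_gt0.
have := has_mean_markov H2 (fun w => _) (measurable_ge_event (C * mu) mX) t0.
have -> : v / (C * mu) ^+ 2 = v / mu ^+ 2 / C ^+ 2 by field; rewrite !gt_eqF.
apply=> w /=; first by rewrite -expr2 sqr_ge0.
have : 0 < C * mu by rewrite mulr_gt0.
by move: (C * mu) => u; rewrite expr2; nra.
Qed.

End Markov.

(** * Moments of the statistic and error bounds for fixed n *)

Section Detection.
Context d (T : measurableType d) (K : realType) (P : probability T K) (n m p l : nat).
Variables (W : {ffun 'I_p -> 'I_n} -> {RV P >-> K}) (x : 'I_n -> {RV P >-> K}) (lambda C : K).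
Hypotheses (model : tensor_pca_model W x) (m3 : (3 <= m)%N) (p3 : (3 <= p)%N) (l4 : (4 <= l)%N).
Hypotheses (lambda0 : 0 < lambda) (C01 : 0 < C < 1).
Local Notation N := (m * p * l)%N.
Local Notation E := (2 * m * l)%N.
Local Notation D := (copies n m p l).
Local Notation M := (#|D|%:R : K).
Local Notation y := (Num.sqrt n%:R : K).
Local Notation a := (spike_strength n p lambda).
Hypothesis nN : (2 * N ^ 2 <= n)%N.

Let n_gt0 : (0 < n)%N.
Proof.
apply: leq_trans nN; rewrite muln_gt0 expn_gt0 !muln_gt0.
by rewrite (ltnW (ltnW m3)) (ltnW (ltnW p3)) (ltnW (ltnW (ltnW l4))).
Qed.

Let M_gt0 : 0 < M. Proof. exact: (copies_gt0 K m3 p3 l4 nN). Qed.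

(** Passage from the real power n^(-p/4) to the integer powers of sqrt n in which the ratios are
    expressed. *)
Lemma sqr_spike : a ^+ 2 = lambda ^+ 2 / y ^+ p.
Proof.
rewrite exprMn; congr (_ * _).
rewrite -powR_mulrn ?sqrtr_ge0// -powR_mulrn ?powR_ge0// -powR12_sqrt ?ler0n//.
by rewrite -!powRrM -powRN; congr powR; field.
Qed.

Lemma spike_gt0 : 0 < a.
Proof. by rewrite mulr_gt0// powR_gt0// ltr0n. Qed.

(** One member of the transversal with its identity automorphism suffices. Positivity makes the
    normalising constant [c] nonzero, and it then cancels from all ratios. *)
Lemma beta_gt0 : 0 < beta K m p l.
Proof.
have /card_gt0P[S] : (0 < #|D|)%N by rewrite -(ltr0n K).
move=> /copiesP[H HC _]; rewrite /beta (bigD1 H)//= ltr_wpDr//.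
  by apply: sumr_ge0 => H' _; rewrite invr_ge0.
rewrite invr_gt0 ltr0n; apply/card_gt0P; exists 1%g; rewrite inE.
apply/forallP => B; suff -> : [set (1%g : {perm vertex H}) u | u in B]%SET = B by [].
by apply/setP => u; apply/imsetP/idP => [[v vB ->]|uB]; [|exists u]; rewrite ?perm1.
Qed.

Let c : K := (Num.sqrt (n%:R ^+ N * beta K m p l))^-1.

Let c_gt0 : 0 < c.
Proof. by rewrite invr_gt0 sqrtr_gt0 mulr_gt0 ?beta_gt0// exprn_gt0// ltr0n. Qed.

Lemma f_calHE (Y : tensor K n p) :
  f_calH m l Y = c * \sum_(S in D) \prod_(e in edges S) tensor_at Y e.
Proof. by rewrite /f_calH sum_copies. Qed.

Let even_copies S : S \in D -> even_edges p (edges S).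
Proof.
move=> SD; have gS := copies_good p3 l4 SD; split; first exact: good_card gS.
by move=> v; exact: good_even gS v.
Qed.

Let mu : K := c * (M * a ^+ E).

Let mu_gt0 : 0 < mu.
Proof. by rewrite !mulr_gt0 ?exprn_gt0 ?spike_gt0. Qed.

Lemma has_mean_planted : has_mean P (fun w => f_calH m l (Y_P lambda W x w)) mu.
Proof.
have e0 : even_edges p (finset.set0 : {set {set 'I_n}}).
  split=> [e|v]; first by rewrite inE.
  by rewrite eq_card0// => e; rewrite !inE.
have H S (SD : S \in D) := has_mean_spiked_pair model n_gt0 lambda (even_copies SD) e0.
have := has_meanZ c (has_mean_sum (index_enum _) H).
apply: has_mean_eq => [w|].
  by rewrite f_calHE; congr (_ * _); apply: eq_bigr => S _; rewrite big_set0 mulr1.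
congr (_ * _); rewrite mulr_natl -sumr_const; apply: eq_bigr => S SD.
rewrite finset.setI0 cards0 expr0 mul1r muln0 subn0 addn0.
by rewrite (good_edges (copies_good p3 l4 SD)).
Qed.

Lemma has_mean_planted_sqr :
  has_mean P (fun w => f_calH m l (Y_P lambda W x w) * f_calH m l (Y_P lambda W x w))
    (mu ^+ 2 * (planted_ratio n m p l lambda + 1)).
Proof.
have H S S' (SD : S \in D) (SD' : S' \in D) :=
  has_mean_spiked_pair model n_gt0 lambda (even_copies SD) (even_copies SD').
have := has_meanZ (c * c) (has_mean_sum (index_enum _) (fun S SD =>
  has_mean_sum (index_enum _) (fun S' SD' => H S S' SD SD'))).
apply: has_mean_eq => [w|].
  rewrite !f_calHE mulrACA; congr (_ * _).
  by rewrite mulr_suml; apply: eq_bigr => S _; rewrite mulr_sumr.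
have a0 := spike_gt0.
have y0 : 0 < y by rewrite sqrtr_gt0 ltr0n.
rewrite /planted_ratio subrK !mulr_sumr; apply: eq_bigr => S SD.
rewrite !mulr_sumr; apply: eq_bigr => S' SD'.
rewrite (good_edges (copies_good p3 l4 SD)) (good_edges (copies_good p3 l4 SD')).
set j := #|_|.
have jE : (j <= E)%N.
  rewrite -(good_edges (copies_good p3 l4 SD)); apply: subset_leq_card.
  exact: finset.subsetIl.
have -> : 1 + lambda ^- 2 * y ^+ p = (1 + a ^+ 2) / a ^+ 2.
  by rewrite sqr_spike; field; rewrite !gt_eqF// exprn_gt0.
have -> : a ^+ (E + E - 2 * j) = a ^+ E ^+ 2 / (a ^+ 2) ^+ j.
  have aj : a ^+ (2 * j) != 0 by rewrite expf_neq0// gt_eqF.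
  apply: (mulIf aj); rewrite -exprD subnK; last by rewrite addnn -mul2n leq_mul2l.
  rewrite -[(a ^+ 2) ^+ j]exprM divfK//.
  by rewrite -exprM muln2 addnn.
rewrite expr_div_n /mu.
have aj : (a ^+ 2) ^+ j != 0 by rewrite !expf_neq0// gt_eqF.
have gen (u v w : K) : w != 0 -> M != 0 ->
    c * c * (u * (v ^+ 2 / w)) = (c * (M * v)) ^+ 2 * (u / w / M ^+ 2).
  by move=> w0 M0; field; rewrite w0 M0.
by apply: gen => //; rewrite gt_eqF.
Qed.

Lemma has_mean_null_sqr :
  has_mean P (fun w => f_calH m l (Y_Q W w) * f_calH m l (Y_Q W w))
    (mu ^+ 2 * null_ratio n m p l lambda).
Proof.
have H S S' (SD : S \in D) (SD' : S' \in D) :=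
  has_mean_noise_pair model n_gt0 (even_copies SD).1 (even_copies SD').1.
have := has_meanZ (c * c) (has_mean_sum (index_enum _) (fun S SD =>
  has_mean_sum (index_enum _) (fun S' SD' => H S S' SD SD'))).
apply: has_mean_eq => [w|].
  rewrite !f_calHE mulrACA; congr (_ * _).
  by rewrite mulr_suml; apply: eq_bigr => S _; rewrite mulr_sumr.
have -> : \sum_(S in D) \sum_(S' in D) (edges S == edges S')%:R = M :> K.
  rewrite -[RHS]mulr1 mulr_natl -sumr_const; apply: eq_bigr => S SD.
  rewrite (bigD1 S)//= eqxx big1 ?addr0// => S' /andP[S'D S'S].
  case: eqP => // ES; move: S'S; rewrite (copies_inj p3 l4 SD S'D ES).
  by rewrite eqxx.
have y0 : 0 < y by rewrite sqrtr_gt0 ltr0n.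
have -> : mu ^+ 2 = c ^+ 2 * M ^+ 2 * (a ^+ 2) ^+ E.
  rewrite -exprM [(2 * E)%N]mulnC exprM /mu.
  have gen (u v w : K) : (u * (v * w)) ^+ 2 = u ^+ 2 * v ^+ 2 * w ^+ 2 by ring.
  exact: gen.
have PE : (p * E = 2 * N)%N by rewrite mulnCA !mulnA.
have yn : y ^+ 2 = n%:R by rewrite sqr_sqrtr// ler0n.
have yE : (y ^+ p) ^+ E = n%:R ^+ N by rewrite -exprM PE exprM yn.
rewrite sqr_spike expr_div_n yE /null_ratio.
have -> : lambda ^+ (4 * m * l) = (lambda ^+ 2) ^+ E by rewrite -exprM !mulnA.
have gen (u v : K) : 0 < u -> 0 < v -> 0 < M ->
    c * c * M = c ^+ 2 * M ^+ 2 * (u / v) * (v / (u * M)).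
  by move=> u0 v0 M0; field; rewrite !gt_eqF.
by apply: gen => //; rewrite !exprn_gt0// ltr0n.
Qed.

Lemma has_mean_null : has_mean P (fun w => f_calH m l (Y_Q W w)) 0.
Proof.
have e0 (e : {set 'I_n}) : e \in (finset.set0 : {set {set 'I_n}}) -> #|e| = p.
  by rewrite inE.
have E0 S (SD : S \in D) := has_mean_noise_pair model n_gt0 (even_copies SD).1 e0.
have := has_meanZ c (has_mean_sum (index_enum _) E0).
apply: has_mean_eq => [w|].
  by rewrite f_calHE; congr (_ * _); apply: eq_bigr => S _; rewrite big_set0 mulr1.
rewrite big1 ?mulr0// => S SD; case: eqP => // ES.
have E_gt0 : (0 < E)%N.
  by rewrite !muln_gt0 (ltnW (ltnW m3)) (ltnW (ltnW (ltnW l4))).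
by move: E_gt0; rewrite -(good_edges (copies_good p3 l4 SD)) ES cards0.
Qed.

Lemma thresholdE : threshold m l C lambda W x = (C * mu)%:E.
Proof. by rewrite /threshold unlock; have [_ ->] := has_mean_planted; rewrite EFinM. Qed.

Lemma detection_le :
  (P [set w | ((f_calH m l (Y_P lambda W x w))%:E <= threshold m l C lambda W x)%E] +
   P [set w | (threshold m l C lambda W x <= (f_calH m l (Y_Q W w))%:E)%E] <=
   (planted_ratio n m p l lambda / (1 - C) ^+ 2 + null_ratio n m p l lambda / C ^+ 2)%:E)%E.
Proof.
rewrite thresholdE EFinD.
have mu2 : mu ^+ 2 != 0 by rewrite expf_neq0// gt_eqF.
have C0 : 0 < C by case/andP: C01.
apply: leeD.
  have := lower_tail_le has_mean_planted has_mean_planted_sqr mu_gt0 C01.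
  rewrite [_ / mu ^+ 2]mulrAC mulfV// mul1r addrK.
  by under [X in (P X <= _)%E]eq_set do rewrite -lee_fin.
have := upper_tail_le (has_mean_measurable has_mean_null) has_mean_null_sqr mu_gt0 C0.
rewrite [_ / mu ^+ 2]mulrAC mulfV// mul1r.
by under [X in (P X <= _)%E]eq_set do rewrite -lee_fin.
Qed.

(** The test answers false when the statistic is strictly below the threshold, an event contained in
    the one with the weak inequality. *)
Lemma test_le :
  (P [set w | test m l (threshold m l C lambda W x) (Y_P lambda W x w) = false] <=
   P [set w | ((f_calH m l (Y_P lambda W x w))%:E <= threshold m l C lambda W x)%E])%E.
Proof.
have mX := has_mean_measurable has_mean_planted.
rewrite thresholdE; apply: le_measure; rewrite ?inE.
- have := measurableC (measurable_ge_event (C * mu) mX).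
  congr measurable; apply/seteqP; split => w /=; rewrite /test lee_fin.
    by move/negP/negbTE.
  by move=> ->.
- have := measurable_le_event (C * mu) mX.
  by congr measurable; apply/seteqP; split => w /=; rewrite lee_fin.
move=> w /=; rewrite /test !lee_fin => /negbT; rewrite -ltNge; exact: ltW.
Qed.

End Detection.

Section GrowthBounds.
Variable K : realType.

(** The self-power of x = D l dominates all error terms: the constant factor of a block is at most
    D, so its l-th power is at most x^l; moreover N^(pE) = N^(2N) <= x^(2N), and l + 2N <= x. *)
Lemma self_power_bounds (m p l D n : nat) (lambda : K) :
  (0 < l)%N -> (2 * m * p < D)%N -> (2 <= D)%N ->
  (2 * (1 + lambda ^+ 2)) ^+ (2 * m) <= D%:R ->
  (2 * m)%:R * lambda ^+ 2 <= D%:R ->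
  ((D * l) ^ (D * l))%:R <= Num.sqrt n%:R :> K ->
  let N := (m * p * l)%N in let E := (2 * m * l)%N in
  [/\ (2 * N ^ 2 <= n)%N,
      (2 * (1 + lambda ^+ 2)) ^+ E * (N ^ (p * E))%:R <= Num.sqrt n%:R &
      E%:R * lambda ^+ 2 <= Num.sqrt n%:R].
Proof.
move=> l0 Dmp D2 HA HB Hx N E; set x := (D * l)%N in Hx *.
have Dx : (D <= x)%N by rewrite leq_pmulr.
have x2 : (2 <= x)%N := leq_trans D2 Dx.
have x0 : (0 < x)%N := ltnW x2.
have Nx : (l + 2 * N <= x)%N.
  have -> : (l + 2 * N = (2 * m * p).+1 * l)%N by rewrite [RHS]mulSn !mulnA.
  by rewrite leq_mul2r Dmp orbT.
have N2x : (2 * N <= x)%N := leq_trans (leq_addl _ _) Nx.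
have xx : (x <= x ^ x)%N by rewrite -[X in (X <= _)%N]expn1 leq_pexp2l.
have PE : (p * E = 2 * N)%N by rewrite mulnCA !mulnA.
split.
- rewrite -(ler_nat K); apply: (@le_trans _ _ (Num.sqrt n%:R)).
    apply: le_trans Hx; rewrite ler_nat.
    apply: (@leq_trans (x ^ 2)); last by rewrite leq_pexp2l.
    apply: (@leq_trans ((2 * N) ^ 2)); last by rewrite leq_exp2r.
    by rewrite expnMn leq_mul2r orbT.
  have y1 : 1 <= Num.sqrt n%:R :> K.
    by apply: le_trans Hx; rewrite ler1n expn_gt0 x0.
  have {2}<- : Num.sqrt n%:R ^+ 2 = n%:R :> K by rewrite sqr_sqrtr.
  by rewrite expr2 ler_peMl// (le_trans ler01).
- apply: le_trans Hx; apply: (@le_trans _ _ (x ^ l * x ^ (2 * N))%:R); last first.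
    by rewrite ler_nat -expnD leq_pexp2l.
  rewrite natrM; apply: ler_pM; rewrite ?exprn_ge0 ?mulr_ge0 ?addr_ge0 ?sqr_ge0//.
    rewrite exprM natrX; apply: lerXn2r; rewrite ?nnegrE ?ler0n//.
      by rewrite exprn_ge0// mulr_ge0// addr_ge0// sqr_ge0.
    by apply: le_trans HA _; rewrite ler_nat.
  rewrite PE ler_nat; have [->|N0] := posnP (2 * N)%N; first by rewrite !expn0.
  by rewrite leq_exp2r//; apply: leq_trans N2x; rewrite leq_pmull.
apply: le_trans Hx; apply: (@le_trans _ _ x%:R); last by rewrite ler_nat.
rewrite natrM mulrAC [leRHS]natrM; apply: ler_wpM2r => //; exact: ler0n.
Qed.

Lemma near_self_power_bounds (ell : nat -> nat) (m p : nat) (lambda : K) :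
  ell @ \oo --> \oo ->
  (fun n => (ell n)%:R : K) =o_\oo (fun n => ln n%:R / ln (ln n%:R) : K) ->
  \forall n \near \oo, let l := ell n in
    let N := (m * p * l)%N in let E := (2 * m * l)%N in
    [/\ (4 <= l)%N, (2 * N ^ 2 <= n)%N,
      (2 * (1 + lambda ^+ 2)) ^+ E * (N ^ (p * E))%:R <= Num.sqrt n%:R &
      E%:R * lambda ^+ 2 <= Num.sqrt n%:R].
Proof.
move=> ell_oo ell_o.
pose A : K := (2 * (1 + lambda ^+ 2)) ^+ (2 * m); pose B : K := (2 * m)%:R * lambda ^+ 2.
(* A sum, so that [D] dominates [A], [B] and 2mp + 2 at once. *)
pose D := (Num.bound A + Num.bound B + (2 * m * p).+2)%N.
have A0 : 0 <= A by rewrite exprn_ge0// mulr_ge0// addr_ge0// sqr_ge0.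
have B0 : 0 <= B by rewrite mulr_ge0// sqr_ge0.
have AD : A <= D%:R.
  by apply/ltW/(lt_le_trans (archi_boundP A0)); rewrite ler_nat /D -addnA leq_addr.
have BD : B <= D%:R.
  apply/ltW/(lt_le_trans (archi_boundP B0)).
  by rewrite ler_nat /D addnAC leq_addl.
have mpD : (2 * m * p < D)%N by rewrite /D addnS ltnS addnS leqW// leq_addl.
have D2 : (2 <= D)%N by rewrite /D !addnS.
have l4 : \forall n \near \oo, (4 <= ell n)%N.
  exact: ell_oo (nbhs_infty_ge 4).
have Hx := self_power_le_sqrt D ell_o.
near=> n.
have h4 : (4 <= ell n)%N by near: n.
have [] // := @self_power_bounds m p (ell n) D n lambda _ mpD D2 AD BD.
  exact: leq_trans h4.
by near: n.
Unshelve. all: by end_near. Qed.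

End GrowthBounds.

Theorem theorem2p6 (K : realType) :
  exists2 R : K, 0 < R &
  forall (p m : nat) (lambda : K) (ell : nat -> nat) (C : K)
    (d : nat -> measure_display) (T : forall n, measurableType (d n))
    (P : forall n, probability (T n) K)
    (W : forall n, {ffun 'I_p -> 'I_n} -> {RV (P n) >-> K})
    (x : forall n, 'I_n -> {RV (P n) >-> K}),
  (3 <= p)%N ->
  10 ^+ 11 * R ^+ 3 <= m%:R ->
  0 < lambda ->
  10 ^+ (p * m) * R <
    lambda ^+ (4 * m) * ((2 * p * m)`!)%:R /
    (2 ^+ (p * m) * (p`!)%:R ^+ (2 * m) * ((m * p)`!)%:R * ((2 * m)`!)%:R) ->
  ell @ \oo --> \oo ->
  (fun n => (ell n)%:R : K) =o_\oo (fun n => ln n%:R / ln (ln n%:R) : K) ->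
  0 < C < 1 ->
  (forall n, tensor_pca_model (W n) (x n)) ->
  let f n := @f_calH K n m p (ell n) in
  let tau n := threshold m (ell n) C lambda (W n) (x n) in
  let YP n := Y_P lambda (W n) (x n) in
  let YQ n := Y_Q (W n) in
  let A n := @test K n m p (ell n) (tau n) in
  ((P n [set w | ((f n (YP n w))%:E <= tau n)%E] +
    P n [set w | (tau n <= (f n (YQ n w))%:E)%E])%E @[n --> \oo] --> 0%E) /\
  ((P n [set w | A n (YP n w) = false] +
    P n [set w | A n (YQ n w) = true])%E @[n --> \oo] --> 0%E).
Proof.
(* The power of 10 in the signal condition covers every loss in the counting, so the absolute
   constant can be 1. *)
exists 1 => //.
move=> p m lambda ell C d T P W x p3 m_large lambda0 signal ell_oo ell_o C01 model f tau YP YQ A.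
have m3 : (3 <= m)%N.
  rewrite -(ler_nat K); apply: le_trans m_large; rewrite expr1n mulr1.
  apply: (@le_trans _ _ (10 ^+ 1)); first by rewrite expr1 ler_nat.
  by apply: ler_weXn2l => //; rewrite ler1n.
rewrite mulr1 in signal.
have theta := threshold_condition m3 p3 lambda0 signal.
have near_bounds := near_self_power_bounds m p lambda ell_oo ell_o.
have [C0 C1] := andP C01.
(* The two tail bounds give 1 / (1 - C)^2 and 1 / C^2, [planted_ratio_le] gives e + 1, and
   [null_ratio_le] gives 8m and the rate 1 / ell. *)
pose B : K := ((expR 1 + 1) / (1 - C) ^+ 2 + (C ^+ 2)^-1) * (8 * m%:R).
have lim_bound : (B * (ell n)%:R^-1)%:E @[n --> \oo] --> 0%E.
  apply: cvg_EFin; first exact: nearW.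
  rewrite -[X in _ --> X](mulr0 B); apply: cvgMr.
  have ell_gt0 : \forall n \near \oo, 0 < (ell n)%:R :> K.
    by apply: filterS near_bounds => n [l4 _ _ _]; rewrite ltr0n (leq_trans _ l4).
  by apply/(gtr0_cvgV0 ell_gt0)/cvgrnyP.
have first_le : \forall n \near \oo,
    (P n [set w | ((f n (YP n w))%:E <= tau n)%E] +
     P n [set w | (tau n <= (f n (YQ n w))%:E)%E] <= (B * (ell n)%:R^-1)%:E)%E.
  apply: filterS near_bounds => n [l4 nN H1 H2].
  apply: le_trans (detection_le (model n) m3 p3 l4 lambda0 C01 nN) _.
  have r_le := null_ratio_le m3 p3 l4 lambda0 nN theta.
  have := planted_ratio_le m3 p3 l4 lambda0 nN H1 H2.
  rewrite lee_fin; set r := null_ratio _ _ _ _ _ in r_le *.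
  set s := planted_ratio _ _ _ _ _ => s_le.
  have C2 : 0 < (C ^+ 2)^-1 by rewrite invr_gt0 exprn_gt0.
  have C3 : 0 < ((1 - C) ^+ 2)^-1 by rewrite invr_gt0 exprn_gt0// subr_gt0.
  apply: (@le_trans _ _ (((expR 1 + 1) / (1 - C) ^+ 2 + (C ^+ 2)^-1) * r)).
    have gen (u v w : K) : (u * v + w) * r = u * r * v + r * w by ring.
    by rewrite gen lerD2r ler_pM2r.
  rewrite /B -mulrA; apply: ler_wpM2l => //.
  by rewrite addr_ge0// ?mulr_ge0 ?addr_ge0 ?expR_ge0// ltW.
split.
  apply: squeeze_cvge (cvg_cst _) lim_bound.
  by apply: filterS first_le => n ->; rewrite andbT adde_ge0.
apply: squeeze_cvge (cvg_cst _) lim_bound.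
apply: filterS2 near_bounds first_le => n [l4 nN _ _] H.
(* The events under the null law agree by definition; [test_le] compares the planted ones. *)
rewrite adde_ge0//=; apply: le_trans H; apply: leeD; last by [].
exact: test_le.
Qed.
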